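(* Let $\rho\in\mathbb{R}$ and let $(P_t)_{t\ge 0}$ be a diffusion Markov semigroup. Then the following assertions are equivalent: (i) the semigroup $(P_t)_{t\ge0}$ satisfies the $CD(\rho,\infty)$ criterion; (ii) the semigroup $(P_t)_{t\ge0}$ satisfies the local logarithmic Sobolev inequality $$\mathrm{Ent}_{P_t}(f)\le \frac{1-e^{-2\rho t}}{2\rho}\,P_t\left(\frac{\Gamma(f)}{f}\right)$$ for all positive functions $f\in\mathcal A$ and all $t\ge 0$; (iii) for all $0<s\le t$ and all $1<q_1\le q_2$ such that $$\frac{q_2-1}{q_1-1}=\frac{e^{2\rho t}-1}{e^{2\rho s}-1},$$ one has $$P_s\big((P_{t-s}f)^{q_2}\big)^{1/q_2}\le P_t(f^{q_1})^{1/q_1}$$ for all positive functions $f\in\mathcal A$; (iv) for all $0<s\le t$ and all $q_1,q_2$ such that either $0<q_2\le q_1<1$ or $q_2\le q_1<0$, and such that $$\frac{q_2-1}{q_1-1}=\frac{e^{2\rho t}-1}{e^{2\rho s}-1},$$ one has $$P_t(f^{q_1})^{1/q_1}\le P_s\big((P_{t-s}f)^{q_2}\big)^{1/q_2}$$ for all positive functions $f\in\mathcal A$. If $\rho=0$, then $\frac{1-e^{-2\rho t}}{2\rho}$ is replaced by $t$ and $\frac{e^{2\rho t}-1}{e^{2\rho s}-1}$ is replaced by $\frac{t}{s}$.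
   Context: A Markov semigroup $(P_t)_{t\ge0}$ is a family of operators acting on bounded measurable functions on a measurable space $(E,\mathcal E)$, preserving positivity, with $P_t(1)=1$ and $P_t\circ P_s=P_{t+s}$. There is a reference measure $\mu$ (in general chosen invariant for the semigroup) such that $P_tf\to f$ in $L^2(\mu)$ as $t\to0$. The infinitesimal generator is $L=\partial_tP_t|_{t=0}$, so that $\partial_tP_tf=LP_tf$. One assumes the existence of a nice dense algebra $\mathcal A$ of functions on $E$ in the domain of $L$, on which the following operations are defined. The carré du champ is $\Gamma(f,g)=\frac12\big(L(fg)-fLg-gLf\big)$, with $\Gamma(f)=\Gamma(f,f)$, and $\Gamma_2(f)=\frac12\big(L\Gamma(f)-2\Gamma(f,Lf)\big)$, for $f,g\in\mathcal A$. The semigroup (or $L$) is a diffusion if $L\phi(f)=\phi'(f)Lf+\phi''(f)\Gamma(f)$ for all $f\in\mathcal A$ and $\phi\in\mathcal C^\infty(\mathbb R)$. The semigroup satisfies the curvature-dimension criterion $CD(\rho,\infty)$ if $\Gamma_2(f)\ge\rho\,\Gamma(f)$ for all $f\in\mathcal A$. For positive $f$, $\mathrm{Ent}_{P_t}(f)=P_t(f\log f)-P_tf\,\log P_tf$. Inequalities between functions on $E$ are pointwise, and $P_s(g)^{1/q}$ means $(P_s(g))^{1/q}$. *)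

(* Defs.v *)
From HB Require Import structures.
From mathcomp Require Import all_boot all_order all_algebra.
From mathcomp Require Import all_classical all_reals all_analysis.
From mathcomp Require Import measurable_realfun.
Set Implicit Arguments.
Unset Strict Implicit.
Unset Printing Implicit Defensive.
Import Order.TTheory GRing.Theory Num.Theory.
Import numFieldNormedType.Exports.
Local Open Scope classical_set_scope.
Local Open Scope ring_scope.

Section MarkovSemigroup.
Context {d : measure_display} {E : measurableType d} {R : realType}.
Implicit Types (P : R -> (E -> R) -> E -> R) (A : set (E -> R)).
Implicit Types (f g : E -> R) (t : R) (x : E).

Definition bounded_measurable f :=
  measurable_fun setT f /\ exists M : R, forall x, `|f x| <= M.

(* [P t f] is only meaningful for [0 <= t] and [f] bounded measurable. *)
Record markov_semigroup P : Prop := {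
  ms_bounded_measurable : forall t f, 0 <= t ->
    bounded_measurable f -> bounded_measurable (P t f) ;
  ms_linear : forall t (a : R) f g, 0 <= t ->
    bounded_measurable f -> bounded_measurable g ->
    P t (fun y => a * f y + g y) = (fun x => a * P t f x + P t g x) ;
  ms_positive : forall t f, 0 <= t -> bounded_measurable f ->
    (forall x, 0 <= f x) -> forall x, 0 <= P t f x ;
  ms_one : forall t, 0 <= t -> P t (fun=> 1) = (fun=> 1) ;
  ms_zero : forall f, bounded_measurable f -> P 0 f = f ;
  ms_comp : forall t s f, 0 <= t -> 0 <= s -> bounded_measurable f ->
    P t (P s f) = P (t + s) f }.

Definition square_integrable (mu : {measure set E -> \bar R}) f :=
  measurable_fun setT f /\ (\int[mu]_x ((f x) ^+ 2)%:E < +oo)%E.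

(* mu need not be invariant, nor finite. *)
Definition reference_measure P (mu : {measure set E -> \bar R}) :=
  forall f, bounded_measurable f -> square_integrable mu f ->
    (\int[mu]_x ((P t f x - f x) ^+ 2)%:E)%E @[t --> 0^'+] --> 0%E.

(* The infinitesimal generator is taken in the pointwise sense; the limit is
   meaningful on [generator_domain P] only. *)
Definition difference_quotient P f x (h : R) : R := h^-1 * (P h f x - f x).

Definition generator_domain P : set (E -> R) :=
  [set f | bounded_measurable f /\
           forall x, cvg (difference_quotient P f x h @[h --> 0^'+])].

Definition generator P f x : R :=
  lim (difference_quotient P f x h @[h --> 0^'+]).

Definition smooth (phi : R -> R) :=
  forall (n : nat) (u : R), derivable (derive1n n phi) u 1.

(* Stability of [A] under [Gamma] follows from [na_mul] and [na_generator];
   [A] contains the constants by [na_smooth]. *)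
Record nice_algebra P (mu : {measure set E -> \bar R}) A : Prop := {
  na_zero : A (fun=> 0) ;
  na_add : forall f g, A f -> A g -> A (fun x => f x + g x) ;
  na_scale : forall (a : R) f, A f -> A (fun x => a * f x) ;
  na_mul : forall f g, A f -> A g -> A (fun x => f x * g x) ;
  na_dense : forall f (e : R), square_integrable mu f -> 0 < e ->
    exists2 g, A g & (\int[mu]_x ((f x - g x) ^+ 2)%:E < e%:E)%E ;
  na_domain : A `<=` generator_domain P ;
  na_generator : forall f, A f -> A (generator P f) ;
  na_semigroup : forall t f, 0 <= t -> A f -> A (P t f) ;
  na_smooth : forall phi f, smooth phi -> A f -> A (fun x => phi (f x)) ;
  na_derive : forall t f x, 0 < t -> A f ->
    is_derive t 1 (fun s : R => P s f x) (generator P (P t f) x) ;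
  na_commute : forall t f, 0 <= t -> A f ->
    generator P (P t f) = P t (generator P f) }.

Definition Gamma P f g x : R :=
  2^-1 * (generator P (fun y => f y * g y) x
          - f x * generator P g x - g x * generator P f x).

Definition Gamma2 P f x : R :=
  2^-1 * (generator P (Gamma P f f) x - 2 * Gamma P f (generator P f) x).

Definition diffusion P A :=
  forall phi f x, smooth phi -> A f ->
    generator P (fun y => phi (f y)) x =
      derive1 phi (f x) * generator P f x + derive1n 2 phi (f x) * Gamma P f f x.

Definition curvature_dimension P A (rho : R) :=
  forall f x, A f -> rho * Gamma P f f x <= Gamma2 P f x.

(* Here [u ln u] is 0 at [u = 0], since [ln 0 = 0]. *)
Definition Ent P t f x : R :=
  P t (fun y => f y * ln (f y)) x - P t f x * ln (P t f x).

(* A function in [A] may be positive without being bounded away from 0, in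
   which case [Gamma P f f y / f y] or [f y `^ q] with [q < 0] may be unbounded.
   This is the extension of the positive operator [P t] to [0, +oo]-valued
   functions; it agrees with [P t] on bounded ones, see [extP_bounded]. *)
Definition extP P t (F : E -> \bar R) x : \bar R :=
  ereal_sup [set (P t h x)%:E | h in
    [set h | bounded_measurable h /\
             forall y, 0 <= h y /\ ((h y)%:E <= F y)%E]].

Lemma extP_bounded P t f x : markov_semigroup P -> 0 <= t ->
  bounded_measurable f -> (forall y, 0 <= f y) ->
  extP P t (fun y => (f y)%:E) x = (P t f x)%:E.
Proof.
move=> msP t0 bf f0; apply/eqP; rewrite eq_le; apply/andP; split.
  apply: ge_ereal_sup => _ [h [bh hf] <-]; rewrite lee_fin -subr_ge0.
  have -> : P t f x - P t h x = P t (fun y => -1 * h y + f y) x.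
    by rewrite (ms_linear msP) //= mulN1r addrC.
  apply: (ms_positive msP) => // [|y].
    case: bh bf => mh [M hM] [mf [N fN]]; split.
      by apply: measurable_funD => //; exact: measurable_funM.
    exists (M + N) => y; apply: (le_trans (ler_normD _ _)).
    by rewrite mulN1r normrN lerD.
  by have [_] := hf y; rewrite lee_fin mulN1r addrC subr_ge0.
by apply: ereal_sup_ubound; exists f => //=; split => // y; split.
Qed.

(* The power function on [0, +oo], with [0 ^ q = +oo] and [+oo ^ q = 0] for
   [q < 0]; [poweR] would give [0] and [+oo]. *)
Definition epow (u : \bar R) (q : R) : \bar R :=
  if 0 <= q then poweR u q else ((poweR u (- q))^-1)%E.

Lemma epow_EFin (r q : R) : 0 < r -> epow r%:E q = (r `^ q)%:E.
Proof.
move=> r0; rewrite /epow; case: ifPn => // _.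
by rewrite poweR_EFin inver gt_eqF ?powR_gt0// powRN invrK.
Qed.

Definition log_sobolev_const (rho t : R) : R :=
  if rho == 0 then t else (1 - expR (- (2 * rho * t))) / (2 * rho).

Definition hypercontractivity_ratio (rho s t : R) : R :=
  if rho == 0 then t / s
  else (expR (2 * rho * t) - 1) / (expR (2 * rho * s) - 1).

Definition positive_in A f := A f /\ forall x, 0 < f x.

Definition local_log_sobolev P A (rho : R) :=
  forall f t x, positive_in A f -> 0 <= t ->
    ((Ent P t f x)%:E <= (log_sobolev_const rho t)%:E *
       extP P t (fun y => (Gamma P f f y / f y)%:E) x)%E.

(* (P_t(f^q))^{1/q} *)
Definition Pnorm P t (q : R) f x : \bar R :=
  epow (extP P t (fun y => epow (f y)%:E q) x) q^-1.

Definition local_hypercontractivity P A (rho : R) :=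
  forall (s t q1 q2 : R), 0 < s -> s <= t -> 1 < q1 -> q1 <= q2 ->
    (q2 - 1) / (q1 - 1) = hypercontractivity_ratio rho s t ->
    forall f x, positive_in A f ->
      (Pnorm P s q2 (P (t - s)%R f) x <= Pnorm P t q1 f x)%E.

Definition local_reverse_hypercontractivity P A (rho : R) :=
  forall (s t q1 q2 : R), 0 < s -> s <= t ->
    (0 < q2 /\ q2 <= q1 /\ q1 < 1) \/ (q2 <= q1 /\ q1 < 0) ->
    (q2 - 1) / (q1 - 1) = hypercontractivity_ratio rho s t ->
    forall f x, positive_in A f ->
      (Pnorm P t q1 f x <= Pnorm P s q2 (P (t - s)%R f) x)%E.

End MarkovSemigroup.

(* Main.v *)
Require Import Defs.
From HB Require Import structures.
From mathcomp Require Import all_boot all_order all_algebra.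
From mathcomp Require Import all_classical all_reals all_analysis.
From mathcomp Require Import measurable_realfun ring lra.
Set Implicit Arguments.
Unset Strict Implicit.
Unset Printing Implicit Defensive.
Import Order.TTheory GRing.Theory Num.Theory.
Import numFieldNormedType.Exports.
Local Open Scope classical_set_scope.
Local Open Scope ring_scope.

(** Write [L] for the generator, [phi u] for [u ln u], [c t] for the constant of the
    logarithmic Sobolev inequality, and [u] for [P_(t-s) f]. The proof works with
    functions bounded away from zero; these have their logarithm, hence all their
    powers, in the algebra ([A_ln]). Four implications are proved for them: the
    curvature bound gives the logarithmic Sobolev inequality and conversely, and the
    latter is equivalent to each of the two hypercontractive inequalities. A positive
    function [f] is then reached through [f + e], with [e] decreasing to zero.

    Curvature to logarithmic Sobolev. The function [F s = P_s (phi u)] joins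
    [phi (P_t f)] to [P_t (phi f)]. Formally [F' = P_s (u Gamma (ln u))] and
    [F'' = 2 P_s (u Gamma2 (ln u))], so that [F'' >= 2 rho F'] and [F] is a convex
    function of a primitive of [exp (2 rho s)]. The inequality says that [F] lies above its tangent
    at [s = t]. The difficulty is that [L] is not continuous, so the map
    [s -> Gamma u] may be irregular and [F'] need not be differentiable. However
    [u] and then [phi u] have Taylor expansions in [s] that are uniform on the space
    and have their coefficients in the algebra; applying [P_s] to each coefficient
    gives a second order expansion of [F] at every point ([peano2_P_family]), with
    the expected coefficients ([entropy_first_order], [entropy_second_order]). A
    maximum principle deduces the tangent inequality from these expansions
    ([tangent_bound]).

    Logarithmic Sobolev to curvature. For [f = exp h] the two sides of the inequality
    agree to first order at [t = 0], and the second order coefficients compare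
    [Gamma2 h] with [rho Gamma h] ([log_sobolev_curvature]).

    Logarithmic Sobolev and hypercontractivity. Let [q s] be the exponent for which
    [q s - 1] is inversely proportional to the clock [rate_time], with [q t = p], and
    put [W = u ^ (q s)]. The derivative in [s] of the logarithm of
    [P_s (W) ^ (1 / q s)] is a positive multiple of
    [(p - 1) * (c s * P_s (Gamma W / W) - Ent W)] ([log_Pnorm_derivative]). The
    logarithmic Sobolev inequality therefore makes the norm increase along the path
    when [p > 1] and decrease when [p < 1]. Conversely a hypercontractive inequality
    compares the norms at [s] and [t], which gives the sign of the derivative at
    [s = t]; if the path starts from [f ^ (1 / p)], then [W = f] there, and the
    logarithmic Sobolev inequality for [f] follows ([log_sobolev_of_path]). *)

(** * Derivatives of real functions *)

Section RealDerivatives.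
Context {R : realType}.
Implicit Types (f g F : R -> R) (a b x y z w lo hi M C : R).

Lemma is_derive_add f g x a b : is_derive x 1 f a -> is_derive x 1 g b ->
  is_derive x 1 (fun y => f y + g y) (a + b).
Proof. by move=> df dg; exact: is_deriveD. Qed.

Lemma is_derive_mul f g x a b : is_derive x 1 f a -> is_derive x 1 g b ->
  is_derive x 1 (fun y => f y * g y) (a * g x + f x * b).
Proof.
move=> df dg; apply: is_derive_eq (is_deriveM df dg) _.
by rewrite addrC mulrC.
Qed.

Lemma is_derive_const (k x : R) : is_derive x 1 (fun=> k) 0.
Proof. exact: is_derive_cst. Qed.

Lemma is_derive_var (x : R) : is_derive x 1 (fun y => y) 1.
Proof. exact: is_derive_id. Qed.

Lemma is_derive_scale (k : R) f x a : is_derive x 1 f a ->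
  is_derive x 1 (fun y => k * f y) (k * a).
Proof.
move=> df; apply: is_derive_eq (is_derive_mul (is_derive_const k x) df) _.
by rewrite mul0r add0r.
Qed.

Lemma is_derive_sub f g x a b : is_derive x 1 f a -> is_derive x 1 g b ->
  is_derive x 1 (fun y => f y - g y) (a - b).
Proof. by move=> df dg; exact: is_deriveB. Qed.

Lemma is_derive_chain f g x a b : is_derive (g x) 1 f a -> is_derive x 1 g b ->
  is_derive x 1 (fun y => f (g y)) (a * b).
Proof. by move=> df dg; exact: is_derive1_comp. Qed.

Lemma is_derive_inv f x a : is_derive x 1 f a -> f x != 0 ->
  is_derive x 1 (fun y => (f y)^-1) (- a / (f x) ^+ 2).
Proof.
move=> df fx0; apply: is_derive_eq (is_deriveV fx0 df) _.
by rewrite scaleNr mulNr mulrC.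
Qed.

Lemma is_derive_exp f n x a : is_derive x 1 f a ->
  is_derive x 1 (fun y => f y ^+ n) (n%:R * f x ^+ n.-1 * a).
Proof.
move=> df; case: n => [|n].
  by under eq_fun do rewrite expr0; rewrite !mul0r; exact: is_derive_const.
rewrite [n.+1.-1]/=; elim: n => [|n IHn].
  by under eq_fun do rewrite expr1; rewrite expr0 !mul1r.
under eq_fun do rewrite exprS.
apply: is_derive_eq (is_derive_mul df IHn) _.
by rewrite [n.+2%:R]mulrSr exprS; ring.
Qed.

Lemma is_derive_shiftN f x h a : is_derive (x - h) 1 f a ->
  is_derive h 1 (fun y => f (x - y)) (- a).
Proof.
move=> df.
have dg := is_derive_sub (is_derive_const x h) (is_derive_var h).
by apply: is_derive_eq (is_derive_chain (g := fun y => x - y) df dg) _;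
rewrite sub0r mulrN1.
Qed.

Lemma is_derive_continuous f x a : is_derive x 1 f a -> {for x, continuous f}.
Proof.
by case=> df _; apply: differentiable_continuous; exact/derivable1_diffP.
Qed.

Lemma is_deriveP f x a : is_derive x 1 f a <->
  (forall e, 0 < e -> exists2 d, 0 < d &
    forall h, `|h| < d -> `|f (x + h) - f x - h * a| <= e * `|h|).
Proof.
have key (h e : R) : h != 0 ->
    (`|a - h^-1 *: (f (h *: (1 : R) + x) - f x)| <= e) =
    (`|f (x + h) - f x - h * a| <= e * `|h|).
  move=> h0; rewrite /GRing.scale /= mulr1 [h + x]addrC.
  rewrite -ler_pdivrMr ?normr_gt0// -normfV -normrM distrC.
  by congr (`|_| <= e); field.
split=> [[df dfE] e e0|H].
  move: df; rewrite /derivable => /cvgrPdist_le/(_ e e0).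
  rewrite -/(derive f x 1) dfE => -[d /= d0 dH]; exists d => // h hd.
  have [->|h0] := eqVneq h 0.
    by rewrite addr0 subrr mul0r subr0 normr0 mulr0.
  have hd' : `|0 - h| < d by rewrite sub0r normrN.
  by rewrite -key//; exact: dH.
have cv : h^-1 *: (f (h *: (1 : R) + x) - f x) @[h --> 0^'] --> a.
  apply/cvgrPdist_le => e e0; have [d d0 dH] := H e e0.
  exists d => //= h hd h0; rewrite key//; apply: dH.
  by rewrite -(normrN h) -sub0r.
by apply: DeriveDef; [exact: cvgP cv|exact: cvg_lim cv].
Qed.

(** The mean value inequality, with endpoints in either order. *)
Lemma mean_value_le F (F1 : R -> R) a b M :
  (forall z, Num.min a b < z -> z < Num.max a b -> is_derive z 1 F (F1 z)) ->
  {within `[Num.min a b, Num.max a b], continuous F} ->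
  (forall z, Num.min a b <= z -> z <= Num.max a b -> `|F1 z| <= M) ->
  `|F b - F a| <= M * `|b - a|.
Proof.
wlog ab : a b / a <= b => [hw|].
  have /orP[/hw //|ba] := le_total a b.
  by rewrite minC maxC distrC [`|b - a|]distrC; exact: hw.
rewrite min_l// max_r// => d c m.
have d' z : z \in `]a, b[ -> is_derive z 1 F (F1 z).
  by rewrite in_itv/= => /andP[az zb]; exact: d.
have [z zab ->] := MVT_segment ab d' c.
move: zab; rewrite in_itv/= => /andP[az zb].
by rewrite normrM ler_wpM2r// m.
Qed.

Definition between a b z := Num.min a b <= z <= Num.max a b.

Lemma between_cc lo hi a b z :
  lo <= a <= hi -> lo <= b <= hi -> between a b z -> lo <= z <= hi.
Proof.
move=> /andP[? ?] /andP[? ?] /andP[az zb]; apply/andP; split.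
  by apply: le_trans az; rewrite le_min; apply/andP.
by apply: le_trans zb _; rewrite ge_max; apply/andP.
Qed.

Lemma between_dist a b z : between a b z -> `|z - a| <= `|b - a|.
Proof.
rewrite /between; have [ab|/ltW ba] := leP a b => /andP[az zb].
  by rewrite !ger0_norm ?subr_ge0// lerD2r.
by rewrite !ler0_norm ?subr_le0// lerN2 lerD2r.
Qed.

(** The endpoints are left to continuity because the orbits of a semigroup
    start at time [0]. *)
Definition derivative_on lo hi F (F1 : R -> R) :=
  (forall z, lo < z < hi -> is_derive z 1 F (F1 z)) /\
  {within `[lo, hi], continuous F}.

Lemma derivative_on_sub lo hi F G (F1 G1 : R -> R) :
  derivative_on lo hi F F1 -> (forall z, is_derive z 1 G (G1 z)) ->
  derivative_on lo hi (fun z => F z - G z) (fun z => F1 z - G1 z).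
Proof.
move=> [dF cF] dG; split=> [z zi|z]; first exact: is_derive_sub (dF _ zi) (dG z).
have cG : {within `[lo, hi], continuous G}.
  by apply: continuous_subspaceT => w; exact: is_derive_continuous (dG w).
exact: cvgB (cF z) (cG z).
Qed.

Lemma derivative_on_closed lo hi F (F1 : R -> R) :
  (forall z, lo <= z <= hi -> is_derive z 1 F (F1 z)) ->
  derivative_on lo hi F F1.
Proof.
move=> dF; split=> [z /andP[/ltW ? /ltW ?]|]; first by apply: dF; apply/andP.
by apply: derivable_within_continuous => z; rewrite in_itv/= => /dF[].
Qed.

Lemma taylor1_le F (F1 : R -> R) lo hi M a b : derivative_on lo hi F F1 ->
  lo <= a <= hi -> lo <= b <= hi -> (forall z, between a b z -> `|F1 z| <= M) ->
  `|F b - F a| <= M * `|b - a|.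
Proof.
move=> [dF cF] /andP[? ?] /andP[? ?] HM; apply: (mean_value_le (F1 := F1)).
- move=> z; rewrite gt_min lt_max => az zb; apply: dF; lra.
- apply: continuous_subspaceW cF; apply: subset_itv; rewrite bnd_simp.
    by rewrite le_min; apply/andP.
  by rewrite ge_max; apply/andP.
- by move=> z az zb; apply: HM; apply/andP.
Qed.

Lemma taylor2_le F (F1 F2 : R -> R) lo hi C a b :
  derivative_on lo hi F F1 -> derivative_on lo hi F1 F2 ->
  (forall z, lo <= z <= hi -> `|F2 z| <= C) ->
  lo <= a <= hi -> lo <= b <= hi ->
  `|F b - F a - (b - a) * F1 a| <= C * `|b - a| ^+ 2.
Proof.
move=> dF dF1 HC ia ib.
have C0 : 0 <= C by exact: le_trans (normr_ge0 _) (HC _ ia).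
rewrite (_ : _ - _ = F b - b * F1 a - (F a - a * F1 a)); last by ring.
rewrite expr2 mulrA.
have dl z : is_derive z 1 (fun z => z * F1 a) (F1 a).
  apply: is_derive_eq (is_derive_mul (is_derive_var z) (is_derive_const (F1 a) z)) _.
  by rewrite mul1r mulr0 addr0.
apply: (taylor1_le (derivative_on_sub dF dl) ia ib) => z zi.
have iz := between_cc ia ib zi.
apply: le_trans (taylor1_le dF1 ia iz (M := C) _) _.
  by move=> w iw; apply: HC; exact: between_cc ia iz iw.
by rewrite ler_wpM2l// between_dist.
Qed.

Lemma taylor3_le F (F1 F2 F3 : R -> R) lo hi C a b :
  derivative_on lo hi F F1 -> derivative_on lo hi F1 F2 ->
  derivative_on lo hi F2 F3 ->
  (forall z, lo <= z <= hi -> `|F3 z| <= C) ->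
  lo <= a <= hi -> lo <= b <= hi ->
  `|F b - F a - (b - a) * F1 a - (b - a) ^+ 2 * (2^-1 * F2 a)|
    <= C * `|b - a| ^+ 3.
Proof.
move=> dF dF1 dF2 HC ia ib.
have C0 : 0 <= C by exact: le_trans (normr_ge0 _) (HC _ ia).
pose q z := z * F1 a + (z - a) * (z - a) * (2^-1 * F2 a).
have dq z : is_derive z 1 q (F1 a + (z - a) * F2 a).
  have dza := is_derive_sub (is_derive_var z) (is_derive_const a z).
  apply: is_derive_eq (is_derive_add (is_derive_mul (is_derive_var z)
    (is_derive_const (F1 a) z)) (is_derive_mul (is_derive_mul dza dza)
    (is_derive_const (2^-1 * F2 a) z))) _.
  by field.
rewrite (_ : _ - _ = F b - q b - (F a - q a)); last by rewrite /q; ring.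
rewrite exprSr mulrA; apply: (taylor1_le (derivative_on_sub dF dq) ia ib) => z zi.
have iz := between_cc ia ib zi; rewrite opprD addrA.
apply: le_trans (taylor2_le dF1 dF2 HC ia iz) _.
by rewrite ler_wpM2l// lerXn2r ?nnegrE// between_dist.
Qed.

End RealDerivatives.

(** * A maximum principle *)

Section MaximumPrinciple.
Context {R : realType}.
Implicit Types (F G : R -> R) (rho a b h s t m : R).

(** A second order expansion at one point; it does not make [F] twice
    differentiable. *)
Definition peano2 F s (a1 a2 : R) := forall e : R, 0 < e -> exists2 d : R, 0 < d &
  forall h, `|h| < d -> `|F (s + h) - F s - h * a1 - h ^+ 2 * a2| <= e * h ^+ 2.

Lemma peano2_add F G s a1 a2 b1 b2 : peano2 F s a1 a2 -> peano2 G s b1 b2 ->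
  peano2 (fun z => F z + G z) s (a1 + b1) (a2 + b2).
Proof.
move=> pF pG e e0; have e20 : 0 < e / 2 by rewrite divr_gt0.
have [d d0 Hd] := pF _ e20; have [d' d'0 Hd'] := pG _ e20.
exists (Num.min d d') => [|h]; first by rewrite lt_min d0.
rewrite lt_min => /andP[/Hd hd /Hd' hd'].
rewrite [e]splitr mulrDl; apply: le_trans (lerD hd hd').
by apply: le_trans (ler_normD _ _); rewrite le_eqVlt; apply/orP; left; apply/eqP;
  congr (`|_|); ring.
Qed.

Lemma peano2_derive F (F1 : R -> R) s a2 :
  (forall z : R, is_derive z 1 F (F1 z)) -> is_derive s 1 F1 a2 ->
  peano2 F s (F1 s) (2^-1 * a2).
Proof.
move=> dF /is_deriveP dF1 e e0; have [d d0 Hd] := dF1 _ e0.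
exists d => // h hd.
pose G z := F z - z * F1 s - (z - s) * (z - s) * (2^-1 * a2).
rewrite (_ : _ - _ = G (s + h) - G s); last by rewrite /G; field.
rewrite -real_normK ?num_real// expr2 mulrA.
rewrite [X in _ <= _ * X](_ : _ = `|s + h - s|); last by congr (`|_|); ring.
apply: (@taylor1_le _ _ (fun z => F1 z - F1 s - (z - s) * a2) (s - `|h|)
  (s + `|h|)) => [|||z zi].
- apply: derivative_on_closed => z _.
  have dzs := is_derive_sub (is_derive_var z) (is_derive_const s z).
  apply: is_derive_eq (is_derive_sub (is_derive_sub (dF z) (is_derive_mul
    (is_derive_var z) (is_derive_const (F1 s) z))) (is_derive_mul (is_derive_mul
    dzs dzs) (is_derive_const (2^-1 * a2) z))) _.
  by field.
- by have := normr_ge0 h; lra.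
- by have := ler_norm h; have := ler_norm (- h); rewrite normrN; lra.
have zs := between_dist zi; rewrite [s + h - s]addrC addKr in zs.
have := Hd (z - s) (le_lt_trans zs hd); rewrite [s + _]addrC subrK => /le_trans.
by apply; rewrite ler_wpM2l// ltW.
Qed.

Lemma peano2_max F s a1 a2 d : peano2 F s a1 a2 -> 0 < d ->
  (forall h, `|h| < d -> F (s + h) <= F s) -> a1 = 0 /\ a2 <= 0.
Proof.
move=> pF d0 mF.
have key e : 0 < e -> exists2 r, 0 < r & forall h, `|h| < r ->
    h * a1 + h ^+ 2 * a2 <= e * h ^+ 2.
  move=> e0; have [d' d'0 H] := pF e e0; exists (Num.min d d').
    by rewrite lt_min d0.
  move=> h; rewrite lt_min => /andP[/mF h1 /H]; rewrite ler_norml => /andP[h2 _].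
  by move: h1 h2; lra.
have a20 : a2 <= 0.
  apply/ler_addgt0Pr => e e0; rewrite add0r; have [r r0 H] := key e e0.
  have r2 : `|r / 2| < r by rewrite gtr0_norm ?divr_gt0//; lra.
  have h1 := H _ r2; have h2 : - (r / 2) * a1 + (- (r / 2)) ^+ 2 * a2 <= e * (- (r / 2)) ^+ 2.
    by apply: H; rewrite normrN.
  have r3 : 0 < (r / 2) ^+ 2 by rewrite exprn_gt0// divr_gt0.
  rewrite -(ler_pM2l r3); move: h1 h2; rewrite sqrrN; lra.
split=> //; apply/eqP/negPn/negP => a10.
have [r r0 H] := key 1 ltr01.
pose k := `|a1| / (1 - a2) / 2; have a2p : 0 < 1 - a2 by lra.
have k0 : 0 < k by rewrite !divr_gt0// normr_gt0.
pose t := Num.min (r / 2) k.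
have t0 : 0 < t by rewrite lt_min k0 divr_gt0.
have tr : t < r by apply: (@le_lt_trans _ _ (r / 2)); [rewrite ge_min lexx|lra].
have tk : t <= k by rewrite ge_min lexx orbT.
have : `|Num.sg a1 * t| < r by rewrite normrM normr_sg a10 mul1r gtr0_norm.
move=> /H; rewrite exprMn sqr_sg a10 mul1r mulrAC -normrEsg mul1r.
have -> : t ^+ 2 = t * t by rewrite expr2.
have : t * (1 - a2) <= `|a1| / 2.
  by rewrite -ler_pdivlMr// (le_trans tk)// /k mulrAC.
have a10' : 0 < `|a1| by rewrite normr_gt0.
move=> h1 h2; have : t * (t * (1 - a2)) <= t * (`|a1| / 2) by rewrite ler_pM2l.
by have := mulr_gt0 t0 a10'; move: h2; lra.
Qed.

End MaximumPrinciple.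

(** * The two time scales *)

Section TimeScales.
Context {R : realType}.
Implicit Types (rho s t : R).

Lemma is_derive_expRM (k x : R) : is_derive x 1 (fun y : R => expR (k * y)) (k * expR (k * x)).
Proof.
have := is_derive_chain (f := expR) (g := fun y => k * y) (is_derive_expR _)
  (is_derive_scale k (is_derive_var x)).
by rewrite mulr1 mulrC.
Qed.

Lemma log_sobolev_const0 rho : log_sobolev_const rho 0 = 0 :> R.
Proof.
by rewrite /log_sobolev_const; case: ifP => // _; rewrite mulr0 oppr0 expR0 subrr mul0r.
Qed.

Lemma is_derive_log_sobolev_const rho t :
  is_derive t 1 (log_sobolev_const rho) (expR (- (2 * rho * t))).
Proof.
rewrite /log_sobolev_const; have [->|rho0] := eqVneq rho 0.
  by rewrite mulr0 mul0r oppr0 expR0; exact: is_derive_var.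
have := is_derive_mul (is_derive_sub (is_derive_const 1 t)
  (is_derive_expRM (- (2 * rho)) t)) (is_derive_const (2 * rho)^-1 t).
rewrite mulr0 addr0 sub0r !mulNr opprK mulrAC divff ?mulf_neq0// mul1r.
by under eq_fun do rewrite mulNr.
Qed.

Lemma log_sobolev_const_gt0 rho t : 0 < t -> 0 < log_sobolev_const rho t.
Proof.
rewrite /log_sobolev_const => t0; case: (ltgtP rho 0) => [r0|r0|//].
- by rewrite nmulr_lgt0 ?invr_lt0 ?subr_lt0 ?expR_gt1; nra.
- by rewrite divr_gt0 ?subr_gt0 ?expR_lt1; nra.
Qed.

(** [rate_time rho] is the clock in which the exponent minus one is inversely
    proportional to time along the hypercontractive flow. *)
Definition rate_time rho t := log_sobolev_const rho t * expR (2 * rho * t).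

Lemma hypercontractivity_ratioE rho s t : 0 < s ->
  hypercontractivity_ratio rho s t = rate_time rho t / rate_time rho s.
Proof.
move=> s0; rewrite /rate_time /hypercontractivity_ratio /log_sobolev_const.
case: eqVneq => [->|r0]; first by rewrite mulr0 !mul0r expR0 !mulr1.
have E u : (1 - expR (- (2 * rho * u))) / (2 * rho) * expR (2 * rho * u) =
    (expR (2 * rho * u) - 1) / (2 * rho).
  by rewrite mulrAC mulrBl mul1r -expRD addNr expR0.
have h : expR (2 * rho * s) - 1 != 0.
  by rewrite subr_eq0 -expR0 (inj_eq (@expR_inj R)) !mulf_neq0// gt_eqF.
by rewrite !E; field; rewrite r0 h.
Qed.

Lemma rate_time_gt0 rho t : 0 < t -> 0 < rate_time rho t.
Proof. by move=> t0; rewrite mulr_gt0 ?expR_gt0// log_sobolev_const_gt0. Qed.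

Lemma is_derive_rate_time rho t :
  is_derive t 1 (rate_time rho) (expR (2 * rho * t)).
Proof.
apply: is_derive_eq (is_derive_mul (is_derive_log_sobolev_const rho t)
  (is_derive_expRM (2 * rho) t)) _.
rewrite -expRD addNr expR0 /log_sobolev_const; case: eqVneq => [->|r0].
  by rewrite !(mulr0, mul0r) expR0 addr0.
rewrite [X in _ + X](_ : _ = expR (2 * rho * t) -
  expR (- (2 * rho * t)) * expR (2 * rho * t)); last by field.
by rewrite -expRD addNr expR0; ring.
Qed.

(** If [F'' >= 2 rho F'] in the sense of second order expansions, then [F] is a
    convex function of a primitive of [exp (2 rho s)], so it lies above its tangent
    at the right endpoint. Otherwise a solution of [K'' = 2 rho K'] would cut [F]
    at both endpoints, leaving a positive interior maximum of the difference,
    which survives the addition of a small strict subsolution. *)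
Lemma tangent_bound (F F1 F2 : R -> R) rho (a b m : R) : a < b ->
  {within `[a, b], continuous F} -> is_derive b 1 F m ->
  (forall s, a < s < b -> peano2 F s (F1 s) (F2 s)) ->
  (forall s, a < s < b -> rho * F1 s <= F2 s) ->
  F b - F a <= log_sobolev_const rho (b - a) * m.
Proof.
move=> ab cF dFb pF HF; rewrite leNgt; apply/negP => absurd.
have ba0 : 0 < b - a by rewrite subr_gt0.
have c0 := log_sobolev_const_gt0 rho ba0; set c := log_sobolev_const _ _ in absurd c0.
pose m' := (F b - F a) / c.
have mm' : m < m' by rewrite ltr_pdivlMr// mulrC.
pose E s : R := expR (- (2 * rho * (b - s))).
have dE s : is_derive s 1 E (2 * rho * E s).
  have d1 := is_derive_scale (- (2 * rho))
    (is_derive_sub (is_derive_const b s) (is_derive_var s)).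
  have := is_derive_chain (f := expR) (g := fun y => - (2 * rho) * (b - y))
    (is_derive_expR _) d1.
  rewrite (_ : (fun _ => _) = E); last by apply/funext => y; rewrite /E mulNr.
  by move/is_derive_eq; apply; rewrite /E mulNr; ring.
pose K s : R := - F b + m' * log_sobolev_const rho (b - s).
have dK s : is_derive s 1 K (- (m' * E s)).
  apply: is_derive_eq (is_derive_add (is_derive_const (- F b) s)
    (is_derive_scale m' (is_derive_shiftN
    (is_derive_log_sobolev_const rho (b - s))))) _.
  by rewrite add0r mulrN.
have dK1 s : is_derive s 1 (fun z => - (m' * E z)) (- (m' * (2 * rho * E s))).
  have := is_derive_scale (- m') (dE s); rewrite mulNr.
  by under eq_fun do rewrite mulNr.
pose D s := F s + K s.
have Da : D a = 0 by rewrite /D /K -/c divfK ?gt_eqF//; ring.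
have Db : D b = 0 by rewrite /D /K subrr log_sobolev_const0; ring.
have [s1 s1ab Ds1] : exists2 s, a < s < b & 0 < D s.
  have dDb := is_derive_add dFb (dK b).
  rewrite /E subrr mulr0 oppr0 expR0 mulr1 in dDb.
  have e0 : 0 < (m' - m) / 2 by lra.
  move/is_deriveP : dDb => /(_ _ e0)[d d0 Hd].
  pose h := Num.min d (b - a) / 2.
  have h0 : 0 < h by rewrite divr_gt0// lt_min d0.
  have [hd hab] : h < d /\ h < b - a.
    have : h < Num.min d (b - a) by rewrite /h in h0 *; lra.
    by rewrite lt_min => /andP.
  exists (b - h); first by apply/andP; split; lra.
  have := Hd (- h); rewrite normrN gtr0_norm// => /(_ hd).
  rewrite -/(D b) -/(D (b - h)) Db ler_norml => /andP[+ _].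
  have : 0 < (m' - m) / 2 * h by rewrite mulr_gt0.
  lra.
pose lam := 2 * `|rho| + 1.
have lam0 : 0 < lam by have := normr_ge0 rho; rewrite /lam; lra.
have lamrho : 0 < lam / 2 - rho by have := ler_norm rho; rewrite /lam; lra.
pose eta := D s1 / (2 * expR (lam * b)).
have eta0 : 0 < eta by rewrite divr_gt0 ?mulr_gt0 ?expR_gt0.
pose X s : R := eta * expR (lam * s).
have dX s : is_derive s 1 X (lam * X s).
  have := is_derive_scale eta (is_derive_expRM lam s).
  by rewrite mulrCA.
have X0 s : 0 < X s by rewrite mulr_gt0 ?expR_gt0.
have Xb : X b = D s1 / 2.
  by rewrite /X /eta invfM mulrA divfK// gt_eqF ?expR_gt0.
have Xab : X a < X b by rewrite ltr_pM2l// ltr_expR ltr_pM2l.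
pose G s := D s + X s.
have cG : {within `[a, b], continuous G}.
  have cK : {within `[a, b], continuous K}.
    by apply: continuous_subspaceT => w; exact: is_derive_continuous (dK w).
  have cX : {within `[a, b], continuous X}.
    by apply: continuous_subspaceT => w; exact: is_derive_continuous (dX w).
  by move=> z; exact: cvgD (cvgD (cF z) (cK z)) (cX z).
have [s0 s0ab maxG] := EVT_max (ltW ab) cG.
have Gs1 : G s1 <= G s0.
  by apply: maxG; rewrite in_itv/=; case/andP: s1ab => /ltW-> /ltW->.
have {s0ab} s0ab : a < s0 < b.
  move: s0ab; rewrite in_itv/= !le_eqVlt => /andP[/orP[/eqP s0E|->]].
    by move: Gs1; rewrite -s0E /G Da; have := X0 s1; lra.
  move=> /orP[/eqP s0E|->//].
  by move: Gs1; rewrite s0E /G Db; have := X0 s1; lra.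
have pG : peano2 G s0 (F1 s0 - m' * E s0 + lam * X s0)
    (F2 s0 + 2^-1 * - (m' * (2 * rho * E s0)) + 2^-1 * (lam * (lam * X s0))).
  apply: peano2_add (peano2_derive dX (is_derive_scale lam (dX s0))).
  exact: peano2_add (pF _ s0ab) (peano2_derive dK (dK1 s0)).
have /andP[as0 s0b] := s0ab.
have d0 : 0 < Num.min (s0 - a) (b - s0) by rewrite lt_min !subr_gt0 as0.
have locmax h : `|h| < Num.min (s0 - a) (b - s0) -> G (s0 + h) <= G s0.
  rewrite lt_min => /andP[h1 h2]; apply: maxG; rewrite in_itv/=.
  have := ler_norm h; have := ler_norm (- h); rewrite normrN => ? ?.
  by apply/andP; split; lra.
have [g1 g2] := peano2_max pG d0 locmax.
have := HF _ s0ab; rewrite (_ : F1 s0 = m' * E s0 - lam * X s0); last by lra.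
have := mulr_gt0 (mulr_gt0 lam0 (X0 s0)) lamrho.
nra.
Qed.

End TimeScales.

(** * Smooth functions *)

Section Smooth.
Context {R : realType}.
Implicit Types (f g phi : R -> R) (u : R).

(** The derivatives of the flat function [exp (- 1 / u)] on the positive half line
    are combinations of these functions. *)
Definition flat (k : nat) u : R :=
  if 0 < u then u^-1 ^+ k * expR (- u^-1) else 0.

Lemma flat_ge0 k u : 0 <= flat k u.
Proof.
rewrite /flat; case: ifP => // u0.
by rewrite mulr_ge0 ?expR_ge0// exprn_ge0// invr_ge0 ltW.
Qed.

Lemma flat_gt0 k u : 0 < u -> 0 < flat k u.
Proof.
by move=> u0; rewrite /flat u0 mulr_gt0 ?expR_gt0// exprn_gt0// invr_gt0.
Qed.

(** [exp v] dominates every power of [v = 1 / u]. *)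
Lemma flat_le k u : 0 <= u -> flat k u <= (k.+1)`!%:R * u.
Proof.
rewrite le_eqVlt => /predU1P[<-|u0]; first by rewrite /flat ltxx mulr0.
rewrite /flat u0; set v := u^-1; have v0 : 0 < v by rewrite invr_gt0.
rewrite expRN ler_pdivrMr ?expR_gt0// -[u]invrK -/v.
have := expR_ge1Dxn k (ltW v0).
set F := (k.+1)`!%:R; have F0 : 0 < F :> R by rewrite ltr0n fact_gt0.
move=> h; have {}h : v ^+ k.+1 / F <= expR v by lra.
rewrite mulrAC ler_pdivlMr// -exprSr.
by move: h; rewrite ler_pdivrMr// mulrC.
Qed.

Lemma flatS k u : flat k u = u * flat k.+1 u.
Proof.
rewrite /flat; case: ifP => u0; last by rewrite mulr0.
by rewrite exprS !mulrA divff ?gt_eqF// mul1r.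
Qed.

Lemma is_derive_flat k u :
  is_derive u 1 (flat k) (flat k.+2 u - k%:R * flat k.+1 u).
Proof.
have [u0|u0|->] := ltgtP u 0.
- rewrite /flat (lt_gtF u0) mulr0 subr0.
  apply: (near_eq_is_derive (f := fun=> 0 : R)) _ (is_derive_const 0 u).
  near=> z.
  by rewrite ifF// lt_gtF//; near: z; exact: lt_nbhsl.
- rewrite /flat u0.
  pose f z : R := z^-1 ^+ k * expR (0 - z^-1).
  have dv := is_derive_inv (is_derive_var u) (lt0r_neq0 u0).
  have dX := is_derive_exp k dv.
  have dE := is_derive_chain (f := expR) (g := fun z => 0 - z^-1)
    (is_derive_expR _) (is_derive_sub (is_derive_const 0 u) dv).
  apply: (near_eq_is_derive (f := f)).
    near=> z; have z0 : 0 < z by near: z; exact: lt_nbhsr.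
    by rewrite z0 /f sub0r.
  apply: is_derive_eq (is_derive_mul dX dE) _.
  rewrite !sub0r mulN1r -exprVn expr2.
  by case: (k) => [|n]; rewrite /= ?exprS; ring.
- have flat0 n : flat n 0 = 0 by rewrite /flat ltxx.
  apply/is_deriveP => e e0; rewrite !flat0.
  set F : R := (k.+2)`!%:R; have F0 : 0 < F by rewrite ltr0n fact_gt0.
  exists (e / F) => [|h hd]; first exact: divr_gt0.
  rewrite add0r !(subr0, mulr0) ger0_norm ?flat_ge0//.
  have [h0|h0] := ltP 0 h; last first.
    by rewrite /flat ltNge h0 /= mulr_ge0// ltW.
  rewrite gtr0_norm// in hd *; rewrite flatS mulrC.
  apply: ler_wpM2r; first exact: ltW.
  apply: le_trans (flat_le _ (ltW h0)) _.
  by rewrite mulrC -ler_pdivlMr// ltW.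
Unshelve. all: by end_near. Qed.

(** A class of functions closed under derivation, whose members are therefore
    smooth. It contains cutoffs, because composition with [flat] is allowed. *)
Inductive elementary : (R -> R) -> Prop :=
| elementary_const k : elementary (fun=> k)
| elementary_id : elementary (fun u => u)
| elementary_add f g : elementary f -> elementary g ->
    elementary (fun u => f u + g u)
| elementary_mul f g : elementary f -> elementary g ->
    elementary (fun u => f u * g u)
| elementary_exp f : elementary f -> elementary (fun u => expR (f u))
| elementary_inv f : elementary f -> (forall u, f u != 0) ->
    elementary (fun u => (f u)^-1)
| elementary_ln f : elementary f -> (forall u, 0 < f u) ->
    elementary (fun u => ln (f u))
| elementary_flat k f : elementary f -> elementary (fun u => flat k (f u)).

Lemma elementary_scale k f : elementary f -> elementary (fun u => k * f u).
Proof. by move=> ef; apply: elementary_mul => //; exact: elementary_const. Qed.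

Lemma elementary_derivative f : elementary f ->
  exists2 f', elementary f' & forall u, is_derive u 1 f (f' u).
Proof.
elim=> {f}.
- move=> k; exists (fun=> 0); first exact: elementary_const.
  by move=> u; exact: is_derive_const.
- exists (fun=> 1); first exact: elementary_const.
  by move=> u; exact: is_derive_var.
- move=> f g _ [f' ef' df] _ [g' eg' dg]; exists (fun u => f' u + g' u).
    exact: elementary_add.
  by move=> u; exact: is_derive_add.
- move=> f g ef [f' ef' df] eg [g' eg' dg].
  exists (fun u => f' u * g u + f u * g' u).
    by apply: elementary_add; exact: elementary_mul.
  by move=> u; exact: is_derive_mul.
- move=> f ef [f' ef' df]; exists (fun u => expR (f u) * f' u).
    by apply: elementary_mul => //; exact: elementary_exp.
  by move=> u; exact: is_derive_chain (is_derive_expR _) (df u).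
- move=> f ef [f' ef' df] f0; exists (fun u => -1 * f' u * (f u)^-1 * (f u)^-1).
    apply: elementary_mul; last exact: elementary_inv.
    apply: elementary_mul; last exact: elementary_inv.
    exact: elementary_scale.
  by move=> u; apply: is_derive_eq (is_derive_inv (df u) (f0 u)) _; field.
- move=> f ef [f' ef' df] f0; exists (fun u => (f u)^-1 * f' u).
    apply: elementary_mul => //; apply: elementary_inv => // u.
    by rewrite gt_eqF.
  by move=> u; exact: is_derive_chain (is_derive1_ln (f0 u)) (df u).
- move=> k f ef [f' ef' df].
  exists (fun u => (flat k.+2 (f u) + (- k%:R) * flat k.+1 (f u)) * f' u).
    apply: elementary_mul => //; apply: elementary_add; last apply: elementary_scale.
      exact: elementary_flat.
    exact: elementary_flat.
  by move=> u; rewrite mulNr; exact: is_derive_chain (is_derive_flat _ _) (df u).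
Qed.

Lemma is_derive_derive1 f f' : (forall u, is_derive u 1 f (f' u)) -> derive1 f = f'.
Proof.
by move=> df; apply/funext => u; rewrite derive1E; case: (df u).
Qed.

Lemma elementary_smooth f : elementary f -> smooth f.
Proof.
move=> ef n u; suff : elementary (derive1n n f).
  by case/elementary_derivative => f' _ /(_ u)[].
elim: n f ef => [|n IHn] f ef //; rewrite derive1Sn; apply: IHn.
by have [f' ef' /is_derive_derive1 ->] := elementary_derivative ef.
Qed.

(** The identity above [2 c], cut off so as to stay above [c]: composed with it, the
    logarithm becomes a smooth function on the whole line. *)
Definition fold_above (c u : R) : R :=
  c + flat 0 (u - c) / (flat 0 (u - c) + flat 0 (2 * c - u)) * (u - c).

Lemma fold_above_denom_gt0 c u : 0 < c -> 0 < flat 0 (u - c) + flat 0 (2 * c - u).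
Proof.
move=> c0; have [uc|uc] := ltP c u.
  by rewrite ltr_pwDl ?flat_ge0// flat_gt0// subr_gt0.
by rewrite ltr_wpDl ?flat_ge0// flat_gt0//; lra.
Qed.

Lemma fold_above_gt0 c u : 0 < c -> 0 < fold_above c u.
Proof.
move=> c0; rewrite /fold_above ltr_pwDl//.
have [uc|uc] := leP c u.
  by rewrite mulr_ge0 ?subr_ge0// divr_ge0 ?flat_ge0// ltW// fold_above_denom_gt0.
by rewrite /flat subr_gt0 (lt_gtF uc) !mul0r.
Qed.

Lemma fold_above_id c u : 0 < c -> 2 * c <= u -> fold_above c u = u.
Proof.
move=> c0 cu; rewrite /fold_above {3}/flat subr_gt0 ltNge cu addr0 divff.
  by rewrite mul1r addrC subrK.
by rewrite gt_eqF// flat_gt0//; lra.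
Qed.

Lemma elementary_fold_above c : 0 < c -> elementary (fold_above c).
Proof.
move=> c0; have eid := elementary_id.
have e1 : elementary (fun u => u - c) by apply: elementary_add => //; exact: elementary_const.
have e2 : elementary (fun u => 2 * c - u).
  have -> : (fun u => 2 * c - u) = (fun u => 2 * c + -1 * u).
    by apply/funext => u; ring.
  by apply: elementary_add; [exact: elementary_const|exact: elementary_scale].
rewrite /fold_above; apply: elementary_add; first exact: elementary_const.
apply: elementary_mul => //; apply: elementary_mul; first exact: elementary_flat.
apply: elementary_inv => [|u]; last by rewrite gt_eqF// fold_above_denom_gt0.
by apply: elementary_add; exact: elementary_flat.
Qed.

End Smooth.

(** * The semigroup and its generator *)

Section BoundedMeasurable.
Context {d : measure_display} {E : measurableType d} {R : realType}.
Implicit Types (f g : E -> R) (k : R).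

Lemma bounded_measurable_cst k : bounded_measurable (fun _ : E => k).
Proof. by split; [exact: measurable_cst|exists `|k|]. Qed.

Lemma bounded_measurable_add f g : bounded_measurable f -> bounded_measurable g ->
  bounded_measurable (fun x => f x + g x).
Proof.
move=> [mf [M fM]] [mg [N gN]]; split; first exact: measurable_funD.
by exists (M + N) => x; apply: le_trans (ler_normD _ _) _; exact: lerD.
Qed.

Lemma bounded_measurable_scale k f : bounded_measurable f ->
  bounded_measurable (fun x => k * f x).
Proof.
move=> [mf [M fM]]; split; first exact: measurable_funM.
by exists (`|k| * M) => x; rewrite normrM ler_wpM2l.
Qed.

Lemma bounded_measurable_sub f g : bounded_measurable f -> bounded_measurable g ->
  bounded_measurable (fun x => f x - g x).
Proof.
move=> bf bg; under eq_fun do rewrite -mulN1r.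
by apply: bounded_measurable_add => //; exact: bounded_measurable_scale.
Qed.

End BoundedMeasurable.

Section Semigroup.
Context {d : measure_display} {E : measurableType d} {R : realType}.
Context {P : R -> (E -> R) -> E -> R}.
Context (msP : markov_semigroup P).
Implicit Types (f g : E -> R) (k s t M : R) (x y : E).

Lemma P_add t f g x : 0 <= t -> bounded_measurable f -> bounded_measurable g ->
  P t (fun y => f y + g y) x = P t f x + P t g x.
Proof.
move=> t0 bf bg; have := ms_linear msP 1 t0 bf bg.
under eq_fun do rewrite mul1r.
by move->; rewrite mul1r.
Qed.

Lemma P_const t k x : 0 <= t -> P t (fun=> k) x = k.
Proof.
move=> t0; have b1 := bounded_measurable_cst (E := E) (1 : R).
have := ms_linear msP (k - 1) t0 b1 b1; rewrite (ms_one msP t0).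
under eq_fun do rewrite mulr1 subrK.
by move=> ->.
Qed.

Lemma P_scale t k f x : 0 <= t -> bounded_measurable f ->
  P t (fun y => k * f y) x = k * P t f x.
Proof.
move=> t0 bf; have := ms_linear msP k t0 bf (bounded_measurable_cst 0).
under eq_fun do rewrite addr0.
by move->; rewrite P_const// addr0.
Qed.

Lemma P_sub t f g x : 0 <= t -> bounded_measurable f -> bounded_measurable g ->
  P t (fun y => f y - g y) x = P t f x - P t g x.
Proof.
move=> t0 bf bg; under [X in P t X]eq_fun do rewrite -mulN1r.
by rewrite P_add ?P_scale ?mulN1r//; exact: bounded_measurable_scale.
Qed.

Lemma P_le t f g x : 0 <= t -> bounded_measurable f -> bounded_measurable g ->
  (forall y, f y <= g y) -> P t f x <= P t g x.
Proof.
move=> t0 bf bg fg; rewrite -subr_ge0 -P_sub//.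
by apply: (ms_positive msP) => // [|y]; [exact: bounded_measurable_sub|rewrite subr_ge0].
Qed.

Lemma P_ge_const t f k x : 0 <= t -> bounded_measurable f ->
  (forall y, k <= f y) -> k <= P t f x.
Proof.
move=> t0 bf kf; rewrite -[leLHS](P_const k x t0).
by apply: P_le => //; exact: bounded_measurable_cst.
Qed.

Lemma P_norm_le t f M x : 0 <= t -> bounded_measurable f ->
  (forall y, `|f y| <= M) -> `|P t f x| <= M.
Proof.
move=> t0 bf fM; have bM k := bounded_measurable_cst (E := E) k.
rewrite ler_norml; apply/andP; split.
  by apply: P_ge_const => // y; have := fM y; rewrite ler_norml => /andP[].
rewrite -[leRHS](P_const M x t0); apply: P_le => // y.
exact: le_trans (ler_norm _) (fM y).
Qed.

End Semigroup.

Section Generator.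
Context {d : measure_display} {E : measurableType d} {R : realType}.
Context {P : R -> (E -> R) -> E -> R}.
Context (msP : markov_semigroup P).
Implicit Types (f g : E -> R) (k s t M : R) (x y : E).

Local Notation L := (generator P).

Lemma generator_cvg f x : generator_domain P f ->
  difference_quotient P f x h @[h --> 0^'+] --> L f x.
Proof. by case=> _ /(_ x). Qed.

Lemma generator_eq f x l :
  difference_quotient P f x h @[h --> 0^'+] --> l -> L f x = l.
Proof. by move=> fl; apply: cvg_lim. Qed.

Lemma near_time_ge0 : \forall h \near (0 : R)^'+, 0 <= h.
Proof. exact: nbhs_right_ge. Qed.

Lemma generator_const k x : L (fun=> k) x = 0.
Proof.
apply: generator_eq; apply: cvg_near_cst; near=> h.
have h0 : 0 <= h by near: h; exact: near_time_ge0.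
by rewrite /difference_quotient P_const// subrr mulr0.
Unshelve. all: by end_near. Qed.

Lemma generator_add f g x : generator_domain P f -> generator_domain P g ->
  L (fun y => f y + g y) x = L f x + L g x.
Proof.
move=> df dg; apply: generator_eq.
apply: (@cvg_trans _ ((difference_quotient P f x h + difference_quotient P g x h)
    @[h --> 0^'+])).
  apply: near_eq_cvg; near=> h.
  have h0 : 0 <= h by near: h; exact: near_time_ge0.
  by rewrite /difference_quotient (P_add msP)//; [ring|case: df|case: dg].
by apply: cvgD; exact: generator_cvg.
Unshelve. all: by end_near. Qed.

Lemma generator_scale k f x : generator_domain P f ->
  L (fun y => k * f y) x = k * L f x.
Proof.
move=> df; apply: generator_eq.
apply: (@cvg_trans _ ((k * difference_quotient P f x h) @[h --> 0^'+])).
  apply: near_eq_cvg; near=> h.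
  have h0 : 0 <= h by near: h; exact: near_time_ge0.
  by rewrite /difference_quotient (P_scale msP)//; [ring|case: df].
by apply: cvgM; [exact: cvg_cst|exact: generator_cvg].
Unshelve. all: by end_near. Qed.

(** The minimum principle: at a zero of a nonnegative function the difference
    quotients are nonnegative. *)
Lemma generator_ge0 f x : generator_domain P f -> (forall y, 0 <= f y) ->
  f x = 0 -> 0 <= L f x.
Proof.
move=> df f0 fx0; apply: limr_ge; first by case: df.
near=> h; have h0 : 0 <= h by near: h; exact: near_time_ge0.
rewrite /difference_quotient fx0 subr0 mulr_ge0 ?invr_ge0//.
by apply: (ms_positive msP) => //; case: df.
Unshelve. all: by end_near. Qed.

End Generator.

Section Algebra.
Context {d : measure_display} {E : measurableType d} {R : realType}.
Context {P : R -> (E -> R) -> E -> R} {mu : {measure set E -> \bar R}}.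
Context {A : set (E -> R)}.
Context (msP : markov_semigroup P) (niceA : nice_algebra P mu A).
Implicit Types (f g w : E -> R) (k s t M C : R) (x y : E).

Local Notation L := (generator P).

Lemma A_bounded_measurable f : A f -> bounded_measurable f.
Proof. by move/(na_domain niceA) => []. Qed.

Lemma A_bounded f : A f -> exists2 M : R, 0 < M & forall y, `|f y| <= M.
Proof.
move/A_bounded_measurable => [_ [M fM]]; exists (`|M| + 1) => [|y].
  by rewrite ltr_wpDl.
by apply: le_trans (fM y) _; have := ler_norm M; lra.
Qed.

Lemma A_elementary phi f : elementary phi -> A f -> A (fun y => phi (f y)).
Proof. by move=> ephi; apply: (na_smooth niceA); exact: elementary_smooth. Qed.

Lemma A_const k : A (fun=> k).
Proof. exact: (A_elementary (elementary_const k) (na_zero niceA)). Qed.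

Lemma A_sub f g : A f -> A g -> A (fun y => f y - g y).
Proof.
move=> Af Ag; under eq_fun do rewrite -mulN1r.
by apply: (na_add niceA) => //; exact: (na_scale niceA).
Qed.

Lemma A_exp k f : A f -> A (fun y => expR (k * f y)).
Proof.
apply: (A_elementary (phi := fun u => expR (k * u))).
by apply: elementary_exp; apply: elementary_scale; exact: elementary_id.
Qed.

(** Only the values of the logarithm above [e] matter, so it can be replaced by a
    function that is smooth on the whole line. *)
Lemma A_ln e f : 0 < e -> A f -> (forall y, e <= f y) -> A (fun y => ln (f y)).
Proof.
move=> e0 Af ef; have c0 : 0 < e / 2 by rewrite divr_gt0.
have -> : (fun y => ln (f y)) = (fun y => ln (fold_above (e / 2) (f y))).
  by apply/funext => y; rewrite fold_above_id// mulrC divfK.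
apply: (A_elementary (phi := fun u => ln (fold_above (e / 2) u))) => //.
by apply: elementary_ln (elementary_fold_above c0) _ => u; exact: fold_above_gt0.
Qed.

(** Freezing the orbit at negative times makes it continuous on the whole line. *)
Definition orbit f x t : R := P (Num.max t 0) f x.

Lemma orbitE f x t : 0 <= t -> orbit f x t = P t f x.
Proof. by move=> t0; rewrite /orbit max_l. Qed.

Lemma is_derive_orbit f x t : A f -> 0 < t ->
  is_derive t 1 (orbit f x) (orbit (L f) x t).
Proof.
move=> Af t0; rewrite orbitE ?ltW// -(na_commute niceA (ltW t0) Af).
apply: near_eq_is_derive (na_derive niceA x t0 Af).
by near=> z; rewrite orbitE// ltW//; near: z; exact: lt_nbhsr.
Unshelve. all: by end_near. Qed.

(** At time zero a bounded difference quotient forces continuity. *)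
Lemma orbit_continuous f x : A f -> continuous (orbit f x).
Proof.
move=> Af t; have [t0|t0|->] := ltgtP t 0.
- apply: cvg_near_cst; near=> z.
  have z0 : z < 0 by near: z; exact: lt_nbhsl.
  by rewrite /orbit !max_r ?ltW.
- exact: is_derive_continuous (is_derive_orbit x Af t0).
- have bf := A_bounded_measurable Af.
  have := generator_cvg (x := x) (na_domain niceA Af).
  move=> /cvgrPdist_le /(_ 1 ltr01) [/= r r0 Hr].
  set K := `|L f x| + 1; have K0 : 0 < K by rewrite ltr_wpDl.
  apply/cvgrPdist_lt => e e0 /=.
  exists (Num.min r (e / K)) => /=; first by rewrite lt_min r0 divr_gt0.
  move=> h hmin; have : `|0 - h| < Num.min r (e / K) by exact: hmin.
  rewrite lt_min => /andP[hr]; rewrite sub0r normrN => he.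
  rewrite (orbitE _ _ (lexx 0)) (ms_zero msP)//.
  have [h0|h0] := leP h 0.
    by rewrite /orbit max_r// (ms_zero msP)// subrr normr0.
  rewrite orbitE ?ltW//.
  have Hh : `|L f x - h^-1 * (P h f x - f x)| <= 1 := Hr h hr h0.
  have : `|h^-1 * (P h f x - f x)| <= K.
    rewrite -[X in `|X|](subrK (L f x)) addrC; apply: le_trans (ler_normD _ _) _.
    by rewrite lerD2l distrC.
  rewrite normrM normfV (gtr0_norm h0) mulrC ler_pdivrMr// distrC => /le_lt_trans.
  by apply; rewrite mulrC -ltr_pdivlMr// -(gtr0_norm h0).
Unshelve. all: by end_near. Qed.

Lemma derivative_on_orbit f x hi : A f ->
  derivative_on 0 hi (orbit f x) (orbit (L f) x).
Proof.
move=> Af; split=> [z /andP[z0 _]|]; first exact: is_derive_orbit.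
by apply: continuous_subspaceT; exact: orbit_continuous.
Qed.

Lemma orbit_norm_le f x t M : A f -> (forall y, `|f y| <= M) -> `|orbit f x t| <= M.
Proof.
move=> Af; apply: (P_norm_le msP); last exact: A_bounded_measurable.
by rewrite le_max lexx orbT.
Qed.

Lemma P_taylor1 f x s t C : A f -> (forall y, `|L f y| <= C) -> 0 <= s -> 0 <= t ->
  `|P t f x - P s f x| <= C * `|t - s|.
Proof.
move=> Af LC s0 t0; have AL := na_generator niceA Af.
rewrite -!orbitE//.
apply: (taylor1_le (derivative_on_orbit x (s + t) Af)); [lra|lra|].
by move=> z _; exact: orbit_norm_le.
Qed.

Lemma P_taylor2 f x s t C : A f -> (forall y, `|L (L f) y| <= C) ->
  0 <= s -> 0 <= t ->
  `|P t f x - P s f x - (t - s) * P s (L f) x| <= C * `|t - s| ^+ 2.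
Proof.
move=> Af LC s0 t0; have AL := na_generator niceA Af.
have ALL := na_generator niceA AL.
rewrite -!orbitE//.
apply: (taylor2_le (derivative_on_orbit x (s + t) Af)
  (derivative_on_orbit x (s + t) AL)); [|lra|lra].
by move=> z _; exact: orbit_norm_le.
Qed.

Lemma P_taylor3 f x s t C : A f -> (forall y, `|L (L (L f)) y| <= C) ->
  0 <= s -> 0 <= t ->
  `|P t f x - P s f x - (t - s) * P s (L f) x
    - (t - s) ^+ 2 * (2^-1 * P s (L (L f)) x)| <= C * `|t - s| ^+ 3.
Proof.
move=> Af LC s0 t0; have AL := na_generator niceA Af.
have ALL := na_generator niceA AL; have ALLL := na_generator niceA ALL.
rewrite -!orbitE//.
apply: (taylor3_le (derivative_on_orbit x (s + t) Af)
  (derivative_on_orbit x (s + t) AL) (derivative_on_orbit x (s + t) ALL)); [|lra|lra].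
by move=> z _; exact: orbit_norm_le.
Qed.

End Algebra.

Arguments orbit {d E R} P f x t.

(** * Calculus of the carre du champ *)

Section CarreDuChamp.
Context {d : measure_display} {E : measurableType d} {R : realType}.
Context {P : R -> (E -> R) -> E -> R} {mu : {measure set E -> \bar R}}.
Context {A : set (E -> R)}.
Context (msP : markov_semigroup P) (niceA : nice_algebra P mu A).
Implicit Types (f g v w : E -> R) (k u : R) (x y : E).

Local Notation L := (generator P).
Local Notation Gam := (Gamma P).

Lemma L_add f g : A f -> A g -> L (fun y => f y + g y) = fun x => L f x + L g x.
Proof.
move=> Af Ag; apply/funext => x.
by apply: (generator_add msP); exact: (na_domain niceA).
Qed.

Lemma L_scale k f : A f -> L (fun y => k * f y) = fun x => k * L f x.
Proof.
by move=> Af; apply/funext => x; apply: (generator_scale msP); exact: (na_domain niceA).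
Qed.

Lemma L_mul f g : L (fun y => f y * g y) =
  fun x => f x * L g x + g x * L f x + 2 * Gam f g x.
Proof. by apply/funext => x; rewrite /Gamma; field. Qed.

Lemma A_Gamma f g : A f -> A g -> A (Gam f g).
Proof.
move=> Af Ag; apply: (na_scale niceA); apply: (A_sub niceA).
  apply: (A_sub niceA); first by apply/(na_generator niceA)/(na_mul niceA).
  by apply: (na_mul niceA) => //; exact: (na_generator niceA).
by apply: (na_mul niceA) => //; exact: (na_generator niceA).
Qed.

Lemma GammaC f g : Gam f g = Gam g f.
Proof.
apply/funext => x; rewrite /Gamma.
have -> : (fun y => f y * g y) = (fun y => g y * f y).
  by apply/funext => y; rewrite mulrC.
by ring.
Qed.

Lemma Gamma_add f g v : A f -> A g -> A v ->
  Gam (fun y => f y + g y) v = fun x => Gam f v x + Gam g v x.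
Proof.
move=> Af Ag Av; apply/funext => x; rewrite /Gamma L_add//.
have -> : (fun y => (f y + g y) * v y) = (fun y => f y * v y + g y * v y).
  by apply/funext => y; rewrite mulrDl.
by rewrite L_add; [ring|exact: (na_mul niceA)|exact: (na_mul niceA)].
Qed.

Lemma Gamma_scale k f v : A f -> A v ->
  Gam (fun y => k * f y) v = fun x => k * Gam f v x.
Proof.
move=> Af Av; apply/funext => x; rewrite /Gamma L_scale//.
have -> : (fun y => k * f y * v y) = (fun y => k * (f y * v y)).
  by apply/funext => y; rewrite mulrA.
by rewrite L_scale; [ring|exact: (na_mul niceA)].
Qed.

Lemma Gamma_const k v : A v -> Gam (fun=> k) v = fun=> 0.
Proof.
move=> Av; apply/funext => x; rewrite /Gamma L_scale// (generator_const msP).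
by ring.
Qed.

(** At a given point subtracting a constant turns [f] into a function whose square
    has a minimum there. *)
Lemma Gamma_ge0 f x : A f -> 0 <= Gam f f x.
Proof.
move=> Af; pose g y := f y + - f x.
have Ac := A_const niceA (- f x).
have Ag : A g by exact: (na_add niceA).
have Lg : L g x = L f x by rewrite /g L_add// (generator_const msP) addr0.
have GE v : A v -> Gam g v x = Gam f v x.
  by move=> Av; rewrite /g Gamma_add// Gamma_const// addr0.
have <- : Gam g g x = Gam f f x by rewrite GE// GammaC GE.
have gx0 : g x = 0 by rewrite /g subrr.
rewrite /Gamma gx0 !mul0r !subr0 mulr_ge0 ?invr_ge0//.
apply: (generator_ge0 msP).
- by apply: (na_domain niceA); exact: (na_mul niceA).
- by move=> y; rewrite -expr2 sqr_ge0.
- by rewrite gx0 mul0r.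
Qed.

(** The Cauchy-Schwarz inequality for the form at [x], in the degenerate case. *)
Lemma Gamma_degenerate f v x : A f -> A v -> Gam f f x = 0 -> Gam f v x = 0.
Proof.
move=> Af Av f0.
have H k : 0 <= 2 * k * Gam f v x + k ^+ 2 * Gam v v x.
  have Akv := na_scale niceA k Av; have As := na_add niceA Af Akv.
  set s := (fun y => _) in As.
  have SE w : A w -> Gam s w x = Gam f w x + k * Gam v w x.
    by move=> Aw; rewrite /s Gamma_add// Gamma_scale.
  have := Gamma_ge0 x As; rewrite SE// !(GammaC _ s) !SE// f0 (GammaC v f).
  by congr (_ <= _); ring.
set b := Gam f v x in H *; set c := Gam v v x in H.
have c0 : 0 <= c by exact: Gamma_ge0.
have := H (- b / (c + 1)).
have c1 : 0 < c + 1 by lra.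
rewrite (_ : _ + _ = - (b ^+ 2 * (c + 2)) / (c + 1) ^+ 2); last first.
  by field; rewrite gt_eqF.
rewrite pmulr_lge0 ?invr_gt0 ?exprn_gt0// oppr_ge0 => h.
apply/eqP; rewrite -sqrf_eq0 eq_le sqr_ge0 andbT.
by rewrite -(ler_pM2r (x := c + 2)) ?mul0r//; lra.
Qed.

Context (diffP : diffusion P A).

Lemma L_chain (phi phi1 phi2 : R -> R) f x : elementary phi ->
  (forall u, is_derive u 1 phi (phi1 u)) ->
  (forall u, is_derive u 1 phi1 (phi2 u)) -> A f ->
  L (fun y => phi (f y)) x = phi1 (f x) * L f x + phi2 (f x) * Gam f f x.
Proof.
move=> ephi d1 d2 Af; rewrite diffP//; last exact: elementary_smooth.
have e1 := is_derive_derive1 d1; have e2 := is_derive_derive1 d2.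
by rewrite /derive1n /= e1 e2.
Qed.

Let Gamma_chain_diag (phi phi1 : R -> R) f x : elementary phi ->
  (forall u, is_derive u 1 phi (phi1 u)) -> A f ->
  Gam (fun y => phi (f y)) (fun y => phi (f y)) x = phi1 (f x) ^+ 2 * Gam f f x.
Proof.
move=> ephi d1 Af.
have [phi1' ephi1 d1'] := elementary_derivative ephi.
have phi1E : phi1' = phi1.
  by rewrite -(is_derive_derive1 d1) -(is_derive_derive1 d1').
rewrite {}phi1E {d1'} in ephi1.
have [phi2 ephi2 d2] := elementary_derivative ephi1.
have dsq u : is_derive u 1 (fun u => phi u * phi u) (2 * (phi u * phi1 u)).
  by apply: is_derive_eq (is_derive_mul (d1 u) (d1 u)) _; ring.
have dsq2 u : is_derive u 1 (fun u => 2 * (phi u * phi1 u))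
    (2 * (phi1 u * phi1 u + phi u * phi2 u)).
  exact: is_derive_scale (is_derive_mul (d1 u) (d2 u)).
rewrite /Gamma (L_chain x ephi d1 d2 Af).
rewrite (L_chain (phi := fun u => phi u * phi u) x _ dsq dsq2 Af); last first.
  exact: elementary_mul.
by rewrite -/(Gam f f x); field.
Qed.

(** The one-variable chain rule gives the value of the form on [phi f] only. At [x]
    the function [phi f - phi' (f x) f] is null for the form, so the two terms
    have the same products with all other functions. *)
Lemma Gamma_chain (phi phi1 : R -> R) f v x : elementary phi ->
  (forall u, is_derive u 1 phi (phi1 u)) -> A f -> A v ->
  Gam (fun y => phi (f y)) v x = phi1 (f x) * Gam f v x.
Proof.
move=> ephi d1 Af Av; set c := phi1 (f x).
pose eta u := phi u + - c * u.
have eeta : elementary eta.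
  by apply: elementary_add => //; apply: elementary_scale; exact: elementary_id.
have deta u : is_derive u 1 eta (phi1 u + - c * 1).
  exact: is_derive_add (d1 u) (is_derive_scale _ (is_derive_var u)).
have := Gamma_chain_diag x eeta deta Af; rewrite mulr1 subrr expr0n mul0r => eta0.
have Aphi := A_elementary niceA ephi Af; have Acf := na_scale niceA (- c) Af.
have := Gamma_degenerate (A_elementary niceA eeta Af) Av eta0.
rewrite /eta Gamma_add// Gamma_scale//; lra.
Qed.

(** Polarization of the chain rule for squares. *)
Lemma Gamma_leibniz f g v : A f -> A g -> A v ->
  Gam (fun y => f y * g y) v = fun x => f x * Gam g v x + g x * Gam f v x.
Proof.
move=> Af Ag Av; apply/funext => x.
have sq h : A h -> Gam (fun y => h y * h y) v x = (h x + h x) * Gam h v x.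
  move=> Ah; apply: (Gamma_chain (phi := fun u => u * u) (phi1 := fun u => u + u)) => //.
    by apply: elementary_mul; exact: elementary_id.
  move=> u; apply: is_derive_eq (is_derive_mul (is_derive_var u) (is_derive_var u)) _.
  by ring.
have Afg := na_mul niceA Af Ag; have Aff := na_mul niceA Af Af.
have Agg := na_mul niceA Ag Ag; have A2fg := na_scale niceA 2 Afg.
have := sq _ (na_add niceA Af Ag); rewrite Gamma_add//.
have -> : (fun y => (f y + g y) * (f y + g y)) =
    (fun y => (f y * f y + 2 * (f y * g y)) + g y * g y).
  by apply/funext => y; ring.
rewrite Gamma_add//; last exact: (na_add niceA).
rewrite Gamma_add// Gamma_scale// sq// sq//; lra.
Qed.

Lemma elementary_expM k : elementary (fun u : R => expR (k * u)).
Proof. by apply: elementary_exp; apply: elementary_scale; exact: elementary_id. Qed.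

Lemma L_exp k f x : A f -> L (fun y => expR (k * f y)) x =
  expR (k * f x) * (k * L f x + k ^+ 2 * Gam f f x).
Proof.
move=> Af; rewrite (L_chain (phi := fun u => expR (k * u)) x (elementary_expM k)
  (is_derive_expRM k) (fun u => is_derive_scale k (is_derive_expRM k u)) Af).
by ring.
Qed.

Lemma Gamma_exp k f v x : A f -> A v ->
  Gam (fun y => expR (k * f y)) v x = k * expR (k * f x) * Gam f v x.
Proof.
exact: (Gamma_chain (phi := fun u => expR (k * u)) x (elementary_expM k)
  (is_derive_expRM k)).
Qed.

Lemma Gamma_exp_diag k f x : A f ->
  Gam (fun y => expR (k * f y)) (fun y => expR (k * f y)) x / expR (k * f x) =
  k ^+ 2 * (expR (k * f x) * Gam f f x).
Proof.
move=> Af; have Ae := A_exp niceA k Af; rewrite Gamma_exp//.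
rewrite GammaC Gamma_exp//.
by field; rewrite gt_eqF ?expR_gt0.
Qed.

(** With [u = exp f] the left side is [L (phi u) - phi' u * L u] for
    [phi u = u ln u]. It is the function to which [P_s] is applied in the first order
    coefficient of [P_s (phi (P_(t-s) g))], at a time when [P_(t-s) g = u]. *)
Lemma entropy_first_order f x : A f ->
  L (fun y => f y * expR (f y)) x - (f x + 1) * L (fun y => expR (f y)) x =
  expR (f x) * Gam f f x.
Proof.
move=> Af; have LE := L_exp 1 x Af; have GE := Gamma_exp 1 x Af Af.
have e1 : (fun y => expR (1 * f y)) = (fun y => expR (f y)).
  by apply/funext => y; rewrite mul1r.
rewrite {}e1 in LE GE.
by rewrite L_mul (GammaC f) GE LE !mul1r; ring.
Qed.

(** Half of the left side plays the same role for the second order coefficient. The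
    derivatives of [Gamma f f] that come from the Leibniz rule cancel, which leaves
    [Gamma2]. *)
Lemma entropy_second_order f x : A f ->
  L (L (fun y => f y * expR (f y))) x
  - 2 * L (fun y => (f y + 1) * L (fun y => expR (f y)) y) x
  + (L (fun y => expR (f y)) x) ^+ 2 / expR (f x)
  + (f x + 1) * L (L (fun y => expR (f y))) x =
  2 * (expR (f x) * Gamma2 P f x).
Proof.
move=> Af; set e := fun y => expR (f y).
have ee : elementary (@expR R) := elementary_exp elementary_id.
have dexp u : is_derive u 1 (@expR R) (expR u) by exact: is_derive_expR.
have Ae : A e by exact: (A_elementary niceA ee Af).
have AG := A_Gamma Af Af; have ALf := na_generator niceA Af.
pose k y := L f y + Gam f f y.
have Ak : A k by exact: (na_add niceA).
have Ge v y : A v -> Gam e v y = e y * Gam f v y.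
  by move=> Av; exact: (Gamma_chain y ee dexp Af Av).
have Le : L e = fun y => e y * k y.
  by apply/funext => y; rewrite (L_chain y ee dexp dexp Af) /k mulrDr.
have Am : A (fun y => e y * k y) by exact: (na_mul niceA).
have Afm := na_mul niceA Af Am; have AeG := na_mul niceA Ae AG.
have fmE : (fun y => (f y + 1) * (e y * k y)) =
    (fun y => f y * (e y * k y) + e y * k y).
  by apply/funext => y; ring.
have LfeE : L (fun y => f y * e y) =
    fun y => e y * Gam f f y + (f y * (e y * k y) + e y * k y).
  apply/funext => y.
  have H : L (fun y => f y * e y) y - (f y + 1) * L e y = e y * Gam f f y.
    exact: entropy_first_order.
  by rewrite -[LHS](subrK ((f y + 1) * L e y)) H Le; ring.
rewrite LfeE Le fmE L_add//; last exact: (na_add niceA).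
rewrite L_add// (L_mul f) (L_mul e (Gam f f)) Le Ge//.
have GkE : Gam k f x = Gam f (L f) x + Gam f (Gam f f) x.
  by rewrite /k Gamma_add// GammaC (GammaC (Gam f f)).
have -> : Gam f (fun y => e y * k y) x = e x * Gam k f x + k x * (e x * Gam f f x).
  by rewrite GammaC Gamma_leibniz// Ge.
rewrite GkE /Gamma2 -/(e x) /k; field; rewrite gt_eqF// expR_gt0//.
Qed.

End CarreDuChamp.

(** * Differentiation along the flow *)

Section Flow.
Context {d : measure_display} {E : measurableType d} {R : realType}.
Context {P : R -> (E -> R) -> E -> R} {mu : {measure set E -> \bar R}}.
Context {A : set (E -> R)}.
Context (msP : markov_semigroup P) (niceA : nice_algebra P mu A).
Implicit Types (f g : E -> R) (w : R -> E -> R) (q : R -> R).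
Implicit Types (e h k r s t z M C : R) (x y : E).

Local Notation L := (generator P).

(** Differentiability in time uniformly on the space, which is what a positive
    operator preserves. *)
Definition uniform_derive w s (w1 : E -> R) := forall e, 0 < e ->
  exists2 r : R, 0 < r & forall h y, `|h| < r ->
    `|w (s + h) y - w s y - h * w1 y| <= e * `|h|.

(** The remainder of the family is absorbed because [P_(s+h)] is a contraction for
    the uniform norm; the coefficients of the expansion lie in the algebra, where the
    orbits are differentiable. *)
Lemma is_derive_P_family w s (w1 : E -> R) x : 0 < s -> A (w s) -> A w1 ->
  (exists2 r, 0 < r & forall h, `|h| < r -> bounded_measurable (w (s + h))) ->
  uniform_derive w s w1 ->
  is_derive s 1 (fun z => P z (w z) x) (P s (fun y => L (w s) y + w1 y) x).
Proof.
move=> s0 Aw Aw1 [r0 r00 bw] dw; apply/is_deriveP => e e0.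
have AL := na_generator niceA Aw; have AL1 := na_generator niceA Aw1.
have [C2 C20 HC2] := A_bounded niceA (na_generator niceA AL).
have [C1 C10 HC1] := A_bounded niceA AL1.
have e3 : 0 < e / 2 by rewrite divr_gt0.
have [r r1 Hr] := dw _ e3.
pose D := e / 2 / (C1 + C2); have C0 : 0 < C1 + C2 by exact: addr_gt0.
have D0 : 0 < D by rewrite divr_gt0.
exists (Num.min (Num.min r0 r) (Num.min s D)) => [|h].
  by rewrite !lt_min r00 r1 s0 D0.
rewrite !lt_min => /andP[/andP[hr0 hr] /andP[hs hD]].
have sh0 : 0 <= s + h by have := ler_norm (- h); rewrite normrN; lra.
have bws := A_bounded_measurable niceA Aw.
have bw1 := A_bounded_measurable niceA Aw1.
have bwh := bw h hr0.
rewrite (P_add msP _ (ltW s0) (A_bounded_measurable niceA AL) bw1).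
have bhw1 := bounded_measurable_scale h bw1.
have E1 : P (s + h) (w (s + h)) x - P s (w s) x - h * (P s (L (w s)) x + P s w1 x) =
    P (s + h) (fun y => w (s + h) y - w s y - h * w1 y) x +
    (P (s + h) (w s) x - P s (w s) x - (s + h - s) * P s (L (w s)) x) +
    h * (P (s + h) w1 x - P s w1 x).
  rewrite (P_sub msP)//; last exact: bounded_measurable_sub.
  by rewrite (P_sub msP)// (P_scale msP)//; ring.
rewrite E1; apply: le_trans (ler_normD _ _) _.
have T2 := P_taylor2 msP niceA x Aw HC2 (ltW s0) sh0.
have T1 := P_taylor1 msP niceA x Aw1 HC1 (ltW s0) sh0.
rewrite [s + h]addrC addrK [h + s]addrC in T2 T1 *.
have T0 : `|P (s + h) (fun y => w (s + h) y - w s y - h * w1 y) x| <= e / 2 * `|h|.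
  apply: (P_norm_le msP) => // [|y]; last exact: Hr.
  by do 2!apply: bounded_measurable_sub => //.
have T1h : `|h * (P (s + h) w1 x - P s w1 x)| <= C1 * `|h| * `|h|.
  by rewrite normrM mulrC ler_wpM2r.
have hCD : `|h| * ((C1 + C2) * `|h|) <= `|h| * (e / 2).
  by rewrite ler_wpM2l// mulrC -ler_pdivlMr// ltW.
have := ler_normD (P (s + h) (fun y => w (s + h) y - w s y - h * w1 y) x)
  (P (s + h) (w s) x - P s (w s) x - h * P s (L (w s)) x).
move: T2; rewrite expr2; lra.
Qed.

(** The second order coefficient collects [w2], the first order expansion of the
    orbit of [w1], and the second order expansion of the orbit of [w s]. *)
Lemma peano2_P_family w s (w1 w2 : E -> R) x C : 0 < s -> A (w s) -> A w1 -> A w2 ->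
  (exists2 r, 0 < r & forall h, `|h| < r -> bounded_measurable (w (s + h))) ->
  (exists2 r, 0 < r & forall h y, `|h| < r ->
    `|w (s + h) y - w s y - h * w1 y - h ^+ 2 * w2 y| <= C * `|h| ^+ 3) ->
  peano2 (fun z => P z (w z) x) s (P s (fun y => L (w s) y + w1 y) x)
    (P s (fun y => 2^-1 * L (L (w s)) y + L w1 y + w2 y) x).
Proof.
move=> s0 Aw Aw1 Aw2 [r0 r00 bw] [r r1 Hr] e e0.
have AL := na_generator niceA Aw; have AL1 := na_generator niceA Aw1.
have AL2 := na_generator niceA Aw2.
have ALL := na_generator niceA AL; have ALL1 := na_generator niceA AL1.
have [C3 C30 HC3] := A_bounded niceA (na_generator niceA ALL).
have [C2 C20 HC2] := A_bounded niceA ALL1.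
have [C1 C10 HC1] := A_bounded niceA AL2.
pose K := `|C| + C1 + C2 + C3.
have K0 : 0 < K by rewrite /K; have := normr_ge0 C; lra.
have D0 : 0 < e / K by rewrite divr_gt0.
exists (Num.min (Num.min r0 r) (Num.min s (e / K))) => [|h].
  by rewrite !lt_min r00 r1 s0 D0.
rewrite !lt_min => /andP[/andP[hr0 hr] /andP[hs hD]].
have sh0 : 0 <= s + h by have := ler_norm (- h); rewrite normrN; lra.
have bm := A_bounded_measurable niceA.
have bwh := bw h hr0.
have bhw1 := bounded_measurable_scale h (bm _ Aw1).
have bhw2 := bounded_measurable_scale (h ^+ 2) (bm _ Aw2).
have b1 := bounded_measurable_sub bwh (bm _ Aw).
have b2 := bounded_measurable_sub b1 bhw1.
have b3 := bounded_measurable_sub b2 bhw2.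
have bLL := bounded_measurable_scale 2^-1 (bm _ ALL).
have bLL1 := bounded_measurable_add bLL (bm _ AL1).
rewrite !(P_add msP _ (ltW s0))//; try exact: bm.
rewrite (P_scale msP _ _ (ltW s0))//; last exact: bm.
set rem := (fun y => w (s + h) y - w s y - h * w1 y - h ^+ 2 * w2 y) in b3.
have remE : P (s + h) rem x = P (s + h) (w (s + h)) x - P (s + h) (w s) x
    - h * P (s + h) w1 x - h ^+ 2 * P (s + h) w2 x.
  rewrite /rem (P_sub msP)// (P_sub msP)// (P_sub msP)//; last exact: bm.
  by rewrite !(P_scale msP)//; exact: bm.
have T0 : `|P (s + h) rem x| <= C * `|h| ^+ 3.
  by apply: (P_norm_le msP) => // y; exact: Hr.
have T3 := P_taylor3 msP niceA x Aw HC3 (ltW s0) sh0.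
have T2 := P_taylor2 msP niceA x Aw1 HC2 (ltW s0) sh0.
have T1 := P_taylor1 msP niceA x Aw2 HC1 (ltW s0) sh0.
rewrite [s + h]addrC addrK [h + s]addrC in T3 T2 T1.
set t3 := (X in `|X| <= _) in T3; set t2 := (X in `|X| <= _) in T2.
set t1 := (X in `|X| <= _) in T1.
rewrite (_ : _ - _ = P (s + h) rem x + (t3 + (h * t2 + h ^+ 2 * t1))); last first.
  by rewrite remE /t3 /t2 /t1; ring.
have h0 := normr_ge0 h.
have T2' : `|h * t2| <= C2 * `|h| ^+ 3.
  rewrite normrM (_ : _ ^+ 3 = `|h| * `|h| ^+ 2); last by rewrite -exprS.
  by rewrite mulrCA; apply: ler_wpM2l.
have T1' : `|h ^+ 2 * t1| <= C1 * `|h| ^+ 3.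
  rewrite normrM normrX (_ : _ ^+ 3 = `|h| ^+ 2 * `|h|); last by rewrite -exprSr.
  by rewrite mulrCA; apply: ler_wpM2l => //; rewrite exprn_ge0.
apply: le_trans (ler_normD _ _) _.
have := ler_normD t3 (h * t2 + h ^+ 2 * t1); have := ler_normD (h * t2) (h ^+ 2 * t1).
have h3 : 0 <= `|h| ^+ 3 by rewrite exprn_ge0.
have : C * `|h| ^+ 3 <= `|C| * `|h| ^+ 3 by rewrite ler_wpM2r// ler_norm.
have : K * `|h| ^+ 3 <= e * h ^+ 2.
  rewrite -[h ^+ 2]real_normK ?num_real// exprS mulrA ler_wpM2r ?exprn_ge0//.
  by rewrite mulrC -ler_pdivlMr// ltW.
by rewrite /K; lra.
Qed.

Lemma uniform_derive_comp (phi phi1 phi2 : R -> R) lo hi w s (w1 : E -> R) M K C :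
  (forall z, lo <= z <= hi -> is_derive z 1 phi (phi1 z)) ->
  (forall z, lo <= z <= hi -> is_derive z 1 phi1 (phi2 z)) ->
  (forall z, lo <= z <= hi -> `|phi1 z| <= K) ->
  (forall z, lo <= z <= hi -> `|phi2 z| <= C) ->
  (exists2 r, 0 < r & forall h y, `|h| < r -> lo <= w (s + h) y <= hi) ->
  (forall y, `|w1 y| <= M) ->
  uniform_derive w s w1 ->
  uniform_derive (fun z y => phi (w z y)) s (fun y => phi1 (w s y) * w1 y).
Proof.
move=> d1 d2 HK HC [r0 r00 Hr0] HM dw e e0.
pose K' := `|K| + 1; have K'0 : 0 < K' by rewrite ltr_wpDl.
pose e1 := Num.min 1 (e / 2 / K').
have e10 : 0 < e1 by rewrite lt_min ltr01 !divr_gt0.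
have e11 : e1 <= 1 by rewrite ge_min lexx.
have e12 : K' * e1 <= e / 2 by rewrite mulrC -ler_pdivlMr// ge_min lexx orbT.
have [r r1 Hr] := dw _ e10.
pose N := `|M| + 1; have N0 : 0 < N by rewrite ltr_wpDl.
pose D := (`|C| + 1) * N ^+ 2.
have D0 : 0 < D by rewrite mulr_gt0 ?exprn_gt0// ltr_wpDl.
have eD0 : 0 < e / 2 / D by rewrite !divr_gt0.
exists (Num.min (Num.min r0 r) (e / 2 / D)) => [|h y].
  by rewrite !lt_min r00 r1 eD0.
rewrite !lt_min => /andP[/andP[hr0 hr] hD].
have ia : lo <= w s y <= hi by have := Hr0 0 y; rewrite addr0 normr0; exact.
have ib := Hr0 h y hr0; have Hh := Hr h y hr.
set a := w s y in ia Hh *; set b := w (s + h) y in ib Hh *; set c := w1 y in Hh *.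
have T := taylor2_le (derivative_on_closed d1) (derivative_on_closed d2) HC ia ib.
have h0 := normr_ge0 h.
have ba : `|b - a| <= N * `|h|.
  rewrite (_ : b - a = b - a - h * c + h * c); last by ring.
  apply: le_trans (ler_normD _ _) _; rewrite normrM mulrDl mul1r addrC.
  apply: lerD; last by apply: le_trans Hh _; rewrite ler_piMl.
  by rewrite mulrC ler_wpM2r// (le_trans (HM y))// ler_norm.
have T' : `|phi b - phi a - (b - a) * phi1 a| <= D * `|h| ^+ 2.
  apply: le_trans T _; rewrite /D -mulrA -exprMn; apply: ler_pM => //.
  - exact: le_trans (normr_ge0 _) (HC _ ia).
  - by have := ler_norm C; lra.
  - by rewrite lerXn2r ?nnegrE// mulr_ge0// ltW.
rewrite (_ : _ - _ = phi b - phi a - (b - a) * phi1 a + phi1 a * (b - a - h * c));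
  last by ring.
apply: le_trans (ler_normD _ _) _.
rewrite (_ : e * `|h| = e / 2 * `|h| + e / 2 * `|h|); last by field.
apply: lerD.
  apply: le_trans T' _; rewrite expr2 mulrA ler_wpM2r//.
  by rewrite mulrC -ler_pdivlMr// ltW.
rewrite normrM; apply: (@le_trans _ _ (K' * (e1 * `|h|))).
  by apply: ler_pM => //; have := HK _ ia; have := ler_norm K; rewrite /K'; lra.
by rewrite mulrA ler_wpM2r.
Qed.

Lemma uniform_derive_scale q w s (q1 : R) (w1 : E -> R) M : is_derive s 1 q q1 ->
  (exists2 r, 0 < r & forall h y, `|h| < r -> `|w (s + h) y| <= M) ->
  (forall y, `|w1 y| <= M) ->
  uniform_derive w s w1 ->
  uniform_derive (fun z y => q z * w z y) s (fun y => q1 * w s y + q s * w1 y).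
Proof.
move=> /is_deriveP dq [r0 r00 Hr0] HM dw e e0.
pose N := `|M| + 1; have N0 : 0 < N by rewrite ltr_wpDl.
pose Q := `|q s| + 1; have Q0 : 0 < Q by rewrite ltr_wpDl.
pose Q1 := `|q1| + 1; have Q10 : 0 < Q1 by rewrite ltr_wpDl.
have eN : 0 < e / 3 / N by rewrite !divr_gt0.
have [rq rq0 Hq] := dq _ eN.
pose e1 := Num.min 1 (e / 3 / Q).
have e10 : 0 < e1 by rewrite lt_min ltr01 !divr_gt0.
have e11 : e1 <= 1 by rewrite ge_min lexx.
have e12 : Q * e1 <= e / 3 by rewrite mulrC -ler_pdivlMr// ge_min lexx orbT.
have [r r1 Hr] := dw _ e10.
have eQ : 0 < e / 3 / (Q1 * N) by rewrite !divr_gt0// mulr_gt0.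
exists (Num.min (Num.min r0 r) (Num.min rq (e / 3 / (Q1 * N)))) => [|h y].
  by rewrite !lt_min r00 r1 rq0 eQ.
rewrite !lt_min => /andP[/andP[hr0 hr] /andP[hrq hD]].
have Hh := Hr h y hr; have Hb := Hr0 h y hr0; have {}Hq := Hq h hrq.
set a := w s y in Hh *; set b := w (s + h) y in Hb Hh *; set c := w1 y in Hh *.
have h0 := normr_ge0 h.
have MN : M <= N by have := ler_norm M; rewrite /N; lra.
have ba : `|b - a| <= N * `|h|.
  rewrite (_ : b - a = b - a - h * c + h * c); last by ring.
  apply: le_trans (ler_normD _ _) _; rewrite normrM mulrDl mul1r addrC.
  apply: lerD; last by apply: le_trans Hh _; rewrite ler_piMl.
  by rewrite mulrC ler_wpM2r// (le_trans (HM y))// ler_norm.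
rewrite (_ : _ - _ = (q (s + h) - q s - h * q1) * b + (h * (q1 * (b - a)) +
  q s * (b - a - h * c))); last by ring.
have T1 : `|(q (s + h) - q s - h * q1) * b| <= e / 3 * `|h|.
  rewrite normrM; apply: (@le_trans _ _ (e / 3 / N * `|h| * N)).
    by apply: ler_pM => //; exact: le_trans Hb MN.
  by rewrite mulrAC divfK ?gt_eqF.
have T2 : `|h * (q1 * (b - a))| <= e / 3 * `|h|.
  rewrite normrM mulrC ler_wpM2r// normrM.
  apply: (@le_trans _ _ (Q1 * (N * `|h|))).
    by apply: ler_pM => //; rewrite /Q1; lra.
  by rewrite mulrA mulrC -ler_pdivlMr ?mulr_gt0// ltW.
have T3 : `|q s * (b - a - h * c)| <= e / 3 * `|h|.
  rewrite normrM; apply: (@le_trans _ _ (Q * (e1 * `|h|))).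
    by apply: ler_pM => //; rewrite /Q; lra.
  by rewrite mulrA ler_wpM2r.
apply: le_trans (ler_normD _ _) _; have := ler_normD (h * (q1 * (b - a)))
  (q s * (b - a - h * c)); lra.
Qed.

(** The orbit of [f], continued affinely to negative times so that it can be
    differentiated from both sides at time zero. *)
Definition flow f r y : R := if 0 <= r then P r f y else f y + r * L f y.

Lemma A_flow f r : A f -> A (flow f r).
Proof.
move=> Af; rewrite /flow; have [r0|_] := leP 0 r; first exact: (na_semigroup niceA).
apply: (na_add niceA) => //; apply: (na_scale niceA); exact: (na_generator niceA).
Qed.

Lemma flow_taylor f r : A f -> 0 <= r -> exists2 C, 0 < C & exists2 r0, 0 < r0 &
  forall h y, `|h| < r0 ->
    `|flow f (r + h) y - flow f r y - h * P r (L f) y| <= C * `|h| ^+ 2.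
Proof.
move=> Af r_ge0; have AL := na_generator niceA Af.
have [C C0 HC] := A_bounded niceA (na_generator niceA AL).
exists C => //; exists (if r == 0 then 1 else r).
  by case: eqVneq => // r0; rewrite lt_def r0.
move=> h y hr; have -> : flow f r y = P r f y by rewrite /flow r_ge0.
rewrite /flow; case: ifPn => [rh|rh].
  by have := P_taylor2 msP niceA y Af HC r_ge0 rh; rewrite [r + h]addrC addrK.
have r0 : r = 0.
  apply/eqP/negPn/negP => r0; move: hr; rewrite (negbTE r0).
  by have := ler_norm (- h); rewrite normrN; lra.
have bf := A_bounded_measurable niceA Af; have bL := A_bounded_measurable niceA AL.
rewrite r0 add0r !(ms_zero msP)//.
rewrite (_ : _ - _ = 0); first by rewrite normr0 mulr_ge0 ?exprn_ge0// ltW.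
by ring.
Qed.

Lemma uniform_derive_flow f s t : A f -> s <= t ->
  uniform_derive (fun z => flow f (t - z)) s (fun y => - P (t - s) (L f) y).
Proof.
rewrite -subr_ge0 => Af st; have [C C0 [r0 r00 H]] := flow_taylor Af st.
move=> e e0; exists (Num.min r0 (e / C)) => [|h y]; first by rewrite lt_min r00 divr_gt0.
rewrite lt_min => /andP[hr hC]; have := H (- h) y; rewrite normrN => /(_ hr).
rewrite (_ : t - s + - h = t - (s + h)); last by ring.
rewrite mulNr mulrN => /le_trans; apply.
by rewrite expr2 mulrA ler_wpM2r// mulrC -ler_pdivlMr// ltW.
Qed.

Lemma flow_range f e M s t : A f -> 0 < e -> (forall y, e <= f y <= M) -> s <= t ->
  exists2 r0, 0 < r0 & forall h y, `|h| < r0 -> e / 2 <= flow f (t - (s + h)) y <= M + e / 2.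
Proof.
move=> Af e0 eM st; have AL := na_generator niceA Af.
have bf := A_bounded_measurable niceA Af.
have [C C0 HC] := A_bounded niceA AL.
exists (e / 2 / C) => [|h y hC]; first by rewrite !divr_gt0.
rewrite /flow; case: ifPn => [r0|].
  have eP : e <= P (t - (s + h)) f y.
    by apply: (P_ge_const msP) => // z; case/andP: (eM z).
  have PM : P (t - (s + h)) f y <= M.
    rewrite -[leRHS](P_const msP M y r0); apply: (P_le msP) => //.
      exact: bounded_measurable_cst.
    by move=> z; case/andP: (eM z).
  by apply/andP; split; lra.
rewrite -ltNge => r0; have /andP[ef fM] := eM y.
have : `|(t - (s + h)) * L f y| <= e / 2.
  rewrite normrM -(divfK (lt0r_neq0 C0) (e / 2)); apply: ler_pM => //.
  rewrite ltr0_norm//; apply: le_trans (ltW hC); have := ler_norm h; lra.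
rewrite ler_norml => /andP[? ?]; apply/andP; split; lra.
Qed.

End Flow.

Arguments flow {d E R} P f r y.

(** * From curvature to the logarithmic Sobolev inequality *)

Section RightLimit.
Context {R : realType}.

Lemma ge0_right_limit (G : R -> R) r : {for 0, continuous G} -> 0 < r ->
  (forall a, 0 < a < r -> 0 <= G a) -> 0 <= G 0.
Proof.
move=> cG r0 HG; rewrite leNgt; apply/negP => G0.
have G0' : 0 < - G 0 by rewrite oppr_gt0.
move/cvgrPdist_lt : cG => /(_ _ G0') [/= e e0 He].
pose a := Num.min r e / 2.
have a0 : 0 < a by rewrite divr_gt0// lt_min r0.
have [ar ae] : a < r /\ a < e.
  have : a < Num.min r e by move: a0; rewrite /a; lra.
  by rewrite lt_min => /andP.
have ae' : `|0 - a| < e by rewrite sub0r normrN gtr0_norm.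
have /= := He a ae'; rewrite ltr_norml => /andP[h _].
have := HG a; rewrite a0 ar => /(_ isT); lra.
Qed.

End RightLimit.

Section BoundedBelow.
Context {d : measure_display} {E : measurableType d} {R : realType}.
Context {P : R -> (E -> R) -> E -> R} {mu : {measure set E -> \bar R}}.
Context {A : set (E -> R)}.
Context (msP : markov_semigroup P) (niceA : nice_algebra P mu A).
Implicit Types (f g : E -> R) (u z e s t k h M : R) (x y : E).

Local Notation L := (generator P).
Local Notation Gam := (Gamma P).

Definition bounded_below f := exists2 e : R, 0 < e & forall y, e <= f y.

Lemma bounded_below_gt0 f y : bounded_below f -> 0 < f y.
Proof. by case=> e e0 /(_ y); exact: lt_le_trans. Qed.

Lemma A_ln_bb f : A f -> bounded_below f -> A (fun y => ln (f y)).
Proof. by move=> Af [e e0 fe]; exact: (A_ln niceA e0). Qed.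

Lemma lnK_bb f : bounded_below f -> (fun y => expR (ln (f y))) = f.
Proof. by move=> bf; apply/funext => y; rewrite lnK// posrE bounded_below_gt0. Qed.

Lemma A_entropy f : A f -> bounded_below f -> A (fun y => f y * ln (f y)).
Proof. by move=> Af bf; apply: (na_mul niceA) => //; exact: A_ln_bb. Qed.

Lemma A_inv f : A f -> bounded_below f -> A (fun y => (f y)^-1).
Proof.
move=> Af bf; have := A_exp niceA (-1) (A_ln_bb Af bf).
congr A; apply/funext => y; rewrite mulN1r expRN lnK//.
by rewrite posrE bounded_below_gt0.
Qed.

Lemma A_fisher f : A f -> bounded_below f -> A (fun y => Gam f f y / f y).
Proof.
by move=> Af bf; apply: (na_mul niceA); [exact: (A_Gamma niceA)|exact: A_inv].
Qed.

Lemma bounded_below_P f t : A f -> bounded_below f -> 0 <= t -> bounded_below (P t f).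
Proof.
move=> Af [e e0 fe] t0; exists e => // y.
by apply: (P_ge_const msP) => //; exact: (A_bounded_measurable niceA).
Qed.

Lemma P_gt0 f t x : A f -> bounded_below f -> 0 <= t -> 0 < P t f x.
Proof. by move=> Af bf t0; apply: bounded_below_gt0; exact: bounded_below_P. Qed.

Lemma is_derive_uln u : 0 < u ->
  is_derive u 1 (fun z : R => z * ln z) (ln u + 1).
Proof.
move=> u0; apply: is_derive_eq (is_derive_mul (is_derive_var u) (is_derive1_ln u0)) _.
by rewrite mul1r divff ?gt_eqF.
Qed.

Lemma is_derive_ln1 u : 0 < u -> is_derive u 1 (fun z : R => ln z + 1) u^-1.
Proof.
move=> u0; apply: is_derive_eq (is_derive_add (is_derive1_ln u0) (is_derive_const 1 u)) _.
by rewrite addr0.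
Qed.

Lemma ln_norm_le e M u : 0 < e -> e <= u <= M -> `|ln u| <= `|ln e| + `|ln M|.
Proof.
move=> e0 /andP[eu uM]; have u0 := lt_le_trans e0 eu; have M0 := lt_le_trans u0 uM.
have h1 : ln e <= ln u by rewrite ler_ln ?posrE.
have h2 : ln u <= ln M by rewrite ler_ln ?posrE.
have := ler_norm (- ln e); have := ler_norm (ln M); rewrite normrN.
have := normr_ge0 (ln e); have := normr_ge0 (ln M).
by move=> *; rewrite ler_norml; apply/andP; split; lra.
Qed.

(** The use of [flow] makes this differentiable from both sides at [z = t]. *)
Definition entropy_flow f t (z : R) y : R :=
  flow P f (t - z) y * ln (flow P f (t - z) y).

Lemma flow_ge0E f r : 0 <= r -> flow P f r = P r f.
Proof. by move=> r0; apply/funext => y; rewrite /flow r0. Qed.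

Definition entropy_flow1 f t s y : R :=
  - ((ln (P (t - s) f y) + 1) * L (P (t - s) f) y).

Definition entropy_flow2 f t s y : R :=
  2^-1 * ((P (t - s) f y)^-1 * L (P (t - s) f) y ^+ 2 +
    (ln (P (t - s) f y) + 1) * L (L (P (t - s) f)) y).

Lemma A_entropy_flow f t s : A f -> bounded_below f -> s <= t ->
  [/\ A (entropy_flow f t s), A (entropy_flow1 f t s) & A (entropy_flow2 f t s)].
Proof.
rewrite -subr_ge0 => Af bf ts.
have Au := na_semigroup niceA ts Af; have bu := bounded_below_P Af bf ts.
have AL := na_generator niceA Au; have ALL := na_generator niceA AL.
have Aln1 : A (fun y => ln (P (t - s) f y) + 1).
  by apply: (na_add niceA); [exact: A_ln_bb|exact: (A_const niceA)].
split.
- by rewrite /entropy_flow flow_ge0E//; exact: A_entropy.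
- rewrite /entropy_flow1; under eq_fun do rewrite -mulN1r.
  by apply: (na_scale niceA); exact: (na_mul niceA).
- apply: (na_scale niceA); apply: (na_add niceA); last exact: (na_mul niceA).
  by apply: (na_mul niceA); [exact: A_inv|exact: (na_mul niceA)].
Qed.

Lemma entropy_flow_bounded_measurable f t s : A f -> bounded_below f -> s <= t ->
  exists2 r, 0 < r & forall h, `|h| < r -> bounded_measurable (entropy_flow f t (s + h)).
Proof.
move=> Af [e e0 fe] st; have [M M0 fM] := A_bounded niceA Af.
have feM y : e <= f y <= M.
  by rewrite fe/=; have := fM y; rewrite ler_norml => /andP[].
have [r r0 Hr] := flow_range msP niceA Af e0 feM st.
exists r => // h hr; apply: (A_bounded_measurable niceA); apply: A_entropy.
  exact: (A_flow niceA).
by exists (e / 2); [rewrite divr_gt0|move=> y; have /andP[] := Hr h y hr].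
Qed.

Lemma uniform_derive_entropy_flow f t s : A f -> bounded_below f -> s <= t ->
  uniform_derive (entropy_flow f t) s (entropy_flow1 f t s).
Proof.
move=> Af [e e0 fe] st; have [M M0 fM] := A_bounded niceA Af.
have feM y : e <= f y <= M.
  by rewrite fe/=; have := fM y; rewrite ler_norml => /andP[].
have e20 : 0 < e / 2 by rewrite divr_gt0.
have ts : 0 <= t - s by rewrite subr_ge0.
have AL := na_generator niceA Af.
have [B B0 HB] := A_bounded niceA AL.
have Hr := flow_range msP niceA Af e0 feM st.
have dw := uniform_derive_flow msP niceA Af st.
have -> : entropy_flow1 f t s = fun y =>
    (ln (flow P f (t - s) y) + 1) * - P (t - s) (L f) y.
  by apply/funext => y; rewrite /entropy_flow1 flow_ge0E// (na_commute niceA)// mulrN.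
apply: (uniform_derive_comp (phi := fun z => z * ln z) (phi1 := fun z => ln z + 1)
  (phi2 := fun z => z^-1) (lo := e / 2) (hi := M + e / 2) (M := B)
  (K := `|ln (e / 2)| + `|ln (M + e / 2)| + 1) (C := (e / 2)^-1)) => //.
- by move=> z /andP[ez _]; apply: is_derive_uln; exact: lt_le_trans ez.
- by move=> z /andP[ez _]; apply: is_derive_ln1; exact: lt_le_trans ez.
- move=> z ezM; apply: le_trans (ler_normD _ _) _.
  by rewrite normr1 lerD2r; exact: ln_norm_le.
- move=> z /andP[ez _]; have z0 := lt_le_trans e20 ez.
  by rewrite gtr0_norm ?invr_gt0// lef_pV2 ?posrE.
- move=> y; rewrite normrN; apply: (P_norm_le msP) => //.
  exact: (A_bounded_measurable niceA).
Qed.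

(** The third derivative in time is bounded uniformly on the space, since [f] stays
    between two positive constants along the flow. *)
Lemma entropy_flow_peano2 f t s : A f -> bounded_below f -> s < t ->
  exists C, exists2 r, 0 < r & forall h y, `|h| < r ->
    `|entropy_flow f t (s + h) y - entropy_flow f t s y - h * entropy_flow1 f t s y
      - h ^+ 2 * entropy_flow2 f t s y| <= C * `|h| ^+ 3.
Proof.
move=> Af bf st; have [e e0 fe] := bf; have [M M0 fM] := A_bounded niceA Af.
have Lb := na_generator niceA.
have AL := Lb _ Af; have ALL := Lb _ AL; have ALLL := Lb _ ALL.
have [B1 B10 HB1] := A_bounded niceA AL.
have [B2 B20 HB2] := A_bounded niceA ALL.
have [B3 B30 HB3] := A_bounded niceA ALLL.
pose I := e^-1; pose K := `|ln e| + `|ln M| + 1.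
exists (I ^+ 2 * B1 ^+ 3 + 3 * (I * (B1 * B2)) + K * B3).
pose r := (t - s) / 2; have r0 : 0 < r by rewrite divr_gt0// subr_gt0.
exists r => // h y hr.
pose a z := orbit P f y (t - z); pose b z := orbit P (L f) y (t - z).
pose c z := orbit P (L (L f)) y (t - z); pose c3 z := orbit P (L (L (L f))) y (t - z).
have tz z : s - r <= z <= s + r -> 0 < t - z by rewrite /r; lra.
have aeM z : s - r <= z <= s + r -> e <= a z <= M.
  move=> /tz/ltW tz0; rewrite /a orbitE//; apply/andP; split.
    by apply: (P_ge_const msP) => //; exact: (A_bounded_measurable niceA).
  apply: le_trans (ler_norm _) _; apply: (P_norm_le msP) => //.
  exact: (A_bounded_measurable niceA).
have a0 z : s - r <= z <= s + r -> 0 < a z.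
  by move=> /aeM /andP[ez _]; exact: lt_le_trans ez.
have da z : s - r <= z <= s + r -> is_derive z 1 a (- b z).
  by move=> /tz tz0; apply: is_derive_shiftN; exact: (is_derive_orbit niceA).
have db z : s - r <= z <= s + r -> is_derive z 1 b (- c z).
  by move=> /tz tz0; apply: is_derive_shiftN; exact: (is_derive_orbit niceA).
have dc z : s - r <= z <= s + r -> is_derive z 1 c (- c3 z).
  by move=> /tz tz0; apply: is_derive_shiftN; exact: (is_derive_orbit niceA).
have dln z : s - r <= z <= s + r -> is_derive z 1 (fun z => ln (a z) + 1) ((a z)^-1 * - b z).
  by move=> iz; exact: is_derive_chain (is_derive_ln1 (a0 z iz)) (da z iz).
pose G z := a z * ln (a z).
pose G1 z := -1 * b z * (ln (a z) + 1).
pose G2 z := (a z)^-1 * (b z * b z) + c z * (ln (a z) + 1).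
pose G3 z := (a z)^-1 ^+ 2 * b z ^+ 3 - 3 * ((a z)^-1 * (b z * c z)) - (ln (a z) + 1) * c3 z.
have dG z : s - r <= z <= s + r -> is_derive z 1 G (G1 z).
  move=> iz; apply: is_derive_eq (is_derive_chain (f := fun u => u * ln u)
    (is_derive_uln (a0 z iz)) (da z iz)) _.
  by rewrite /G1; ring.
have dG1 z : s - r <= z <= s + r -> is_derive z 1 G1 (G2 z).
  move=> iz; apply: is_derive_eq (is_derive_mul (is_derive_scale (-1) (db z iz)) (dln z iz)) _.
  by rewrite /G2; ring.
have dG2 z : s - r <= z <= s + r -> is_derive z 1 G2 (G3 z).
  move=> iz; have az0 : a z != 0 by rewrite gt_eqF// a0.
  have dbb := is_derive_mul (db z iz) (db z iz).
  apply: is_derive_eq (is_derive_add (is_derive_mul (is_derive_inv (da z iz) az0) dbb)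
    (is_derive_mul (dc z iz) (dln z iz))) _.
  by rewrite /G3; field.
have HG3 z : s - r <= z <= s + r ->
    `|G3 z| <= I ^+ 2 * B1 ^+ 3 + 3 * (I * (B1 * B2)) + K * B3.
  move=> iz; have /andP[ez zM] := aeM z iz; have az0 := a0 z iz.
  have iI : `|(a z)^-1| <= I by rewrite gtr0_norm ?invr_gt0// lef_pV2 ?posrE.
  have bB1 : `|b z| <= B1 by exact: (orbit_norm_le msP niceA).
  have cB2 : `|c z| <= B2 by exact: (orbit_norm_le msP niceA).
  have dB3 : `|c3 z| <= B3 by exact: (orbit_norm_le msP niceA).
  have lK : `|ln (a z) + 1| <= K.
    apply: le_trans (ler_normD _ _) _; rewrite normr1 lerD2r.
    by apply: ln_norm_le => //; rewrite ez.
  have I0 : 0 <= I by rewrite invr_ge0 ltW.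
  have T1 : `|(a z)^-1 ^+ 2 * b z ^+ 3| <= I ^+ 2 * B1 ^+ 3.
    rewrite normrM !normrX; apply: ler_pM; rewrite ?exprn_ge0//.
      by rewrite lerXn2r ?nnegrE.
    by rewrite lerXn2r ?nnegrE// ltW.
  have T2 : `|3 * ((a z)^-1 * (b z * c z))| <= 3 * (I * (B1 * B2)).
    rewrite normrM ger0_norm// ler_pM2l// normrM; apply: ler_pM => //.
    by rewrite normrM; apply: ler_pM.
  have T3 : `|(ln (a z) + 1) * c3 z| <= K * B3 by rewrite normrM; apply: ler_pM.
  rewrite /G3; apply: le_trans (ler_normB _ _) _; apply: lerD => //.
  by apply: le_trans (ler_normB _ _) _; exact: lerD.
have iss : s - r <= s <= s + r by apply/andP; split; lra.
have ish : s - r <= s + h <= s + r.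
  by have := ler_norm h; have := ler_norm (- h); rewrite normrN => *; apply/andP; split; lra.
have := taylor3_le (derivative_on_closed dG) (derivative_on_closed dG1)
  (derivative_on_closed dG2) HG3 iss ish.
rewrite [s + h]addrC addrK [h + s]addrC => /le_trans.
have ts := ltW (tz _ iss); have tsh := ltW (tz _ ish).
rewrite (_ : entropy_flow f t (s + h) y = G (s + h)); last first.
  by rewrite /entropy_flow flow_ge0E// /G /a orbitE.
rewrite (_ : entropy_flow f t s y = G s); last first.
  by rewrite /entropy_flow flow_ge0E// /G /a orbitE.
have ALs := na_semigroup niceA ts AL.
rewrite (_ : entropy_flow1 f t s y = G1 s); last first.
  by rewrite /entropy_flow1 /G1 /a /b !orbitE// (na_commute niceA)//; ring.
rewrite (_ : entropy_flow2 f t s y = 2^-1 * G2 s); last first.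
  rewrite /entropy_flow2 /G2 /a /b /c !orbitE//.
  by rewrite (na_commute niceA ts Af) (na_commute niceA ts AL); ring.
by apply.
Qed.

End BoundedBelow.

Arguments entropy_flow {d E R} P f t z y.
Arguments entropy_flow1 {d E R} P f t s y.
Arguments entropy_flow2 {d E R} P f t s y.

Section CurvatureToLogSobolev.
Context {d : measure_display} {E : measurableType d} {R : realType}.
Context {P : R -> (E -> R) -> E -> R} {mu : {measure set E -> \bar R}}.
Context {A : set (E -> R)} {rho : R}.
Context (msP : markov_semigroup P) (niceA : nice_algebra P mu A) (diffP : diffusion P A).
Implicit Types (f g : E -> R) (u z e s t k h M : R) (x y : E).

Local Notation L := (generator P).
Local Notation Gam := (Gamma P).

(** The real-valued form of the local logarithmic Sobolev inequality, available for
    functions bounded away from zero. *)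
Definition log_sobolev_at f t x :=
  Ent P t f x <= log_sobolev_const rho t * P t (fun y => Gam f f y / f y) x.

Lemma log_sobolev_at0 f x : A f -> bounded_below f -> log_sobolev_at f 0 x.
Proof.
move=> Af bf; rewrite /log_sobolev_at log_sobolev_const0 mul0r /Ent.
rewrite !(ms_zero msP) ?subrr//; apply: (A_bounded_measurable niceA) => //.
exact: (A_entropy niceA).
Qed.

Lemma fisher_ln f x : A f -> bounded_below f ->
  Gam f f x / f x = f x * Gam (fun y => ln (f y)) (fun y => ln (f y)) x.
Proof.
move=> Af bf; have Aln := A_ln_bb niceA Af bf.
have := Gamma_exp_diag msP niceA diffP 1 x Aln.
have -> : (fun y => expR (1 * ln (f y))) = f.
  by rewrite -[RHS](lnK_bb bf); apply/funext => y; rewrite mul1r.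
by rewrite mul1r lnK ?posrE ?bounded_below_gt0// expr1n mul1r.
Qed.

Lemma entropy_first_order_ln f x : A f -> bounded_below f ->
  L (fun y => f y * ln (f y)) x - (ln (f x) + 1) * L f x = Gam f f x / f x.
Proof.
move=> Af bf; rewrite fisher_ln//.
have := entropy_first_order msP niceA diffP x (A_ln_bb niceA Af bf).
rewrite (lnK_bb bf) lnK ?posrE ?bounded_below_gt0//.
have -> : (fun y => ln (f y) * expR (ln (f y))) = (fun y => f y * ln (f y)).
  by apply/funext => y; rewrite lnK ?posrE ?bounded_below_gt0// mulrC.
by [].
Qed.

Lemma entropy_second_order_ln f x : A f -> bounded_below f ->
  L (L (fun y => f y * ln (f y))) x - 2 * L (fun y => (ln (f y) + 1) * L f y) x
  + L f x ^+ 2 / f x + (ln (f x) + 1) * L (L f) x =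
  2 * (f x * Gamma2 P (fun y => ln (f y)) x).
Proof.
move=> Af bf.
have := entropy_second_order msP niceA diffP x (A_ln_bb niceA Af bf).
have fxK : expR (ln (f x)) = f x by rewrite lnK// posrE bounded_below_gt0.
rewrite (lnK_bb bf) fxK.
have -> : (fun y => ln (f y) * expR (ln (f y))) = (fun y => f y * ln (f y)).
  by apply/funext => y; rewrite lnK ?posrE ?bounded_below_gt0// mulrC.
by [].
Qed.

(** Along [F s = P_s (u ln u)] with [u = P_(t-s) f], the second order coefficient of
    [F] dominates [rho] times the first order one, so that [F] lies above its
    tangent at [t] in the time scale of the inequality. The map [s -> Gamma (u)]
    need not be regular in [s]; second order expansions of [F] exist
    nevertheless, because [u ln u] itself is expanded before [P_s] is applied. *)
Lemma curvature_log_sobolev_at f t x : curvature_dimension P A rho ->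
  A f -> bounded_below f -> 0 <= t -> log_sobolev_at f t x.
Proof.
move=> cd Af bf; rewrite le_eqVlt => /predU1P[<-|t0]; first exact: log_sobolev_at0.
have t0' := ltW t0.
have bm := A_bounded_measurable niceA.
pose F z := P z (entropy_flow P f t z) x.
pose F1 s := P s (fun y => L (entropy_flow P f t s) y + entropy_flow1 P f t s y) x.
pose F2 s := P s (fun y => 2^-1 * L (L (entropy_flow P f t s)) y +
  L (entropy_flow1 P f t s) y + entropy_flow2 P f t s y) x.
have dF s : 0 < s <= t -> is_derive s 1 F (F1 s).
  move=> /andP[s0 st]; have [Aw Aw1 _] := A_entropy_flow msP niceA Af bf st.
  have bw := entropy_flow_bounded_measurable msP niceA Af bf st.
  have dw := uniform_derive_entropy_flow msP niceA Af bf st.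
  exact: (is_derive_P_family msP niceA x s0 Aw Aw1 bw dw).
have pF s : 0 < s < t -> peano2 F s (F1 s) (F2 s).
  move=> /andP[s0 st]; have [Aw Aw1 Aw2] := A_entropy_flow msP niceA Af bf (ltW st).
  have [C HC] := entropy_flow_peano2 msP niceA Af bf st.
  have bw := entropy_flow_bounded_measurable msP niceA Af bf (ltW st).
  exact: (peano2_P_family msP niceA x s0 Aw Aw1 Aw2 bw HC).
have HF s : 0 < s < t -> rho * F1 s <= F2 s.
  move=> /andP[s0 st]; have [Aw Aw1 Aw2] := A_entropy_flow msP niceA Af bf (ltW st).
  have ts : 0 <= t - s by rewrite subr_ge0 ltW.
  have Au := na_semigroup niceA ts Af; have bu := bounded_below_P msP niceA Af bf ts.
  have AG := na_generator niceA.
  have A1 := na_add niceA (AG _ Aw) Aw1.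
  have A2 := na_add niceA (na_add niceA (na_scale niceA 2^-1 (AG _ (AG _ Aw))) (AG _ Aw1)) Aw2.
  rewrite /F1 -(P_scale msP _ _ (ltW s0)); last exact: bm.
  apply: (P_le msP); rewrite ?ltW//; [exact/bm/(na_scale niceA)|exact: bm|].
  move=> y; set u := P (t - s) f in Au bu *.
  have wE : entropy_flow P f t s = fun y => u y * ln (u y).
    by rewrite /entropy_flow flow_ge0E.
  have w1E : entropy_flow1 P f t s = fun y => -1 * ((ln (u y) + 1) * L u y).
    by apply/funext => z; rewrite mulN1r.
  have Aln := A_ln_bb niceA Au bu.
  have Am : A (fun y => (ln (u y) + 1) * L u y).
    apply: (na_mul niceA); last exact: AG.
    by apply: (na_add niceA) => //; exact: (A_const niceA).
  have E1 : L (entropy_flow P f t s) y + entropy_flow1 P f t s y =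
      u y * Gam (fun y => ln (u y)) (fun y => ln (u y)) y.
    by rewrite -(fisher_ln y Au bu) -(entropy_first_order_ln y Au bu) wE w1E mulN1r.
  have E2 : 2^-1 * L (L (entropy_flow P f t s)) y + L (entropy_flow1 P f t s) y +
      entropy_flow2 P f t s y = u y * Gamma2 P (fun y => ln (u y)) y.
    have := entropy_second_order_ln y Au bu; rewrite wE w1E (L_scale msP niceA)//.
    by rewrite /entropy_flow2 -/u mulrC; lra.
  rewrite E1 E2 mulrCA ler_pM2l ?bounded_below_gt0//; exact: cd.
have F1t : F1 t = P t (fun y => Gam f f y / f y) x.
  congr (P t _ x); apply/funext => y; rewrite -(entropy_first_order_ln y Af bf).
  rewrite /entropy_flow1 /entropy_flow flow_ge0E subrr// (ms_zero msP)//.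
  exact: bm.
have Ft : F t = P t (fun y => f y * ln (f y)) x.
  by rewrite /F /entropy_flow flow_ge0E subrr// (ms_zero msP)//; exact: bm.
(* the tangent inequality on [a, t]; it remains to let [a] decrease to zero *)
have tangent a : 0 < a < t -> F t - F a <= log_sobolev_const rho (t - a) * F1 t.
  move=> /andP[a0 at']; apply: (tangent_bound (F1 := F1) (F2 := F2)) => //.
  - apply: derivable_within_continuous => z; rewrite in_itv/= => /andP[az zt].
    by have [] := dF z; rewrite ?zt ?(lt_le_trans a0 az).
  - by apply: dF; rewrite t0 lexx.
  - by move=> s /andP[as' st]; apply: pF; rewrite st (lt_trans a0).
  - by move=> s /andP[as' st]; apply: HF; rewrite st (lt_trans a0).
(* [F] does not jump at time zero *)
have [K K0 HK] : exists2 K, 0 < K & forall a, 0 < a < t ->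
    F a <= P t f x * ln (P t f x) + K * a.
  have [e e0 fe] := bf; have [M M0 fM] := A_bounded niceA Af.
  have AL := na_generator niceA Af; have [B B0 HB] := A_bounded niceA AL.
  have Au := na_semigroup niceA t0' Af; have bu := bounded_below_P msP niceA Af bf t0'.
  have Aw := A_entropy niceA Au bu.
  have [C C0 HC] := A_bounded niceA (na_generator niceA Aw).
  pose k := `|ln e| + `|ln M| + 1.
  have k0 : 0 < k by rewrite /k ltr_wpDl// addr_ge0.
  exists (k * B + C) => [|a /andP[a0 at']]; first by rewrite addr_gt0// mulr_gt0.
  have ta : 0 <= t - a by rewrite subr_ge0 ltW.
  have range r y : 0 <= r -> e <= P r f y <= M.
    move=> r0; apply/andP; split.
      by apply: (P_ge_const msP) => //; exact: bm.
    by apply: le_trans (ler_norm _) _; apply: (P_norm_le msP) => //; exact: bm.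
  have wa y : entropy_flow P f t a y <= P t f y * ln (P t f y) + k * (B * a).
    rewrite /entropy_flow flow_ge0E//.
    have dl z : e <= z <= M -> is_derive z 1 (fun z => z * ln z) (ln z + 1).
      by move=> /andP[ez _]; apply: is_derive_uln; exact: lt_le_trans ez.
    have := taylor1_le (M := k) (derivative_on_closed dl) (range t y t0') (range (t - a) y ta).
    have Hk z : between (P t f y) (P (t - a) f y) z -> `|ln z + 1| <= k.
      move=> zb; apply: le_trans (ler_normD _ _) _; rewrite normr1 lerD2r.
      apply: ln_norm_le => //; exact: between_cc (range t y t0') (range (t - a) y ta) zb.
    move=> /(_ Hk) /(le_trans (ler_norm _)); rewrite lerBlDl => /le_trans; apply.
    rewrite lerD2l ler_pM2l//.
    have := P_taylor1 msP niceA y Af HB t0' ta.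
    by rewrite (_ : t - a - t = - a); [rewrite normrN (gtr0_norm a0)|ring].
  have [Aa _ _] := A_entropy_flow msP niceA Af bf (ltW at').
  have Ac := A_const niceA (k * (B * a)).
  apply: (@le_trans _ _ (P a (fun y => P t f y * ln (P t f y) + k * (B * a)) x)).
    by apply: (P_le msP); rewrite ?ltW//; apply: bm => //; exact: (na_add niceA).
  rewrite (P_add msP) ?(ltW a0)//; try exact: bm.
  rewrite (P_const msP) ?(ltW a0)//.
  have := P_taylor1 msP niceA x Aw HC (lexx 0) (ltW a0).
  rewrite subr0 (gtr0_norm a0) (ms_zero msP); last exact: bm.
  by move=> /(le_trans (ler_norm _)) ; lra.
rewrite /log_sobolev_at /Ent -F1t -Ft -subr_ge0.
pose G a := K * a + log_sobolev_const rho (t - a) * F1 t - (F t - P t f x * ln (P t f x)).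
have -> : log_sobolev_const rho t * F1 t - (F t - P t f x * ln (P t f x)) = G 0.
  by rewrite /G mulr0 add0r subr0.
apply: (ge0_right_limit _ t0) => [|a ia]; last first.
  by rewrite /G; have := tangent a ia; have := HK a ia; lra.
have dG : is_derive (0 : R) 1 G _ := is_derive_sub
  (is_derive_add (is_derive_scale K (is_derive_var 0))
  (is_derive_mul (is_derive_shiftN (is_derive_log_sobolev_const rho (t - 0)))
  (is_derive_const (F1 t) 0))) (is_derive_const _ 0).
exact: is_derive_continuous dG.
Qed.

End CurvatureToLogSobolev.

Arguments log_sobolev_at {d E R} P rho f t x.

(** * From the logarithmic Sobolev inequality to curvature *)

Section LogSobolevToCurvature.
Context {d : measure_display} {E : measurableType d} {R : realType}.
Context {P : R -> (E -> R) -> E -> R} {mu : {measure set E -> \bar R}}.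
Context {A : set (E -> R)} {rho : R}.
Context (msP : markov_semigroup P) (niceA : nice_algebra P mu A) (diffP : diffusion P A).
Implicit Types (f g : E -> R) (u z e s t k h M : R) (x y : E).

Local Notation L := (generator P).
Local Notation Gam := (Gamma P).

Lemma second_order_ge0 (D D1 D2 : R -> R) :
  continuous D -> continuous D1 -> {for 0, continuous D2} ->
  (forall t, 0 < t -> is_derive t 1 D (D1 t)) ->
  (forall t, 0 < t -> is_derive t 1 D1 (D2 t)) ->
  D 0 = 0 -> D1 0 = 0 -> (forall t, 0 < t -> 0 <= D t) -> 0 <= D2 0.
Proof.
move=> cD cD1 cD2 dD dD1 D0 D10 Dge; rewrite leNgt; apply/negP => D20.
have D20' : 0 < - D2 0 by rewrite oppr_gt0.
move/cvgrPdist_lt : cD2 => /(_ _ D20') [/= r r0 Hr].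
have D2lt z : 0 <= z -> z < r -> D2 z < 0.
  move=> z0 zr; have zr' : `|0 - z| < r by rewrite sub0r normrN ger0_norm.
  by have := Hr z zr'; rewrite /= ltr_norml => /andP[h _]; lra.
have neg (F F1 : R -> R) : continuous F -> (forall t, 0 < t -> is_derive t 1 F (F1 t)) ->
    F 0 = 0 -> (forall z, 0 < z -> z < r -> F1 z < 0) ->
    forall z, 0 < z -> z < r -> F z < 0.
  move=> cF dF F0 F1lt z z0 zr.
  have dF' w : w \in `]0, z[ -> is_derive w 1 F (F1 w).
    by rewrite in_itv/= => /andP[w0 _]; exact: dF.
  have [w] := MVT z0 dF' (continuous_subspaceT cF).
  rewrite in_itv/= => /andP[w0 wz]; rewrite F0 !subr0 => ->.
  by rewrite pmulr_llt0//; exact: F1lt (lt_trans wz zr).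
have D1lt := neg D1 D2 cD1 dD1 D10 (fun z (z0 : 0 < z) => D2lt z (ltW z0)).
have := neg D D1 cD dD D0 D1lt (r / 2); have := Dge (r / 2).
have r2 : 0 < r / 2 by rewrite divr_gt0.
by move=> /(_ r2) h1 /(_ r2) h2; have := h2 ltac:(lra); lra.
Qed.

(** The difference [D] of the two sides for [f = exp h] is nonnegative and vanishes
    to first order at time zero, so its second derivative there is nonnegative: up to
    a positive factor it is [Gamma2 h - rho Gamma h]. *)
Lemma log_sobolev_curvature :
  (forall f t x, A f -> bounded_below f -> 0 <= t -> log_sobolev_at P rho f t x) ->
  curvature_dimension P A rho.
Proof.
move=> lsi h x Ah; pose f y := expR (h y).
have Af : A f by exact: (A_elementary niceA (elementary_exp elementary_id) Ah).
have bf : bounded_below f.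
  have [M M0 hM] := A_bounded niceA Ah; exists (expR (- M)); first exact: expR_gt0.
  by move=> y; rewrite ler_expR; have := hM y; rewrite ler_norml => /andP[].
have hE : (fun y => ln (f y)) = h by apply/funext => y; rewrite expRK.
have AG := na_generator niceA; have bm := A_bounded_measurable niceA.
pose psi y := Gam f f y / f y; pose phi y := f y * ln (f y).
have Apsi : A psi by exact: (A_fisher niceA).
have Aphi : A phi by exact: (A_entropy niceA).
pose u := orbit P f x; pose c := log_sobolev_const rho.
pose ex t := expR (- (2 * rho * t)).
pose D t := c t * orbit P psi x t - orbit P phi x t + u t * ln (u t).
pose D1 t := (ex t * orbit P psi x t + c t * orbit P (L psi) x t) - orbit P (L phi) x t
  + (ln (u t) + 1) * orbit P (L f) x t.
pose D2 t := ((- (2 * rho) * ex t * orbit P psi x t + ex t * orbit P (L psi) x t)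
  + (ex t * orbit P (L psi) x t + c t * orbit P (L (L psi)) x t)) - orbit P (L (L phi)) x t
  + ((u t)^-1 * orbit P (L f) x t * orbit P (L f) x t
     + (ln (u t) + 1) * orbit P (L (L f)) x t).
have u0 t : 0 < u t by apply: (P_gt0 msP niceA) => //; rewrite le_max lexx orbT.
have dc t : is_derive t 1 c (ex t) by exact: is_derive_log_sobolev_const.
have dex t : is_derive t 1 ex (- (2 * rho) * ex t).
  have -> : ex = fun z => expR (- (2 * rho) * z).
    by apply/funext => z; rewrite mulNr.
  exact: is_derive_expRM.
have cc t : {for t, continuous c} := is_derive_continuous (dc t).
have cex t : {for t, continuous ex} := is_derive_continuous (dex t).
have co g : A g -> continuous (orbit P g x) by move=> Ag; exact: (orbit_continuous msP niceA).
have cln t : {for t, continuous (fun t => ln (u t))}.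
  exact: (@continuous_comp _ _ _ u (@ln R) t (co f Af t) (continuous_ln (u0 t))).
have cln1 t : {for t, continuous (fun t => ln (u t) + 1)}.
  by apply: cvgD; [exact: cln|exact: cvg_cst].
have dO g t : A g -> 0 < t -> is_derive t 1 (orbit P g x) (orbit P (L g) x t).
  by move=> Ag t0; exact: (is_derive_orbit niceA).
have D20 : 0 <= D2 0.
  apply: (@second_order_ge0 D D1 D2).
  - move=> t; apply: cvgD; first apply: cvgB.
    + by apply: cvgM; [exact: cc|exact: co].
    + exact: co.
    + by apply: cvgM; [exact: co|exact: cln].
  - move=> t; apply: cvgD; first apply: cvgB; first apply: cvgD.
    + by apply: cvgM; [exact: cex|exact: co].
    + by apply: cvgM; [exact: cc|exact/co/AG].
    + exact/co/AG.
    + by apply: cvgM; [exact: cln1|exact/co/AG].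
  - apply: cvgD; first apply: cvgB; first apply: cvgD; first apply: cvgD.
    + by apply: cvgM; [apply: cvgM; [exact: cvg_cst|exact: cex]|exact: co].
    + by apply: cvgM; [exact: cex|exact/co/AG].
    + apply: cvgD; first by apply: cvgM; [exact: cex|exact/co/AG].
      by apply: cvgM; [exact: cc|exact/co/AG/AG].
    + exact/co/AG/AG.
    + apply: cvgD; first apply: cvgM; first apply: cvgM.
      * by apply: cvgV; [rewrite gt_eqF|exact: co].
      * exact/co/AG.
      * exact/co/AG.
      * by apply: cvgM; [exact: cln1|exact/co/AG/AG].
  - move=> t t0; apply: is_derive_add; first apply: is_derive_sub.
    + exact: is_derive_mul (dc t) (dO _ _ Apsi t0).
    + exact: dO.
    + exact: (is_derive_chain (f := fun u => u * ln u) (is_derive_uln (u0 t)) (dO _ _ Af t0)).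
  - move=> t t0; apply: is_derive_add; first apply: is_derive_sub; first apply: is_derive_add.
    + exact: is_derive_mul (dex t) (dO _ _ Apsi t0).
    + exact: is_derive_mul (dc t) (dO _ _ (AG _ Apsi) t0).
    + exact: (dO _ _ (AG _ Aphi) t0).
    + exact: (is_derive_mul (is_derive_chain (f := fun u => ln u + 1)
        (is_derive_ln1 (u0 t)) (dO _ _ Af t0)) (dO _ _ (AG _ Af) t0)).
  - rewrite /D /c log_sobolev_const0 /u !orbitE// !(ms_zero msP)//; try exact: bm.
    by rewrite /phi; ring.
  - rewrite /D1 /c log_sobolev_const0 /ex /u !orbitE// !(ms_zero msP)//;
      try exact/bm; try exact/bm/AG.
    rewrite mulr0 oppr0 expR0 /psi -(entropy_first_order_ln msP niceA diffP x Af bf) -/phi.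
    by ring.
  - move=> t t0; have H : P t phi x - P t f x * ln (P t f x) <= c t * P t psi x.
      exact: lsi Af bf (ltW t0).
    by rewrite /D /u !orbitE ?(ltW t0)//; lra.
move: D20; rewrite /D2 /c log_sobolev_const0 /ex /u !orbitE//.
rewrite !(ms_zero msP)//; try exact/bm; try exact/bm/AG; try exact/bm/AG/AG.
rewrite mulr0 oppr0 expR0.
have Alf : A (fun y => (ln (f y) + 1) * L f y).
  apply: (na_mul niceA); last exact: AG.
  by apply: (na_add niceA); [rewrite hE|exact: (A_const niceA)].
have Lpsi : L psi x = L (L phi) x - L (fun y => (ln (f y) + 1) * L f y) x.
  have -> : psi = fun y => L phi y + -1 * ((ln (f y) + 1) * L f y).
    by apply/funext => y; rewrite /psi -(entropy_first_order_ln msP niceA diffP y Af bf) mulN1r.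
  rewrite (L_add msP niceA) ?(L_scale msP niceA)//.
  - by rewrite mulN1r.
  - exact: AG.
  - exact: (na_scale niceA).
have := entropy_second_order_ln msP niceA diffP x Af bf.
rewrite -/phi; have psiE := fisher_ln msP niceA diffP x Af bf.
rewrite hE in psiE *; rewrite Lpsi [psi x]psiE => H2 HD.
rewrite -(ler_pM2l (expR_gt0 (h x))) -/(f x).
by move: HD H2; rewrite expr2; lra.
Qed.

End LogSobolevToCurvature.

(** * The hypercontractive path *)

Section HypercontractivePath.
Context {d : measure_display} {E : measurableType d} {R : realType}.
Context {P : R -> (E -> R) -> E -> R} {mu : {measure set E -> \bar R}}.
Context {A : set (E -> R)} {rho : R}.
Context (msP : markov_semigroup P) (niceA : nice_algebra P mu A) (diffP : diffusion P A).
Implicit Types (f g : E -> R) (q : R -> R) (u z e s t k h M : R) (x y : E).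

Local Notation L := (generator P).
Local Notation Gam := (Gamma P).

Definition power_flow f t q z y : R := expR (q z * ln (flow P f (t - z) y)).

(** The logarithm, the product by the exponent and the exponential preserve uniform
    differentiability, because their arguments stay in compact sets. *)
Lemma uniform_derive_power_flow f t q s (q1 : R) : A f -> bounded_below f -> s <= t ->
  is_derive s 1 q q1 ->
  uniform_derive (power_flow f t q) s (fun y => power_flow f t q s y *
    (q1 * ln (P (t - s) f y) + q s * ((P (t - s) f y)^-1 * - P (t - s) (L f) y))).
Proof.
move=> Af [e e0 fe] st dq; have [M M0 fM] := A_bounded niceA Af.
have feM y : e <= f y <= M.
  by rewrite fe/=; have := fM y; rewrite ler_norml => /andP[].
have e20 : 0 < e / 2 by rewrite divr_gt0.
have ts : 0 <= t - s by rewrite subr_ge0.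
have AL := na_generator niceA Af.
have [B B0 HB] := A_bounded niceA AL.
have Hr := flow_range msP niceA Af e0 feM st.
have dw := uniform_derive_flow msP niceA Af st.
have PL y : `|- P (t - s) (L f) y| <= B.
  by rewrite normrN; apply: (P_norm_le msP) => //; exact: (A_bounded_measurable niceA).
have dln z : e / 2 <= z <= M + e / 2 -> is_derive z 1 (@ln R) z^-1.
  by move=> /andP[ez _]; apply: is_derive1_ln; exact: lt_le_trans ez.
have dinv z : e / 2 <= z <= M + e / 2 -> is_derive z 1 (fun z : R => z^-1) (- 1 / z ^+ 2).
  move=> /andP[ez _]; apply: is_derive_inv (is_derive_var z) _.
  by rewrite gt_eqF// (lt_le_trans e20).
have bV z : e / 2 <= z <= M + e / 2 -> `|z^-1| <= (e / 2)^-1.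
  move=> /andP[ez _]; have z0 := lt_le_trans e20 ez.
  by rewrite gtr0_norm ?invr_gt0// lef_pV2 ?posrE.
have bV2 z : e / 2 <= z <= M + e / 2 -> `|- 1 / z ^+ 2| <= (e / 2)^-1 ^+ 2.
  move=> iz; rewrite mulN1r normrN -exprVn normrX lerXn2r ?nnegrE ?bV//.
  by rewrite invr_ge0 ltW.
have dl := uniform_derive_comp dln dinv bV bV2 Hr PL dw.
set l := `|ln (e / 2)| + `|ln (M + e / 2)|.
pose N := Num.max l ((e / 2)^-1 * B).
have bl : exists2 r, 0 < r & forall h y, `|h| < r -> `|ln (flow P f (t - (s + h)) y)| <= N.
  have [r r0 H] := Hr; exists r => // h y hr; rewrite le_max; apply/orP; left.
  by apply: ln_norm_le => //; exact: H.
have bl1 y : `|(flow P f (t - s) y)^-1 * - P (t - s) (L f) y| <= N.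
  rewrite le_max; apply/orP; right; rewrite normrM; apply: ler_pM => //.
  have [r r0 H] := Hr; have := H 0 y; rewrite addr0 normr0 => /(_ r0); exact: bV.
have dql := uniform_derive_scale dq bl bl1 dl.
have [rq rq0 Hq] : exists2 r, 0 < r & forall h, `|h| < r ->
    `|q (s + h)| <= `|q s| + `|q1| + 1.
  move/is_deriveP : (dq) => /(_ 1 ltr01)[r r0 H].
  exists (Num.min r 1) => [|h]; first by rewrite lt_min r0 ltr01.
  rewrite lt_min => /andP[hr h1]; have := H h hr; rewrite mul1r => H'.
  rewrite (_ : q (s + h) = q (s + h) - q s - h * q1 + (q s + h * q1)); last by ring.
  apply: le_trans (ler_normD _ _) _; have := ler_normD (q s) (h * q1).
  have : `|h * q1| <= `|q1| by rewrite normrM ler_piMl// ltW.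
  lra.
pose K := (`|q s| + `|q1| + 1) * N.
have N0 : 0 <= N by rewrite le_max addr_ge0.
have bql : exists2 r, 0 < r & forall h y, `|h| < r ->
    - K <= q (s + h) * ln (flow P f (t - (s + h)) y) <= K.
  have [r r0 H] := bl; exists (Num.min r rq) => [|h y]; first by rewrite lt_min r0.
  rewrite lt_min => /andP[hr hq]; rewrite -ler_norml normrM /K.
  by apply: ler_pM => //; [exact: Hq|exact: H].
pose Mw := `|q1| * N + `|q s| * N.
have bql1 y : `|q1 * ln (flow P f (t - s) y) + q s *
    ((flow P f (t - s) y)^-1 * - P (t - s) (L f) y)| <= Mw.
  apply: le_trans (ler_normD _ _) _; rewrite !normrM -normrM; apply: lerD.
    rewrite normrM ler_wpM2l//; have [r r0 H] := bl.
    by have := H 0 y; rewrite addr0 normr0; exact.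
  by rewrite ler_wpM2l// -normrM.
have dE z : - K <= z <= K -> is_derive z 1 (@expR R) (expR z) by move=> _; exact: is_derive_expR.
have bE z : - K <= z <= K -> `|expR z| <= expR K.
  by move=> /andP[_ zK]; rewrite ger0_norm ?expR_ge0// ler_expR.
have := uniform_derive_comp dE dE bE bE bql bql1 dql.
by rewrite /power_flow !flow_ge0E.
Qed.

Lemma A_power f k : A f -> bounded_below f -> A (fun y => expR (k * ln (f y))).
Proof. by move=> Af bf; apply: (A_exp niceA); exact: (A_ln_bb niceA). Qed.

Lemma bounded_below_power f k : A f -> bounded_below f ->
  bounded_below (fun y => expR (k * ln (f y))).
Proof.
move=> Af bf; have [M M0 HM] := A_bounded niceA (na_scale niceA k (A_ln_bb niceA Af bf)).
exists (expR (- M)); first exact: expR_gt0.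
by move=> y; rewrite ler_expR; have := HM y; rewrite ler_norml => /andP[].
Qed.

Lemma is_derive_P_power_flow f t q s (q1 : R) x : A f -> bounded_below f ->
  0 < s -> s <= t -> is_derive s 1 q q1 ->
  let l y := ln (P (t - s) f y) in let W y := expR (q s * l y) in
  is_derive s 1 (fun z => P z (power_flow f t q z) x)
    (q1 * P s (fun y => W y * l y) x +
     (q s ^+ 2 - q s) * P s (fun y => W y * Gam l l y) x).
Proof.
move=> Af bf s0 st dq l W; have ts : 0 <= t - s by rewrite subr_ge0.
have bm := A_bounded_measurable niceA; have AG := na_generator niceA.
have Au := na_semigroup niceA ts Af; have bu := bounded_below_P msP niceA Af bf ts.
have Al : A l by exact: (A_ln_bb niceA).
have AW : A W by exact: A_power.
have Awl : A (fun y => W y * l y) by exact: (na_mul niceA).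
have AGl : A (fun y => W y * Gam l l y).
  by apply: (na_mul niceA) => //; exact: (A_Gamma niceA).
have wE : power_flow f t q s = W by rewrite /power_flow flow_ge0E.
pose w1 y := W y * (q1 * l y + q s * ((P (t - s) f y)^-1 * - P (t - s) (L f) y)).
have Aw1 : A w1.
  apply: (na_mul niceA) => //; apply: (na_add niceA); first exact: (na_scale niceA).
  apply: (na_scale niceA); apply: (na_mul niceA); first exact: (A_inv niceA).
  under eq_fun do rewrite -mulN1r.
  by apply/(na_scale niceA)/(na_semigroup niceA) => //; exact: AG.
have dw : uniform_derive (power_flow f t q) s w1.
  by have := uniform_derive_power_flow Af bf st dq; rewrite wE.
have bw : exists2 r, 0 < r & forall h, `|h| < r ->
    bounded_measurable (power_flow f t q (s + h)).
  have [e e0 fe] := bf; have [M M0 fM] := A_bounded niceA Af.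
  have feM y : e <= f y <= M.
    by rewrite fe/=; have := fM y; rewrite ler_norml => /andP[].
  have [r r0 Hr] := flow_range msP niceA Af e0 feM st.
  exists r => // h hr; apply: bm; apply: A_power; first exact: (A_flow niceA).
  by exists (e / 2); [rewrite divr_gt0|move=> y; have /andP[] := Hr h y hr].
have Aw : A (power_flow f t q s) by rewrite wE.
have := is_derive_P_family msP niceA x s0 Aw Aw1 bw dw.
move/is_derive_eq; apply; rewrite wE.
rewrite -!(P_scale msP _ _ (ltW s0)); try exact: bm.
rewrite -(P_add msP _ (ltW s0)); try by apply: bm; exact: (na_scale niceA).
congr (P s _ x); apply/funext => y.
rewrite (L_exp diffP (q s) y Al) /w1 -(na_commute niceA ts Af).
have -> : L (P (t - s) f) y = P (t - s) f y * (L l y + Gam l l y).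
  have lE : (fun y => expR (1 * l y)) = P (t - s) f.
    by rewrite -[RHS](lnK_bb bu); apply/funext => y'; rewrite mul1r.
  have := L_exp diffP 1 y Al; rewrite lE !mul1r expr1n mul1r => ->.
  by rewrite lnK// posrE bounded_below_gt0.
have u0 : P (t - s) f y != 0 by rewrite gt_eqF// bounded_below_gt0.
by rewrite -/(W y); field.
Qed.

Definition log_Pnorm f t q x z : R := ln (P z (power_flow f t q z) x) / q z.

(** The differential equation for the exponent turns the derivative of the logarithm
    of the norm into a multiple of the defect in the logarithmic Sobolev inequality
    for [(P_(t-s) f) ^ q]. *)
Lemma is_derive_log_Pnorm f t q s (q1 : R) x : A f -> bounded_below f ->
  0 < s -> s <= t -> is_derive s 1 q q1 -> q s != 0 ->
  q1 * log_sobolev_const rho s = - (q s - 1) ->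
  let W := power_flow f t q s in
  is_derive s 1 (log_Pnorm f t q x) (q1 / (q s ^+ 2 * P s W x) *
    (Ent P s W x - log_sobolev_const rho s * P s (fun y => Gam W W y / W y) x)).
Proof.
move=> Af bf s0 st dq qs0 qode W; have ts : 0 <= t - s by rewrite subr_ge0.
have bm := A_bounded_measurable niceA.
have Au := na_semigroup niceA ts Af; have bu := bounded_below_P msP niceA Af bf ts.
pose l y := ln (P (t - s) f y).
have Al : A l by exact: (A_ln_bb niceA).
have WE : W = fun y => expR (q s * l y) by rewrite /W /power_flow flow_ge0E.
have AW : A W by rewrite WE; exact: A_power.
have bW : bounded_below W by rewrite WE; exact: bounded_below_power.
have F0 : 0 < P s W x by apply: (P_gt0 msP niceA) => //; exact: ltW.
have dF : is_derive s 1 (fun z => P z (power_flow f t q z) x)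
    (q1 * P s (fun y => W y * l y) x +
     (q s ^+ 2 - q s) * P s (fun y => W y * Gam l l y) x).
  by rewrite WE; exact: is_derive_P_power_flow.
have dN := is_derive_mul (is_derive_chain (f := @ln R) (is_derive1_ln F0) dF)
  (is_derive_inv dq qs0).
apply: is_derive_eq dN _; rewrite -/W /Ent.
have -> : P s (fun y => W y * ln (W y)) x = q s * P s (fun y => W y * l y) x.
  rewrite -(P_scale msP _ _ (ltW s0)); last by apply: bm; exact: (na_mul niceA).
  by congr (P s _ x); apply/funext => y; rewrite {2}WE expRK; ring.
have -> : P s (fun y => Gam W W y / W y) x = q s ^+ 2 * P s (fun y => W y * Gam l l y) x.
  rewrite -(P_scale msP _ _ (ltW s0)); last first.
    by apply: bm; apply: (na_mul niceA) => //; exact: (A_Gamma niceA).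
  by congr (P s _ x); apply/funext => y; rewrite WE (Gamma_exp_diag msP niceA diffP).
set a := P s (fun y => W y * l y) x; set b := P s (fun y => W y * Gam l l y) x.
set F := P s W x in F0 *; set c := log_sobolev_const rho s in qode *.
rewrite (_ : (q s ^+ 2 - q s) = - q s * (q1 * c)); last by rewrite qode; ring.
by field; rewrite qs0 gt_eqF.
Qed.

(** The exponent interpolating between [P_t (f ^ q0)] and the norms at earlier
    times. *)
Definition path_exponent t (q0 : R) z : R :=
  1 + (q0 - 1) * rate_time rho t * (rate_time rho z)^-1.

Lemma path_exponent_end t (q0 : R) : 0 < t -> path_exponent t q0 t = q0.
Proof.
move=> t0; rewrite /path_exponent mulfK ?gt_eqF ?rate_time_gt0//; ring.
Qed.

Lemma path_exponentE t (q0 : R) s : 0 < s ->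
  path_exponent t q0 s = 1 + (q0 - 1) * hypercontractivity_ratio rho s t.
Proof. by move=> s0; rewrite hypercontractivity_ratioE// /path_exponent mulrA. Qed.

Definition path_exponent1 t (q0 : R) z : R :=
  (q0 - 1) * rate_time rho t * (- expR (2 * rho * z) / rate_time rho z ^+ 2).

Lemma is_derive_path_exponent t (q0 : R) z : 0 < z ->
  is_derive z 1 (path_exponent t q0) (path_exponent1 t q0 z).
Proof.
move=> z0; have r0 : rate_time rho z != 0 by rewrite gt_eqF// rate_time_gt0.
apply: is_derive_eq (is_derive_add (is_derive_const 1 z) (is_derive_scale _
  (is_derive_inv (is_derive_rate_time rho z) r0))) _.
by rewrite add0r.
Qed.

(** The clock satisfies [rate_time' * log_sobolev_const = rate_time]. *)
Lemma path_exponent_ode t (q0 : R) z : 0 < z ->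
  path_exponent1 t q0 z * log_sobolev_const rho z = - (path_exponent t q0 z - 1).
Proof.
move=> z0; rewrite /path_exponent /path_exponent1.
have r0 := rate_time_gt0 rho z0; set T := rate_time rho t.
move: r0; rewrite /rate_time => r0.
by field; rewrite !gt_eqF ?expR_gt0// log_sobolev_const_gt0.
Qed.

Lemma path_exponent1_factor t (q0 : R) z : 0 < z -> 0 < t ->
  exists2 k, 0 < k & path_exponent1 t q0 z = - (q0 - 1) * k.
Proof.
move=> z0 t0; exists (rate_time rho t * (expR (2 * rho * z) / rate_time rho z ^+ 2)).
  by rewrite mulr_gt0 ?rate_time_gt0// divr_gt0 ?expR_gt0// exprn_gt0// rate_time_gt0.
by rewrite /path_exponent1; ring.
Qed.

End HypercontractivePath.

Arguments power_flow {d E R} P f t q z y.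
Arguments log_Pnorm {d E R} P f t q x z.
Arguments path_exponent {R} rho t q0 z.

(** * Logarithmic Sobolev and hypercontractivity, away from zero *)

Section DerivativeSign.
Context {R : realType}.
Implicit Types (F : R -> R) (s t z m : R).

Lemma derivative_ge0_le F s t : s <= t ->
  (forall z, s <= z <= t -> exists2 m, 0 <= m & is_derive z 1 F m) -> F s <= F t.
Proof.
move=> st H; have dF z : z \in `[s, t] -> derivable F z 1.
  by rewrite in_itv/= => /H[m _ []].
have dF' z : z \in `]s, t[ -> is_derive z 1 F (derive1 F z).
  move=> zst; rewrite derive1E; apply: derivableP; apply: dF.
  exact: subset_itv_oo_cc.
have [z zst] := MVT_segment st dF' (derivable_within_continuous dF).
have [m m0 [_ Fz]] : exists2 m, 0 <= m & is_derive z 1 F m.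
  by apply: H; move: zst; rewrite in_itv.
by rewrite derive1E Fz -subr_ge0 => ->; rewrite mulr_ge0// subr_ge0.
Qed.

Lemma left_derivative_ge0 F t m r : is_derive t 1 F m -> r < t ->
  (forall z, r < z < t -> F z <= F t) -> 0 <= m.
Proof.
move=> /is_deriveP dF rt HF; apply/ler_addgt0Pl => e e0; rewrite addrC.
have [d d0 Hd] := dF e e0.
pose h := Num.min d (t - r) / 2.
have h0 : 0 < h by rewrite divr_gt0// lt_min d0 subr_gt0.
have [hd hr] : h < d /\ h < t - r.
  have : h < Num.min d (t - r) by move: h0; rewrite /h; lra.
  by rewrite lt_min => /andP.
have := Hd (- h); rewrite normrN gtr0_norm// => /(_ hd).
have itz : r < t - h < t by apply/andP; split; lra.
have := HF _ itz; rewrite ler_norml => Hz /andP[h1 h2].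
rewrite -(pmulr_rge0 _ h0); lra.
Qed.

End DerivativeSign.

Section AwayFromZero.
Context {d : measure_display} {E : measurableType d} {R : realType}.
Context {P : R -> (E -> R) -> E -> R} {mu : {measure set E -> \bar R}}.
Context {A : set (E -> R)} {rho : R}.
Context (msP : markov_semigroup P) (niceA : nice_algebra P mu A) (diffP : diffusion P A).
Implicit Types (f g : E -> R) (q : R -> R) (u z e s t k h M p : R) (x y : E).

Local Notation L := (generator P).
Local Notation Gam := (Gamma P).

Lemma rate_time_le s t : 0 < s -> s <= t -> rate_time rho s <= rate_time rho t.
Proof.
move=> s0 st; apply: derivative_ge0_le => // z _; exists (expR (2 * rho * z)).
  exact: expR_ge0.
exact: is_derive_rate_time.
Qed.

Lemma hypercontractivity_ratio_ge1 s t : 0 < s -> s <= t ->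
  1 <= hypercontractivity_ratio rho s t.
Proof.
move=> s0 st; rewrite hypercontractivity_ratioE// ler_pdivlMr ?rate_time_gt0// mul1r.
exact: rate_time_le.
Qed.

Lemma path_exponent_between s t z p : 0 < s -> s <= z -> z <= t ->
  0 <= (p - 1) * (path_exponent rho t p z - p) /\
  0 <= (p - 1) * (path_exponent rho t p s - path_exponent rho t p z).
Proof.
move=> s0 sz zt; have z0 := lt_le_trans s0 sz; have t0 := lt_le_trans z0 zt.
have rs := rate_time_gt0 rho s0; have rz := rate_time_gt0 rho z0.
have rt := rate_time_gt0 rho t0.
have sq : 0 <= (p - 1) ^+ 2 by rewrite sqr_ge0.
split.
  have -> : (p - 1) * (path_exponent rho t p z - p) =
      (p - 1) ^+ 2 * (hypercontractivity_ratio rho z t - 1).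
    by rewrite path_exponentE//; ring.
  by apply: mulr_ge0 => //; rewrite subr_ge0; exact: hypercontractivity_ratio_ge1.
have -> : (p - 1) * (path_exponent rho t p s - path_exponent rho t p z) =
    (p - 1) ^+ 2 * rate_time rho t * ((rate_time rho s)^-1 - (rate_time rho z)^-1).
  by rewrite /path_exponent; ring.
apply: mulr_ge0; first by apply: mulr_ge0 => //; exact: ltW.
by rewrite subr_ge0 lef_pV2 ?posrE//; exact: rate_time_le.
Qed.

Lemma Pnorm_bounded_below f s p x : A f -> bounded_below f -> 0 <= s -> p != 0 ->
  Pnorm P s p f x = (expR (ln (P s (fun y => expR (p * ln (f y))) x) / p))%:E.
Proof.
move=> Af bf s0 p0; have AW := A_power niceA p Af bf.
have bW := bounded_below_power niceA p Af bf.
have F0 := P_gt0 msP niceA x AW bW s0.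
have pE (r a : R) : 0 < r -> epow r%:E a = (expR (a * ln r))%:E.
  by move=> r0; rewrite epow_EFin// /powR gt_eqF.
rewrite /Pnorm.
have -> : (fun y => epow (f y)%:E p) = fun y => (expR (p * ln (f y)))%:E.
  by apply/funext => y; rewrite pE// bounded_below_gt0.
rewrite extP_bounded//; first by rewrite pE// mulrC.
exact: (A_bounded_measurable niceA).
Qed.

Lemma Pnorm_log_Pnorm f t q z x : A f -> bounded_below f -> 0 <= z -> z <= t ->
  q z != 0 ->
  Pnorm P z (q z) (P (t - z) f) x = (expR (log_Pnorm P f t q x z))%:E.
Proof.
move=> Af bf z0 zt qz; have tz : 0 <= t - z by rewrite subr_ge0.
have Au := na_semigroup niceA tz Af; have bu := bounded_below_P msP niceA Af bf tz.
rewrite (Pnorm_bounded_below x Au bu z0 qz).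
by rewrite /log_Pnorm /power_flow flow_ge0E.
Qed.

Lemma A_power_flow f t q z : A f -> bounded_below f -> z <= t ->
  A (power_flow P f t q z) /\ bounded_below (power_flow P f t q z).
Proof.
rewrite -subr_ge0 => Af bf tz; have Au := na_semigroup niceA tz Af.
have bu := bounded_below_P msP niceA Af bf tz.
rewrite /power_flow flow_ge0E//.
by split; [exact: (A_power niceA)|exact: (bounded_below_power niceA)].
Qed.

Lemma log_Pnorm_derivative f t z p x : A f -> bounded_below f ->
  0 < z -> z <= t -> path_exponent rho t p z != 0 ->
  let W := power_flow P f t (path_exponent rho t p) z in
  exists2 k, 0 < k &
    is_derive z 1 (log_Pnorm P f t (path_exponent rho t p) x)
      ((p - 1) * (k * (log_sobolev_const rho z * P z (fun y => Gam W W y / W y) x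
                        - Ent P z W x))).
Proof.
move=> Af bf z0 zt pz W; have t0 := lt_le_trans z0 zt; have tz : 0 <= t - z by rewrite subr_ge0.
have dN := is_derive_log_Pnorm msP niceA diffP x Af bf z0 zt
  (is_derive_path_exponent (rho := rho) t p z0) pz (path_exponent_ode (rho := rho) t p z0).
have [k k0 kE] := path_exponent1_factor (rho := rho) p z0 t0.
have F0 : 0 < P z W x.
  have [AW bW] := A_power_flow (path_exponent rho t p) Af bf zt.
  by apply: (P_gt0 msP niceA) => //; exact: ltW.
exists (k / (path_exponent rho t p z ^+ 2 * P z W x)).
  by rewrite divr_gt0// mulr_gt0// exprn_even_gt0.
by apply: is_derive_eq dN _; rewrite kE -/W; field; rewrite pz gt_eqF.
Qed.

Hypothesis lsi : forall f t x, A f -> bounded_below f -> 0 <= t ->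
  log_sobolev_at P rho f t x.

Let defect_ge0 f z x : A f -> bounded_below f -> 0 < z ->
  0 <= log_sobolev_const rho z * P z (fun y => Gam f f y / f y) x - Ent P z f x.
Proof. by move=> Af bf z0; rewrite subr_ge0; exact: lsi Af bf (ltW z0). Qed.

Lemma log_sobolev_path_le f s t p x : A f -> bounded_below f -> 0 < s -> s <= t ->
  1 < p ->
  log_Pnorm P f t (path_exponent rho t p) x s <=
  log_Pnorm P f t (path_exponent rho t p) x t.
Proof.
move=> Af bf s0 st p1; apply: derivative_ge0_le => // z /andP[sz zt].
have z0 := lt_le_trans s0 sz.
have pz : path_exponent rho t p z != 0.
  have [h _] := path_exponent_between p s0 sz zt.
  by rewrite pmulr_rge0 ?subr_gt0// in h; rewrite gt_eqF//; lra.
have [k k0 dN] := log_Pnorm_derivative x Af bf z0 zt pz.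
set m := (X in is_derive _ _ _ X) in dN; exists m => //.
rewrite /m mulr_ge0 ?subr_ge0 ?(ltW p1)//.
have [AW bW] := A_power_flow (path_exponent rho t p) Af bf zt.
by apply: mulr_ge0; [exact: ltW|exact: defect_ge0].
Qed.

Lemma log_sobolev_path_ge f s t p x : A f -> bounded_below f -> 0 < s -> s <= t ->
  p < 1 -> (p < 0 \/ 0 < path_exponent rho t p s) ->
  log_Pnorm P f t (path_exponent rho t p) x t <=
  log_Pnorm P f t (path_exponent rho t p) x s.
Proof.
move=> Af bf s0 st p1 qs; rewrite -lerN2.
apply: (derivative_ge0_le
  (F := fun z => - log_Pnorm P f t (path_exponent rho t p) x z)) => //.
move=> z /andP[sz zt].
have z0 := lt_le_trans s0 sz.
have pz : path_exponent rho t p z != 0.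
  have [h1 h2] := path_exponent_between p s0 sz zt.
  rewrite nmulr_rge0 ?subr_lt0// in h1; rewrite nmulr_rge0 ?subr_lt0// in h2.
  by case: qs => h; [rewrite lt_eqF|rewrite gt_eqF]; lra.
have [k k0 dN] := log_Pnorm_derivative x Af bf z0 zt pz.
set m := (X in is_derive _ _ _ X) in dN; exists (- m); last exact: is_deriveN dN.
rewrite /m -mulNr opprB mulr_ge0 ?subr_ge0 ?(ltW p1)//.
have [AW bW] := A_power_flow (path_exponent rho t p) Af bf zt.
by apply: mulr_ge0; [exact: ltW|exact: defect_ge0].
Qed.

End AwayFromZero.

Section Converses.
Context {d : measure_display} {E : measurableType d} {R : realType}.
Context {P : R -> (E -> R) -> E -> R} {mu : {measure set E -> \bar R}}.
Context {A : set (E -> R)} {rho : R}.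
Context (msP : markov_semigroup P) (niceA : nice_algebra P mu A) (diffP : diffusion P A).
Implicit Types (f g : E -> R) (q : R -> R) (u z e s t k h M p r : R) (x y : E).

Local Notation L := (generator P).
Local Notation Gam := (Gamma P).

Lemma bounded_below_positive_in f : A f -> bounded_below f -> positive_in A f.
Proof. by move=> Af bf; split=> // y; exact: bounded_below_gt0. Qed.

Lemma local_log_sobolev_bounded_below : local_log_sobolev P A rho ->
  forall f t x, A f -> bounded_below f -> 0 <= t -> log_sobolev_at P rho f t x.
Proof.
move=> lsi f t x Af bf t0.
have := lsi f t x (bounded_below_positive_in Af bf) t0.
rewrite extP_bounded//.
- exact/(A_bounded_measurable niceA)/(A_fisher niceA).
- move=> y; rewrite divr_ge0 ?(Gamma_ge0 msP niceA)//.
  exact: ltW (bounded_below_gt0 y bf).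
Qed.

(** The path of norms for [f ^ (1 / p)] ends, at time [t] and exponent [p], at the
    norm of [f], and the derivative of its logarithm is then a nonzero multiple of
    the defect for [f] itself. *)
Lemma log_sobolev_of_path f t p r x : A f -> bounded_below f -> 0 < t ->
  p != 0 -> p != 1 -> r < t ->
  (forall z, r < z < t ->
    let N := log_Pnorm P (fun y => expR (p^-1 * ln (f y))) t (path_exponent rho t p) x in
    (p - 1) * N z <= (p - 1) * N t :> R) ->
  log_sobolev_at P rho f t x.
Proof.
move=> Af bf t0 p0 p1 rt; set g := (fun y => expR (p^-1 * ln (f y))) => H.
have Ag : A g by exact: (A_power niceA).
have bg : bounded_below g by exact: (bounded_below_power niceA).
have pt := path_exponent_end (rho := rho) p t0.
have ptn : path_exponent rho t p t != 0 by rewrite pt.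
have [k k0 dN] := log_Pnorm_derivative msP niceA diffP x Ag bg t0 (lexx t) ptn.
have wE : power_flow P g t (path_exponent rho t p) t = f.
  rewrite /power_flow pt flow_ge0E subrr// (ms_zero msP); last exact: (A_bounded_measurable niceA).
  apply/funext => y; rewrite expRK mulrA divff// mul1r lnK//.
  by rewrite posrE bounded_below_gt0.
rewrite wE in dN.
have := left_derivative_ge0 (is_derive_scale (p - 1) dN) rt H.
have pp : 0 < (p - 1) ^+ 2 by rewrite exprn_even_gt0//= subr_eq0.
by rewrite mulrA -expr2 pmulr_rge0// pmulr_rge0// subr_ge0.
Qed.

Lemma hypercontractivity_log_sobolev : local_hypercontractivity P A rho ->
  forall f t x, A f -> bounded_below f -> 0 <= t -> log_sobolev_at P rho f t x.
Proof.
move=> hyp f t x Af bf; rewrite le_eqVlt => /predU1P[<-|t0].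
  exact: (log_sobolev_at0 msP niceA).
apply: (@log_sobolev_of_path f t 2 0) => //; first by rewrite gt_eqF// ltr1n.
move=> z /andP[z0 zt] /=; set g := (fun y => _).
have Ag : A g by exact: (A_power niceA).
have bg : bounded_below g by exact: (bounded_below_power niceA).
have [pz _] := path_exponent_between (rho := rho) 2 z0 (lexx z) (ltW zt).
have e1 : 2 - 1 = 1 :> R by ring.
rewrite e1 !mul1r subr_ge0 in pz *.
have ratio : (path_exponent rho t 2 z - 1) / (2 - 1) = hypercontractivity_ratio rho z t.
  by rewrite path_exponentE// e1; field.
have pt := path_exponent_end (rho := rho) 2 t0.
have pz0 : 0 < path_exponent rho t 2 z by apply: lt_le_trans pz.
have := hyp z t 2 (path_exponent rho t 2 z) z0 (ltW zt) (ltr1n _ 2) pz ratio g x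
  (bounded_below_positive_in Ag bg).
rewrite (Pnorm_log_Pnorm msP niceA (q := path_exponent rho t 2))//; try exact: ltW.
  have := Pnorm_log_Pnorm msP niceA (q := path_exponent rho t 2) x Ag bg (ltW t0) (lexx t).
  rewrite pt subrr (ms_zero msP) => [->//|]; last exact: (A_bounded_measurable niceA).
  by rewrite lee_fin ler_expR.
by rewrite gt_eqF.
Qed.

Lemma reverse_hypercontractivity_log_sobolev : local_reverse_hypercontractivity P A rho ->
  forall f t x, A f -> bounded_below f -> 0 <= t -> log_sobolev_at P rho f t x.
Proof.
move=> hyp f t x Af bf; rewrite le_eqVlt => /predU1P[<-|t0].
  exact: (log_sobolev_at0 msP niceA).
pose p : R := 2^-1; have p0 : 0 < p by rewrite invr_gt0.
have p1 : p < 1 by rewrite invf_lt1// ltr1n.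
have pt := path_exponent_end (rho := rho) p t0.
(* the hypothesis asks for positive exponents, which the path has close to time [t] *)
have [a [a0 at' Ha]] : exists a, [/\ 0 <= a, a < t & forall z, a < z < t ->
    0 < path_exponent rho t p z].
  have := is_derive_continuous (is_derive_path_exponent (rho := rho) t p t0).
  move/cvgrPdist_lt => /(_ p p0) [/= e e0 He].
  exists (Num.max 0 (t - e)); split; first by rewrite le_max lexx.
    by rewrite gt_max t0/= ltrBlDr ltrDl.
  move=> z; rewrite gt_max => /andP[/andP[_ tez] zt].
  have zE : `|t - z| < e by rewrite gtr0_norm ?subr_gt0// ltrBlDr -ltrBlDl.
  have /= := He z zE; rewrite pt ltr_norml => /andP[_]; lra.
apply: (@log_sobolev_of_path f t p a) => //; [exact: lt0r_neq0|by rewrite lt_eqF|].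
move=> z /andP[az zt] /=; set g := (fun y => _).
have z0 : 0 < z by exact: le_lt_trans az.
have Ag : A g by exact: (A_power niceA).
have bg : bounded_below g by exact: (bounded_below_power niceA).
have [pz _] := path_exponent_between (rho := rho) p z0 (lexx z) (ltW zt).
have pz0 : 0 < path_exponent rho t p z by apply: Ha; rewrite az.
have p10 : p - 1 < 0 by rewrite subr_lt0.
rewrite nmulr_rge0// subr_le0 in pz; rewrite ler_nM2l//.
have ratio : (path_exponent rho t p z - 1) / (p - 1) = hypercontractivity_ratio rho z t.
  by rewrite path_exponentE//; field; rewrite lt_eqF.
have := hyp z t p (path_exponent rho t p z) z0 (ltW zt)
  (or_introl (conj pz0 (conj pz p1))) ratio g x (bounded_below_positive_in Ag bg).
rewrite (Pnorm_log_Pnorm msP niceA (q := path_exponent rho t p))//; try exact: ltW.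
  have := Pnorm_log_Pnorm msP niceA (q := path_exponent rho t p) x Ag bg (ltW t0) (lexx t).
  rewrite pt subrr (ms_zero msP) => [->|]; last exact: (A_bounded_measurable niceA).
    by rewrite lee_fin ler_expR.
  exact: lt0r_neq0.
by rewrite gt_eqF.
Qed.

End Converses.

(** * Positive functions that approach zero *)

Section Powers.
Context {R : realType}.
Implicit Types (u v e k p q : R).

Lemma powR_gt0E u p : 0 < u -> u `^ p = expR (p * ln u).
Proof. by move=> u0; rewrite /powR gt_eqF. Qed.

Lemma powRK u p : 0 <= u -> p != 0 -> (u `^ p) `^ p^-1 = u.
Proof. by move=> u0 p0; rewrite -powRrM divff// powRr1. Qed.

Lemma le_powR_neg u v p : 0 < u -> u <= v -> p <= 0 -> v `^ p <= u `^ p.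
Proof.
move=> u0 uv p0; have v0 := lt_le_trans u0 uv.
rewrite !powR_gt0E// ler_expR ler_wnM2l// ler_ln ?posrE//.
Qed.

Lemma powR_inv_le_neg u v p q : 0 < u -> 0 < v -> q < 0 ->
  u `^ p^-1 <= v `^ q^-1 -> v <= u `^ (q / p).
Proof.
move=> u0 v0 q0 uv; have := le_powR_neg (powR_gt0 p^-1 u0) uv (ltW q0).
by rewrite -!powRrM mulVf ?ltr0_neq0// (powRr1 (ltW v0)) mulrC.
Qed.

Lemma cvg_powR1D p : {for 0, continuous (fun k : R => (1 + k) `^ p)}.
Proof.
have d1 : is_derive (0 : R) 1 (fun k => 1 + k) (0 + 1).
  exact: is_derive_add (is_derive_const 1 0) (is_derive_var 0).
have h1 : (0 : R) < 1 + 0 by rewrite addr0.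
exact: is_derive_continuous (is_derive_chain (f := fun u => u `^ p) (is_derive1_powR p h1) d1).
Qed.

(** A perturbation of the base is absorbed by a factor close to one where the base
    is large, and by a small constant where it is small. *)
Lemma powR_perturb p k : 0 < p -> 0 < k -> exists2 e, 0 < e &
  forall u, 0 <= u -> (u + e) `^ p <= (1 + k) `^ p * u `^ p + k.
Proof.
move=> p0 k0; have p0' := ltW p0; pose e := k `^ p^-1 / (1 + k^-1).
have k1 : 0 < 1 + k^-1 by rewrite addr_gt0 ?invr_gt0.
have e0 : 0 < e by rewrite divr_gt0// powR_gt0.
exists e => // u u0; have [ku|ku] := leP e (k * u).
  rewrite -powRM//; last by rewrite addr_ge0// ltW.
  rewrite ler_wpDr ?(ltW k0)//; apply: ge0_ler_powR; rewrite ?nnegrE//.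
  - by rewrite addr_ge0// ltW.
  - by rewrite mulr_ge0// addr_ge0// ltW.
  - by rewrite mulrDl mul1r lerD2l.
rewrite ler_wpDl ?mulr_ge0 ?powR_ge0//.
have -> : k = (e * (1 + k^-1)) `^ p.
  by rewrite divfK ?gt_eqF// -powRrM mulVf ?gt_eqF// powRr1 ?ltW.
apply: ge0_ler_powR; rewrite ?nnegrE//.
- by rewrite addr_ge0// ltW.
- by rewrite mulr_ge0// ltW.
- rewrite mulrDr mulr1 addrC lerD2l -ler_pdivrMr ?invr_gt0// invrK mulrC.
  by rewrite ltW.
Qed.

Lemma uln_le u v : 0 <= u -> u <= v -> u * ln u <= u * ln v.
Proof.
rewrite le_eqVlt => /predU1P[<-|u0] uv; first by rewrite !mul0r.
by rewrite ler_pM2l// ler_ln ?posrE// (lt_le_trans u0).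
Qed.

Lemma uln_ge u e : 0 <= u -> 0 < e -> u * ln (u + e) <= u * ln u + e.
Proof.
rewrite le_eqVlt => /predU1P[<-|u0] e0; first by rewrite !mul0r add0r ltW.
have ue : 0 < 1 + e / u by rewrite addr_gt0// divr_gt0.
have -> : u + e = u * (1 + e / u) by field; rewrite gt_eqF.
rewrite lnM ?posrE// mulrDr lerD2l.
have := @le_ln1Dx R (e / u); rewrite (lt_trans (ltrN10 R)) ?divr_gt0// => /(_ isT).
by rewrite -(ler_pM2l u0) mulrCA divff ?gt_eqF// mulr1.
Qed.

Lemma norm_uln_le u k : 0 < u -> u <= k -> `|u * ln u| <= 1 + k ^+ 2.
Proof.
move=> u0 uk; have k0 := lt_le_trans u0 uk.
have h1 : u * ln u <= u ^+ 2.
  by rewrite expr2 ler_pM2l// ltW// ln_sublinear.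
have h2 : - 1 <= u * ln u.
  have : ln u^-1 <= u^-1 by rewrite ltW// ln_sublinear// invr_gt0.
  rewrite lnV ?posrE// -(ler_pM2l u0) divff ?gt_eqF//; lra.
have : u ^+ 2 <= k ^+ 2 by rewrite lerXn2r ?nnegrE// ltW.
have : 0 <= u ^+ 2 by rewrite sqr_ge0.
by move=> *; rewrite ler_norml; apply/andP; split; lra.
Qed.

End Powers.

Section PositiveFunctions.
Context {d : measure_display} {E : measurableType d} {R : realType}.
Context {P : R -> (E -> R) -> E -> R} {mu : {measure set E -> \bar R}}.
Context {A : set (E -> R)} {rho : R}.
Context (msP : markov_semigroup P) (niceA : nice_algebra P mu A) (diffP : diffusion P A).
Implicit Types (f g : E -> R) (u z e s t k h M p q r X : R) (x y : E).

Local Notation L := (generator P).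
Local Notation Gam := (Gamma P).

Lemma shift_bounded_below f e : A f -> 0 < e -> (forall y, 0 <= f y) ->
  A (fun y => f y + e) /\ bounded_below (fun y => f y + e).
Proof.
move=> Af e0 f0; split; first by apply: (na_add niceA) => //; exact: (A_const niceA).
by exists e => // y; rewrite lerDr.
Qed.

Lemma P_shift f t e x : 0 <= t -> A f -> P t (fun y => f y + e) x = P t f x + e.
Proof.
move=> t0 Af; rewrite (P_add msP)// ?(P_const msP)//.
  exact: (A_bounded_measurable niceA).
exact: bounded_measurable_cst.
Qed.

Lemma bounded_measurable_uln f : bounded_measurable f -> (forall y, 0 < f y) ->
  bounded_measurable (fun y => f y * ln (f y)).
Proof.
move=> [mf [M fM]] f0; split.
  apply: measurable_funM => //; exact: measurableT_comp (@measurable_ln R) mf.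
exists (1 + M ^+ 2) => y; apply: norm_uln_le => //.
exact: le_trans (ler_norm _) (fM y).
Qed.

Lemma bounded_measurable_powR f p : bounded_measurable f -> (forall y, 0 <= f y) ->
  0 < p -> bounded_measurable (fun y => f y `^ p).
Proof.
move=> [mf [M fM]] f0 p0; split.
  exact: measurableT_comp (measurable_powR p) mf.
have fM' y : f y <= M by exact: le_trans (ler_norm _) (fM y).
exists (M `^ p) => y; rewrite ger0_norm ?powR_ge0//.
have M0 := le_trans (f0 y) (fM' y).
by apply: ge0_ler_powR; rewrite ?nnegrE ?(ltW p0).
Qed.

(** Since [e ln e] is of order [k] when [e = k ^ 2], the error vanishes with [k]. *)
Lemma Ent_shift_ge f t x k : A f -> (forall y, 0 < f y) -> 0 <= t -> 0 < k ->
  Ent P t f x <= Ent P t (fun y => f y + k ^+ 2) x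
    + (k ^+ 2 + k ^+ 2 * (P t f x + k ^+ 2) + 2 * k).
Proof.
move=> Af f0 t0 k0; set e := k ^+ 2; have e0 : 0 < e by rewrite exprn_gt0.
have bf := A_bounded_measurable niceA Af.
have [Ae be] := shift_bounded_below Af e0 (fun y => ltW (f0 y)).
have v0 : 0 <= P t f x by apply: (ms_positive msP) => // y; exact: ltW.
rewrite /Ent P_shift//; set v := P t f x in v0 *.
have h1 : P t (fun y => f y * ln (f y)) x <=
    P t (fun y => (f y + e) * ln (f y + e)) x - e * ln e.
  have bc := bounded_measurable_cst (E := E) (e * ln e).
  have bfe : bounded_measurable (fun y => (f y + e) * ln (f y + e)).
    by apply: (A_bounded_measurable niceA); exact: (A_entropy niceA).
  rewrite -(P_const msP (e * ln e) x t0) -(P_sub msP)//.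
  apply: (P_le msP) => //.
  - exact: bounded_measurable_uln.
  - exact: bounded_measurable_sub.
  move=> y; have fe : f y <= f y + e by rewrite lerDl ltW.
  have := uln_le (ltW (f0 y)) fe.
  have ef : e <= f y + e by rewrite lerDr ltW.
  have := uln_le (ltW e0) ef; lra.
have h2 := uln_ge v0 e0.
have h3 : e * ln (v + e) <= e * (v + e).
  by rewrite ler_pM2l// ltW// ln_sublinear// ltr_wpDl.
have h4 : - (e * ln e) <= 2 * k.
  have : ln k^-1 <= k^-1 by rewrite ltW// ln_sublinear// invr_gt0.
  rewrite lnV ?posrE// /e lnXn// -(ler_pM2l e0) => h.
  have : k ^+ 2 * k^-1 = k by field; rewrite gt_eqF.
  by move: h; rewrite /e mulr2n; lra.
lra.
Qed.

Lemma extP_ge0 t (F : E -> \bar R) x : 0 <= t -> (forall y, 0 <= F y)%E ->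
  (0 <= extP P t F x)%E.
Proof.
move=> t0 F0; apply: ereal_sup_ubound; exists (fun=> 0); last by rewrite (P_const msP).
by split; [exact: bounded_measurable_cst|move=> y; split].
Qed.

Lemma P_le_extP t g (F : E -> \bar R) x : bounded_measurable g ->
  (forall y, 0 <= g y)%R -> (forall y, (g y)%:E <= F y)%E ->
  ((P t g x)%:E <= extP P t F x)%E.
Proof. by move=> bg g0 gF; apply: ereal_sup_ubound; exists g. Qed.

Lemma log_sobolev_positive :
  (forall f t x, A f -> bounded_below f -> 0 <= t -> log_sobolev_at P rho f t x) ->
  local_log_sobolev P A rho.
Proof.
move=> lsi f t x [Af f0] t0; set X := extP _ _ _ _.
have G0 y : 0 <= Gam f f y by exact: (Gamma_ge0 msP niceA).
have X0 : (0 <= X)%E.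
  by apply: extP_ge0 => // y; rewrite lee_fin divr_ge0// ltW.
have c0 : 0 <= log_sobolev_const rho t.
  move: t0; rewrite le_eqVlt => /predU1P[<-|/(log_sobolev_const_gt0 rho)/ltW//].
  by rewrite log_sobolev_const0.
set c := log_sobolev_const rho t in c0 *.
have key k : 0 < k -> ((Ent P t (fun y => f y + k ^+ 2) x)%:E <= c%:E * X)%E.
  move=> k0; have e0 : 0 < k ^+ 2 by rewrite exprn_gt0.
  have [Ae be] := shift_bounded_below Af e0 (fun y => ltW (f0 y)).
  have fe0 y : 0 < f y + k ^+ 2 by rewrite addr_gt0.
  set fe := (fun y => f y + k ^+ 2) in Ae be fe0 *.
  have GE : Gam fe fe = Gam f f.
    have Ac := A_const niceA (k ^+ 2).
    have GE v : A v -> Gam fe v = Gam f v.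
      move=> Av; rewrite /fe (Gamma_add msP niceA)// (Gamma_const msP niceA)//.
      by apply/funext => y; rewrite addr0.
    by rewrite GE// GammaC GE.
  have := lsi fe t x Ae be t0; rewrite /log_sobolev_at -/c -lee_fin => /le_trans; apply.
  rewrite EFinM lee_wpmul2l// ?lee_fin//; apply: P_le_extP.
  - by apply: (A_bounded_measurable niceA); exact: (A_fisher niceA).
  - move=> y; rewrite GE divr_ge0//; exact: ltW (fe0 y).
  - move=> y; rewrite GE lee_fin ler_wpM2l// lef_pV2 ?posrE ?f0 ?fe0//.
    by rewrite /fe lerDl ltW.
have [cX|cX] := eqVneq (c%:E * X)%E +oo%E; first by rewrite cX leey.
have cXfin : (c%:E * X)%E \is a fin_num.
  rewrite ge0_fin_numE ?mule_ge0 ?lee_fin//; first by rewrite lt_neqAle cX leey.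
rewrite -(fineK cXfin) lee_fin -subr_ge0; set b := fine _.
pose v := P t f x.
pose G k := b + (k * k + k * k * (v + k * k) + 2 * k) - Ent P t f x.
have -> : b - Ent P t f x = G 0 by rewrite /G; ring.
apply: (ge0_right_limit (r := 1)) => // [|k /andP[k0 _]].
  have d0 := is_derive_var (0 : R); have dk := is_derive_mul d0 d0.
  exact: is_derive_continuous (is_derive_sub (is_derive_add (is_derive_const b 0)
    (is_derive_add (is_derive_add dk (is_derive_mul dk (is_derive_add
    (is_derive_const v 0) dk))) (is_derive_scale 2 d0))) (is_derive_const (Ent P t f x) 0)).
have := Ent_shift_ge x Af f0 t0 k0; have := key k k0.
rewrite -(fineK cXfin) lee_fin -/b -/v /G expr2; lra.
Qed.

Definition rPnorm t p f x : R := (P t (fun y => f y `^ p) x) `^ p^-1.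

Lemma Pnorm_pos t p f x : 0 <= t -> 0 < p -> bounded_measurable f ->
  (forall y, 0 <= f y) -> Pnorm P t p f x = (rPnorm t p f x)%:E.
Proof.
move=> t0 p0 bf f0.
have eE (a u : R) : 0 < a -> epow u%:E a = (u `^ a)%:E.
  by move=> a0; rewrite /epow ltW// poweR_EFin.
rewrite /Pnorm.
have -> : (fun y => epow (f y)%:E p) = fun y => (f y `^ p)%:E.
  by apply/funext => y; rewrite eE.
rewrite extP_bounded//; first by rewrite eE ?invr_gt0.
  exact: bounded_measurable_powR.
by move=> y; exact: powR_ge0.
Qed.

Lemma Pnorm_rPnorm t p f x : A f -> bounded_below f -> 0 <= t -> p != 0 ->
  Pnorm P t p f x = (rPnorm t p f x)%:E.
Proof.
move=> Af bf t0 p0; rewrite (Pnorm_bounded_below msP niceA)// /rPnorm.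
have fE : (fun y => f y `^ p) = fun y => expR (p * ln (f y)).
  by apply/funext => y; rewrite powR_gt0E// bounded_below_gt0.
rewrite fE powR_gt0E; first by rewrite mulrC.
apply: (P_gt0 msP niceA) => //; first exact: (A_power niceA).
exact: (bounded_below_power niceA).
Qed.

Lemma rPnorm_le t p f g x : 0 <= t -> 0 < p -> bounded_measurable f ->
  bounded_measurable g -> (forall y, 0 <= f y <= g y) ->
  rPnorm t p f x <= rPnorm t p g x.
Proof.
move=> t0 p0 bf bg fg.
have f0 y : 0 <= f y by case/andP: (fg y).
have g0 y : 0 <= g y by case/andP: (fg y) => ? ?; exact: le_trans (f0 y) _.
have bfp := bounded_measurable_powR bf f0 p0.
have bgp := bounded_measurable_powR bg g0 p0.
apply: ge0_ler_powR; rewrite ?nnegrE ?invr_ge0 ?(ltW p0)//.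
- by apply: (ms_positive msP) => // y; exact: powR_ge0.
- by apply: (ms_positive msP) => // y; exact: powR_ge0.
apply: (P_le msP) => // y; apply: ge0_ler_powR; rewrite ?nnegrE ?(ltW p0)//.
by case/andP: (fg y).
Qed.

(** The norm of [f + e] is right continuous in [e] at zero: by [powR_perturb] the
    perturbation costs a factor close to one and a small constant. *)
Lemma rPnorm_right_limit t p f x X : 0 <= t -> 0 < p -> bounded_measurable f ->
  (forall y, 0 <= f y) -> 0 <= X ->
  (forall e, 0 < e -> X <= rPnorm t p (fun y => f y + e) x) ->
  X <= rPnorm t p f x.
Proof.
move=> t0 p0 bf f0 X0 H; have bfp := bounded_measurable_powR bf f0 p0.
set a := P t (fun y => f y `^ p) x.
have a0 : 0 <= a by apply: (ms_positive msP) => // y; exact: powR_ge0.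
suff Xa : X `^ p <= a.
  rewrite -(@powRK R X p) ?gt_eqF//.
  by apply: ge0_ler_powR; rewrite ?nnegrE ?invr_ge0 ?powR_ge0 ?(ltW p0).
rewrite -subr_ge0; pose G k := (1 + k) `^ p * a + k - X `^ p.
have -> : a - X `^ p = G 0 by rewrite /G !addr0 powR1 mul1r.
apply: (ge0_right_limit (r := 1)) => // [|k /andP[k0 _]].
  apply: cvgB; last exact: cvg_cst.
  apply: cvgD; last exact: cvg_id.
  by apply: cvgM; [exact: cvg_powR1D|exact: cvg_cst].
rewrite subr_ge0; have [e e0 He] := powR_perturb p0 k0.
have be := bounded_measurable_add bf (bounded_measurable_cst e).
have fe0 y : 0 <= f y + e by rewrite addr_ge0// ltW.
have bep := bounded_measurable_powR be fe0 p0.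
have Pe0 : 0 <= P t (fun y => (f y + e) `^ p) x.
  by apply: (ms_positive msP) => // y; exact: powR_ge0.
apply: (@le_trans _ _ (P t (fun y => (f y + e) `^ p) x)).
  rewrite -[leRHS](@powRK R _ p^-1)// ?invr_eq0 ?gt_eqF// invrK.
  by apply: ge0_ler_powR; rewrite ?nnegrE ?powR_ge0 ?(ltW p0)//; exact: H.
have bc := bounded_measurable_cst (E := E) k.
have bs := bounded_measurable_scale ((1 + k) `^ p) bfp.
rewrite -(P_scale msP)// -{2}(P_const msP k x t0) -(P_add msP)//.
apply: (P_le msP) => // [|y]; first exact: bounded_measurable_add.
exact: He.
Qed.

End PositiveFunctions.

Section Hypercontractivity.
Context {d : measure_display} {E : measurableType d} {R : realType}.
Context {P : R -> (E -> R) -> E -> R} {mu : {measure set E -> \bar R}}.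
Context {A : set (E -> R)} {rho : R}.
Context (msP : markov_semigroup P) (niceA : nice_algebra P mu A) (diffP : diffusion P A).
Implicit Types (f g : E -> R) (q : R -> R) (u z e s t k h M p r X : R) (x y : E).

Lemma rPnorm_log_Pnorm f t q z x : A f -> bounded_below f -> 0 <= z -> z <= t ->
  q z != 0 -> rPnorm (P := P) z (q z) (P (t - z) f) x = expR (log_Pnorm P f t q x z).
Proof.
move=> Af bf z0 zt qz; have tz : 0 <= t - z by rewrite subr_ge0.
apply/EFin_inj; rewrite -(Pnorm_log_Pnorm msP niceA)//.
rewrite (Pnorm_rPnorm msP niceA)//; first exact: (na_semigroup niceA).
exact: (bounded_below_P msP niceA).
Qed.

Lemma path_exponent_start s t p (p' : R) : 0 < s -> p != 1 ->
  (p' - 1) / (p - 1) = hypercontractivity_ratio rho s t ->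
  path_exponent rho t p s = p'.
Proof. by move=> s0 p1 pE; rewrite path_exponentE// -pE; field; rewrite subr_eq0. Qed.

Hypothesis lsi : forall f t x, A f -> bounded_below f -> 0 <= t ->
  log_sobolev_at P rho f t x.

Let path_ends f s t p (p' : R) x : A f -> bounded_below f -> 0 < s -> s <= t ->
  p != 0 -> p' != 0 -> p != 1 ->
  (p' - 1) / (p - 1) = hypercontractivity_ratio rho s t ->
  rPnorm (P := P) s p' (P (t - s) f) x =
    expR (log_Pnorm P f t (path_exponent rho t p) x s) /\
  rPnorm (P := P) t p f x = expR (log_Pnorm P f t (path_exponent rho t p) x t).
Proof.
move=> Af bf s0 st p0 p'0 p1 ratio; have t0 := lt_le_trans s0 st.
have ps := path_exponent_start s0 p1 ratio.
have pt := path_exponent_end (rho := rho) p t0.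
have := rPnorm_log_Pnorm (q := path_exponent rho t p) x Af bf (ltW s0) st.
have := rPnorm_log_Pnorm (q := path_exponent rho t p) x Af bf (ltW t0) (lexx t).
rewrite ps pt subrr (ms_zero msP); last exact: (A_bounded_measurable niceA).
by move=> /(_ p0) Et /(_ p'0) Es.
Qed.

Lemma hypercontractivity_bounded_below f s t p (p' : R) x : A f -> bounded_below f ->
  0 < s -> s <= t -> 1 < p -> p <= p' ->
  (p' - 1) / (p - 1) = hypercontractivity_ratio rho s t ->
  rPnorm (P := P) s p' (P (t - s) f) x <= rPnorm (P := P) t p f x.
Proof.
move=> Af bf s0 st p1 pp' ratio.
have p0 : 0 < p by apply: lt_trans p1.
have p'0 : 0 < p' by apply: lt_le_trans pp'.
have [|||-> ->] := path_ends x Af bf s0 st _ _ _ ratio; rewrite ?gt_eqF//.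
by rewrite ler_expR; exact: log_sobolev_path_le msP niceA diffP lsi _ _ _ _ _ _ _ _ _ _.
Qed.

Lemma reverse_hypercontractivity_bounded_below f s t p (p' : R) x : A f ->
  bounded_below f -> 0 < s -> s <= t -> p < 1 -> p != 0 -> p' != 0 ->
  (p < 0 \/ 0 < p') ->
  (p' - 1) / (p - 1) = hypercontractivity_ratio rho s t ->
  rPnorm (P := P) t p f x <= rPnorm (P := P) s p' (P (t - s) f) x.
Proof.
move=> Af bf s0 st p1 p0 p'0 ppos ratio.
have p1n : p != 1 by rewrite lt_eqF.
have [-> ->] := path_ends x Af bf s0 st p0 p'0 p1n ratio.
rewrite ler_expR; apply: (log_sobolev_path_ge msP niceA diffP lsi) => //.
by rewrite (path_exponent_start s0 p1n ratio).
Qed.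

Lemma P_positive f t : A f -> (forall y, 0 < f y) -> 0 <= t ->
  bounded_measurable (P t f) /\ forall y, 0 <= P t f y.
Proof.
move=> Af f0 t0; have bf := A_bounded_measurable niceA Af; split.
  exact: (ms_bounded_measurable msP).
by move=> y; apply: (ms_positive msP) => // z; exact: ltW.
Qed.

Lemma hypercontractivity_positive : local_hypercontractivity P A rho.
Proof.
move=> s t p p' s0 st p1 pp' ratio f x [Af f0]; have t0 := lt_le_trans s0 st.
have ts : 0 <= t - s by rewrite subr_ge0.
have p0 : 0 < p by apply: lt_trans p1.
have p'0 : 0 < p' by apply: lt_le_trans pp'.
have bf := A_bounded_measurable niceA Af.
have f0' y : 0 <= f y := ltW (f0 y).
have [bg g0] := P_positive Af f0 ts.
rewrite (Pnorm_pos msP x (ltW s0) p'0 bg g0) (Pnorm_pos msP x (ltW t0) p0 bf f0') lee_fin.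
apply: (rPnorm_right_limit msP (ltW t0) p0 bf f0' (powR_ge0 _ _)) => e e0.
have [Ae be] := shift_bounded_below niceA Af e0 f0'.
apply: le_trans (hypercontractivity_bounded_below x Ae be s0 st p1 pp' ratio).
apply: (rPnorm_le msP x (ltW s0) p'0 bg).
  exact/(A_bounded_measurable niceA)/(na_semigroup niceA).
by move=> y; rewrite g0/= (P_shift msP niceA)// lerDl ltW.
Qed.

Lemma reverse_hypercontractivity_positive_exponent f s t p (p' : R) x :
  positive_in A f -> 0 < s -> s <= t -> 0 < p' -> p' <= p -> p < 1 ->
  (p' - 1) / (p - 1) = hypercontractivity_ratio rho s t ->
  (Pnorm P t p f x <= Pnorm P s p' (P (t - s) f) x)%E.
Proof.
move=> [Af f0] s0 st p'0 pp' p1 ratio; have t0 := lt_le_trans s0 st.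
have ts : 0 <= t - s by rewrite subr_ge0.
have p0 : 0 < p by exact: lt_le_trans pp'.
have bf := A_bounded_measurable niceA Af.
have f0' y : 0 <= f y := ltW (f0 y).
have [bg g0] := P_positive Af f0 ts.
rewrite (Pnorm_pos msP x (ltW s0) p'0 bg g0) (Pnorm_pos msP x (ltW t0) p0 bf f0') lee_fin.
apply: (rPnorm_right_limit msP (ltW s0) p'0 bg g0 (powR_ge0 _ _)) => e e0.
have [Ae be] := shift_bounded_below niceA Af e0 f0'.
have gE : (fun y => P (t - s) f y + e) = P (t - s) (fun y => f y + e).
  by apply/funext => y; rewrite (P_shift msP niceA).
rewrite gE; apply: (@le_trans _ _ (rPnorm (P := P) t p (fun y => f y + e) x)).
  apply: (rPnorm_le msP x (ltW t0) p0 bf).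
    exact: (A_bounded_measurable niceA).
  by move=> y; rewrite f0'/= lerDl ltW.
apply: reverse_hypercontractivity_bounded_below; rewrite ?gt_eqF//.
by right.
Qed.

Lemma epow_ge0 (a : \bar R) p : (0 <= a)%E -> (0 <= epow a p)%E.
Proof. by move=> a0; rewrite /epow; case: ifP => _; rewrite ?inve_ge0 poweR_ge0. Qed.

Lemma epow0_neg p : p < 0 -> epow (0 : R)%:E p = +oo%E.
Proof.
move=> p0; rewrite /epow ifN -?ltNge//.
by rewrite poweR_EFin powR0 ?inve0// oppr_eq0 lt_eqF.
Qed.

Lemma epowy_neg p : p < 0 -> epow +oo%E p = 0%E.
Proof.
move=> p0; rewrite /epow ifN -?ltNge//.
by rewrite poweRyr ?invey// oppr_eq0 lt_eqF.
Qed.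

Lemma epow_pos p u : 0 < u -> epow u%:E p = (u `^ p)%:E.
Proof. exact: epow_EFin. Qed.

(** With a negative exponent the powers of [f + e] increase to those of [f] as [e]
    decreases to zero, but [P_s] need not be continuous along increasing sequences.
    A bounded function below the limit power is below the power of [max g c] for a
    constant [c > 0], and there [g + e] is at most [1 + e / c] times [max g c]. *)
Lemma reverse_hypercontractivity_negative_exponent f s t p (p' : R) x :
  positive_in A f -> 0 < s -> s <= t -> p' <= p -> p < 0 ->
  (p' - 1) / (p - 1) = hypercontractivity_ratio rho s t ->
  (Pnorm P t p f x <= Pnorm P s p' (P (t - s) f) x)%E.
Proof.
move=> [Af f0] s0 st pp' p0 ratio; have t0 := lt_le_trans s0 st.
have ts : 0 <= t - s by rewrite subr_ge0.
have p'0 : p' < 0 by exact: le_lt_trans pp' p0.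
have bf := A_bounded_measurable niceA Af.
have f0' y : 0 <= f y := ltW (f0 y).
have [bg g0] := P_positive Af f0 ts.
set g := P (t - s) f in bg g0 *.
rewrite /Pnorm; set a := extP P t _ x; set b := extP P s _ x.
have Pe e : 0 < e -> A (fun y => f y + e) /\ bounded_below (fun y => f y + e).
  by move=> e0; exact: (shift_bounded_below niceA).
have gE e : P (t - s) (fun y => f y + e) = fun y => g y + e.
  by apply/funext => y; rewrite (P_shift msP niceA).
pose F e := P t (fun y => (f y + e) `^ p) x.
pose G e := P s (fun y => (g y + e) `^ p') x.
have powE (w : E -> R) r : bounded_below w ->
    (fun y => w y `^ r) = fun y => expR (r * ln (w y)).
  by move=> bw; apply/funext => y; rewrite powR_gt0E// bounded_below_gt0.
have F0 e : 0 < e -> 0 < F e.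
  move=> /Pe[Ae be]; rewrite /F powE//; apply: (P_gt0 msP niceA); rewrite ?(ltW t0)//.
    exact: (A_power niceA).
  exact: (bounded_below_power niceA).
have Age e : 0 < e -> A (fun y => g y + e) /\ bounded_below (fun y => g y + e).
  move=> /Pe[Ae be]; rewrite -gE; split; first exact: (na_semigroup niceA).
  exact: (bounded_below_P msP niceA).
have AGe e : 0 < e -> A (fun y => (g y + e) `^ p').
  by move=> /Age[Ae be]; rewrite powE//; exact: (A_power niceA).
have G0 e : 0 < e -> 0 < G e.
  move=> /Age[Ae be]; rewrite /G powE//; apply: (P_gt0 msP niceA); rewrite ?(ltW s0)//.
    exact: (A_power niceA).
  exact: (bounded_below_power niceA).
have bounded_case e : 0 < e -> F e `^ p^-1 <= G e `^ p'^-1.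
  move=> /Pe[Ae be]; rewrite /F /G.
  have := reverse_hypercontractivity_bounded_below x Ae be s0 st (lt_trans p0 ltr01)
    (ltr0_neq0 p0) (ltr0_neq0 p'0) (or_introl p0) ratio.
  by rewrite /rPnorm gE.
have Fa e : 0 < e -> ((F e)%:E <= a)%E.
  move=> e0; have [Ae be] := Pe e e0; apply: P_le_extP.
  - rewrite powE//; apply: (A_bounded_measurable niceA); exact: (A_power niceA).
  - by move=> y; exact: powR_ge0.
  - move=> y; rewrite epow_pos// lee_fin; apply: le_powR_neg => //; last exact: ltW.
    by rewrite lerDl ltW.
have Gb e : 0 < e -> ((G e)%:E <= b)%E.
  move=> e0; apply: P_le_extP.
  - by apply: (A_bounded_measurable niceA); exact: AGe.
  - by move=> y; exact: powR_ge0.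
  - move=> y; have := g0 y; rewrite le_eqVlt => /predU1P[<-|gy].
      by rewrite epow0_neg// leey.
    rewrite epow_pos// lee_fin; apply: le_powR_neg => //; last exact: ltW.
    by rewrite lerDl ltW.
have a1 : (0 < a)%E by apply: lt_le_trans (Fa 1 ltr01); rewrite lte_fin F0.
have b1 : (0 < b)%E by apply: lt_le_trans (Gb 1 ltr01); rewrite lte_fin G0.
have pV : p^-1 < 0 by rewrite invr_lt0.
case: (eqVneq a +oo%E) => [->|ay].
  by rewrite epowy_neg//; apply: epow_ge0; exact: ltW.
have afin : a \is a fin_num by rewrite ge0_fin_numE ?(ltW a1)// lt_neqAle ay leey.
rewrite -(fineK afin) in a1 Fa *; set c := fine a in a1 Fa *.
have c0 : 0 < c by [].
have GF e : 0 < e -> G e <= c `^ (p' / p).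
  move=> e0; have Fc : F e <= c by have := Fa e e0; rewrite lee_fin.
  apply: le_trans (powR_inv_le_neg (F0 e e0) (G0 e e0) p'0 (bounded_case e e0)) _.
  have pp'0 : 0 <= p' / p by apply: mulr_le0; [exact: ltW|exact: ltW].
  by apply: ge0_ler_powR => //; rewrite nnegrE; [exact: ltW (F0 e e0)|exact: ltW].
have bc : (b <= (c `^ (p' / p))%:E)%E.
  apply: ge_ereal_sup => _ [h [bh hg] <-]; rewrite lee_fin.
  have [mh [N hN]] := bh; pose M := `|N| + 1.
  have M0 : 0 < M by rewrite ltr_wpDl.
  have hM y : h y <= M.
    apply: le_trans (ler_norm _) _; apply: le_trans (hN y) _.
    by have := ler_norm N; rewrite /M; lra.
  pose k := M `^ p'^-1; have k0 : 0 < k by exact: powR_gt0.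
  have kM : k `^ p' = M by rewrite /k -powRrM mulVf ?ltr0_neq0// powRr1 ?ltW.
  have hmax y : h y <= (Num.max (g y) k) `^ p'.
    have [gk|kg] := leP (g y) k; first by rewrite kM.
    have gy : 0 < g y by exact: lt_trans kg.
    by have [_] := hg y; rewrite epow_pos.
  rewrite -subr_ge0; pose H z := c `^ (p' / p) - (1 + z) `^ p' * P s h x.
  have -> : c `^ (p' / p) - P s h x = H 0 by rewrite /H addr0 powR1 mul1r.
  apply: (ge0_right_limit (r := 1)) => // [|z /andP[z0 _]].
    apply: cvgB; first exact: cvg_cst.
    by apply: cvgM; [exact: cvg_powR1D|exact: cvg_cst].
  have e0 : 0 < k * z by rewrite mulr_gt0.
  rewrite subr_ge0; apply: le_trans (GF _ e0).
  rewrite -(P_scale msP) ?(ltW s0)//; apply: (P_le msP); rewrite ?(ltW s0)//.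
  - exact: bounded_measurable_scale.
  - by apply: (A_bounded_measurable niceA); exact: AGe.
  move=> y; have m0 : 0 < Num.max (g y) k by rewrite lt_max k0 orbT.
  have z1 : 0 < 1 + z by rewrite addr_gt0.
  apply: (@le_trans _ _ ((1 + z) `^ p' * (Num.max (g y) k) `^ p')).
    by rewrite ler_wpM2l ?powR_ge0.
  rewrite -powRM ?(ltW z1) ?(ltW m0)//; apply: le_powR_neg; rewrite ?(ltW p'0)//.
    by rewrite ltr_wpDl.
  rewrite mulrDl mul1r; apply: lerD; first by rewrite le_max lexx.
  by rewrite mulrC ler_wpM2l ?(ltW z0)// le_max lexx orbT.
have bfin : b \is a fin_num.
  by rewrite ge0_fin_numE ?(ltW b1)//; exact: le_lt_trans bc (ltry _).
rewrite -(fineK bfin) in b1 bc *; set B := fine b in b1 bc *.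
have B0 : 0 < B by [].
rewrite !epow_pos// lee_fin; rewrite lee_fin in bc.
have -> : c `^ p^-1 = (c `^ (p' / p)) `^ p'^-1.
  by rewrite -powRrM; congr (_ `^ _); field; rewrite !ltr0_neq0.
by apply: le_powR_neg => //; rewrite invr_le0 ltW.
Qed.

Lemma reverse_hypercontractivity_positive : local_reverse_hypercontractivity P A rho.
Proof.
move=> s t p p' s0 st [[p'0 [pp' p1]]|[pp' p0]] ratio f x pf.
  exact: reverse_hypercontractivity_positive_exponent.
exact: reverse_hypercontractivity_negative_exponent.
Qed.

End Hypercontractivity.

(** * The equivalence *)

Theorem theorem3p1 (d : measure_display) (E : measurableType d) (R : realType)
    (P : R -> (E -> R) -> E -> R) (mu : {measure set E -> \bar R})
    (A : set (E -> R)) (rho : R)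
    (msP : markov_semigroup P) (refmu : reference_measure P mu)
    (niceA : nice_algebra P mu A) (diffP : diffusion P A) :
  [<-> curvature_dimension P A rho ;
       local_log_sobolev P A rho ;
       local_hypercontractivity P A rho ;
       local_reverse_hypercontractivity P A rho ].
Proof.
tfae.
- move=> cd; apply: (log_sobolev_positive msP niceA) => f t x Af bf t0.
  exact: (curvature_log_sobolev_at msP niceA diffP).
- move=> lsi; apply: (hypercontractivity_positive msP niceA diffP).
  exact: (local_log_sobolev_bounded_below msP niceA).
- move=> hyp; apply: (reverse_hypercontractivity_positive msP niceA diffP).
  exact: (hypercontractivity_log_sobolev msP niceA diffP).
- move=> rhyp; apply: (log_sobolev_curvature msP niceA diffP).
  exact: (reverse_hypercontractivity_log_sobolev msP niceA diffP).
Qed.
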